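(* Let $n\ge1$, $\sigma\in(1,2]$, $s\ge0$ and $m\in[1,2]$. Assume $(|D|^2u_0,u_1,\theta_0)\in L^m(\mathbb{R}^n)\times L^m(\mathbb{R}^n)\times L^m(\mathbb{R}^n)$. Let $w^{(0)}$ be the solution of the system (S) and $\tilde w$ the solution of the reference system (R) given in the context. Then, for all $t\ge0$, $$\left\|\chi_{\mathrm{int}}(D)\mathcal{F}^{-1}_{\xi\to x}\left(w^{(0)}-T_0\tilde w\right)(t,\cdot)\right\|_{\dot H^s(\mathbb{R}^n)}\lesssim(1+t)^{-\frac{(2-m)n+2ms}{4m}-(\sigma-1)}\left\|\left(|D|^2u_0,u_1,\theta_0\right)\right\|_{\left(L^m(\mathbb{R}^n)\right)^3}.$$
   Context: System (S): $$w^{(0)}_t+\left(|\xi|^2A_0+|\xi|^{2\sigma}A_1\right)w^{(0)}=0,\quad t>0,\ \xi\in\mathbb{R}^n,\qquad w^{(0)}(0,\xi)=w^{(0)}_0(\xi):=\left(\hat u_1+|\xi|^2\hat u_0,\;\hat u_1-|\xi|^2\hat u_0,\;\hat\theta_0\right)^{\mathrm T},$$ $$A_0=\tfrac12\begin{pmatrix}0&-2&-2\\2&0&-2\\1&1&2\end{pmatrix},\qquad A_1=\tfrac12\begin{pmatrix}1&1&0\\1&1&0\\0&0&0\end{pmatrix}.$$ It is the Fourier transform in $x$ of the thermoelastic plate problem $u_{tt}+\Delta^2u+\Delta\theta+(-\Delta)^\sigma u_t=0$, $\theta_t-\Delta\theta-\Delta u_t=0$, $(u,u_t,\theta)(0,\cdot)=(u_0,u_1,\theta_0)$,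 with $w^{(0)}=(\hat u_t+|\xi|^2\hat u,\hat u_t-|\xi|^2\hat u,\hat\theta)^{\mathrm T}$. $y_1,y_2,y_3$ are the three (distinct) solutions of $y^3-y^2+2y-1=0$, namely $$y_1=\tfrac13(1+z_1),\quad y_2=\tfrac13\left(1-\tfrac12z_1+\tfrac{\sqrt3}{2}iz_2\right),\quad y_3=\tfrac13\left(1-\tfrac12z_1-\tfrac{\sqrt3}{2}iz_2\right),$$ $$z_1=\sqrt[3]{\tfrac12(3\sqrt{69}+11)}-\sqrt[3]{\tfrac12(3\sqrt{69}-11)},\qquad z_2=\sqrt[3]{\tfrac12(3\sqrt{69}+11)}+\sqrt[3]{\tfrac12(3\sqrt{69}-11)}.$$ $T_0$ is a constant invertible matrix with $T_0^{-1}A_0T_0=\mathrm{diag}(y_1,y_2,y_3)$. Reference system (R): $$\tilde w_t+\mathrm{diag}(y_1,y_2,y_3)|\xi|^2\tilde w=0,\qquad\tilde w(0,\xi)=T_0^{-1}w^{(0)}_0(\xi).$$ $\chi_{\mathrm{int}}\in\mathcal{C}^\infty(\mathbb{R}^n)$ is a cut-off function with values in $[0,1]$ supported in $\{|\xi|\le\varepsilon\}$, $0<\varepsilon\ll1$ fixed sufficiently small, equal to $1$ for $|\xi|\le\varepsilon/2$; $\chi_{\mathrm{int}}(D)$ is the Fourier multiplier with symbol $\chi_{\mathrm{int}}$. $|D|^s$ has symbol $|\xi|^s$ and $\|f\|_{\dot H^s}=\||D|^sf\|_{L^2}$. $f\lesssim g$ means $f\le Cg$ with a constant $C>0$ independent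 of $t$ and of the initial data. *)

(* Defs.v *)
From HB Require Import structures.
From mathcomp Require Import all_boot all_order all_algebra.
From mathcomp Require Import all_classical all_reals all_analysis.
From mathcomp Require Import complex.
Set Implicit Arguments.
Unset Strict Implicit.
Unset Printing Implicit Defensive.
Import Order.TTheory GRing.Theory Num.Theory.
Import numFieldNormedType.Exports.

Local Open Scope classical_set_scope.
Local Open Scope ring_scope.
Local Open Scope complex_scope.

(* R^n is 'rV[R]_n, with the Borel sigma-algebra (generated by the n
   coordinates). The library norm on 'rV[R]_n is the sup norm; the Euclidean
   norm |x| is [enorm] below. *)

Definition rV_display : measure_display.
Proof. exact: default_measure_display. Qed.

Section measurable_rV.
Variables (R : realType) (n : nat).

Definition rV_coord (i : 'I_n) (x : 'rV[R]_n) : measurableTypeR R := x ord0 i.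

Let rV_set0 : g_sigma_preimage rV_coord set0.
Proof. exact: sigma_algebra0. Qed.

Let rV_setC A : g_sigma_preimage rV_coord A -> g_sigma_preimage rV_coord (~` A).
Proof. exact: sigma_algebraC. Qed.

Let rV_bigcup (F : (set 'rV[R]_n)^nat) :
  (forall i, g_sigma_preimage rV_coord (F i)) ->
  g_sigma_preimage rV_coord (\bigcup_i (F i)).
Proof. exact: sigma_algebra_bigcup. Qed.

HB.instance Definition _ := @isMeasurable.Build rV_display 'rV[R]_n
  (g_sigma_preimage rV_coord) rV_set0 rV_setC rV_bigcup.

End measurable_rV.

Section lebesgue_rV.
Variable R : realType.

Lemma measurable_rV_coord n (i : 'I_n) :
  measurable_fun [set: 'rV[R]_n] (@rV_coord R n i).
Proof.
move=> _ Y mY; rewrite setTI; apply: sub_sigma_algebra => /=.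
rewrite -bigcup_seq/=; exists i => /=; first by rewrite mem_index_enum.
by exists Y => //; rewrite setTI.
Qed.

Lemma measurable_fun_rVP d (T : measurableType d) n (f : T -> 'rV[R]_n) :
  (forall i, measurable_fun [set: T] (@rV_coord R n i \o f)) ->
  measurable_fun [set: T] f.
Proof.
move=> mf.
have : g_sigma_preimage (fun i => @rV_coord R n i \o f) `<=` measurable.
  apply: smallest_sub; first exact: sigma_algebra_measurable.
  move=> A; rewrite -bigcup_seq => -[i _ [B mB <-]].
  exact: mf.
rewrite g_sigma_preimage_comp => prefS.
by move=> _ A mA; apply: prefS; exists A.
Qed.

Definition rV_cons n (p : measurableTypeR R * 'rV[R]_n) : 'rV[R]_n.+1 :=
  row_mx (const_mx (p.1 : R) : 'M[R]_1) p.2.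

Definition rV_uncons n (x : 'rV[R]_n.+1) : measurableTypeR R * 'rV[R]_n :=
  (x ord0 ord0, \row_i x ord0 (lift ord0 i)).

Lemma rV_consK n : cancel (@rV_cons n) (@rV_uncons n).
Proof.
move=> [a y]; rewrite /rV_uncons /rV_cons /=; congr (_, _).
  have := row_mxEl (const_mx (a : R) : 'M[R]_1) y ord0 ord0.
  rewrite [RHS]mxE => E; rewrite -[RHS]E; congr (row_mx _ _ _ _); exact: val_inj.
apply/rowP => i; rewrite mxE.
rewrite -(row_mxEr (const_mx (a : R) : 'M[R]_1) y); congr (row_mx _ _ _ _).
exact: val_inj.
Qed.

Lemma measurable_rV_cons n :
  measurable_fun setT (@rV_cons n).
Proof.
apply: measurable_fun_rVP => i.
have [j ->|->] := unliftP ord0 i.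
  rewrite (_ : _ \o _ = @rV_coord R n j \o snd).
    apply: measurableT_comp; first exact: measurable_rV_coord.
    exact: measurable_snd.
  apply/funext => p /=; rewrite -[in RHS](rV_consK p) /rV_coord /=.
  by rewrite mxE.
rewrite (_ : _ \o _ = fst); first exact: measurable_fst.
by apply/funext => p; rewrite -[in RHS](rV_consK p).
Qed.

Lemma measurable_rV_uncons n : measurable_fun [set: 'rV[R]_n.+1] (@rV_uncons n).
Proof.
apply: measurable_fun_pair; first exact: (measurable_rV_coord ord0).
apply: measurable_fun_rVP => i.
rewrite (_ : _ \o _ = @rV_coord R n.+1 (lift ord0 i)).
  exact: measurable_rV_coord.
by apply/funext => x; rewrite /rV_coord /= mxE.
Qed.

Section step.
Variables (n : nat) (mu : {sigma_finite_measure set 'rV[R]_n -> \bar R}).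

Definition lebesgue_rV_step : set 'rV[R]_n.+1 -> \bar R :=
  pushforward (@lebesgue_measure R \x mu)%E (@rV_cons n).

Let step0 : lebesgue_rV_step set0 = 0%E.
Proof. by rewrite /lebesgue_rV_step /pushforward preimage_set0 measure0. Qed.

Let step_ge0 A : (0 <= lebesgue_rV_step A)%E.
Proof. by rewrite /lebesgue_rV_step /pushforward; exact: measure_ge0. Qed.

Let step_sigma_additive : semi_sigma_additive lebesgue_rV_step.
Proof.
move=> F mF tF mUF; rewrite /lebesgue_rV_step /pushforward preimage_bigcup.
have mc A : measurable A -> measurable (@rV_cons n @^-1` A).
  by move=> mA; rewrite -[X in measurable X]setTI; exact: measurable_rV_cons.
apply: measure_semi_sigma_additive.
- by move=> k; exact: mc.
- apply/trivIsetP => /= i j _ _ ij; rewrite -preimage_setI.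
  by move/trivIsetP : tF => /(_ _ _ _ _ ij) ->//; rewrite preimage_set0.
- by rewrite -preimage_bigcup; exact: mc.
Qed.

HB.instance Definition _ := isMeasure.Build _ _ _ lebesgue_rV_step
  step0 step_ge0 step_sigma_additive.

Let step_sigma_finite : sigma_finite setT lebesgue_rV_step.
Proof.
have /sigma_finiteP[F [TF ndF Foo]] := sigma_finiteT (@lebesgue_measure R).
have /sigma_finiteP[G [TG ndG Goo]] := sigma_finiteT mu.
exists (fun k => @rV_uncons n @^-1` (F k `*` G k)).
  rewrite -preimage_bigcup -[LHS](preimage_setT (@rV_uncons n)); congr (_ @^-1` _).
  rewrite -setXTT TF TG predeqE => -[x y]; split.
    move=> [/= [i _ Fix] [j _ Gjy]]; exists (maxn i j) => //; split.
    - by move: x Fix; exact/subsetPset/ndF/leq_maxl.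
    - by move: y Gjy; exact/subsetPset/ndG/leq_maxr.
  by move=> [i _ []/= ? ?]; split; exists i.
move=> k; have [? ?] := Foo k; have [? ?] := Goo k; split.
  rewrite -[X in measurable X]setTI; apply: measurable_rV_uncons => //.
  exact: measurableX.
rewrite /lebesgue_rV_step /pushforward -comp_preimage.
rewrite (_ : _ \o _ = id) ?preimage_id; last first.
  by apply/funext => p /=; rewrite rV_consK.
by rewrite product_measure1E// lte_mul_pinfty// ge0_fin_numE.
Qed.

HB.instance Definition _ := Measure_isSigmaFinite.Build _ _ _ lebesgue_rV_step
  step_sigma_finite.

End step.

Fixpoint lebesgue_rV n : {sigma_finite_measure set 'rV[R]_n -> \bar R} :=
  match n with
  | 0 => \d_ (0 : 'rV[R]_0)
  | k.+1 => lebesgue_rV_step (lebesgue_rV k)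
  end.

End lebesgue_rV.

Local Notation Re := complex.Re.
Local Notation Im := complex.Im.

Section fourier.
Variables (R : realType) (n : nat).
Local Notation C := R[i].
Local Notation Rn := 'rV[R]_n.

Definition dotr (x y : Rn) : R := \sum_i x ord0 i * y ord0 i.
Definition enorm (x : Rn) : R := Num.sqrt (dotr x x).

Definition cmod (z : C) : R := Num.sqrt (Re z ^+ 2 + Im z ^+ 2).
Definition cvnorm k (v : 'cV[C]_k) : R :=
  Num.sqrt (\sum_i cmod (v i ord0) ^+ 2).

Definition expi (theta : R) : C := cos theta +i* sin theta.

Definition cmeasurable (f : Rn -> C) : Prop :=
  measurable_fun setT (fun x => Re (f x) : measurableTypeR R) /\
  measurable_fun setT (fun x => Im (f x) : measurableTypeR R).

Definition cintegrable (f : Rn -> C) : Prop :=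
  (lebesgue_rV R n).-integrable setT (fun x => (Re (f x))%:E) /\
  (lebesgue_rV R n).-integrable setT (fun x => (Im (f x))%:E).

Definition cintegral (f : Rn -> C) : C :=
  Rintegral (lebesgue_rV R n) setT (fun x => Re (f x)) +i*
  Rintegral (lebesgue_rV R n) setT (fun x => Im (f x)).

Definition Lpnorm (p : R) (f : Rn -> C) : \bar R :=
  Lnorm (lebesgue_rV R n) p%:E (fun x => (cmod (f x))%:E).

Definition in_Lp (p : R) (f : Rn -> C) : Prop :=
  cmeasurable f /\ (Lpnorm p f < +oo)%E.

Definition partial (i : 'I_n) (f : Rn -> R) : Rn -> R :=
  fun x => derive (f : Rn -> R^o) x (delta_mx ord0 i).

Definition partials (s : seq 'I_n) (f : Rn -> R) : Rn -> R :=
  foldr partial f s.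

Definition smooth (f : Rn -> R) : Prop :=
  forall s : seq 'I_n,
    continuous (partials s f : Rn -> R^o) /\
    forall (i : 'I_n) (x : Rn),
      derivable (partials s f : Rn -> R^o) x (delta_mx ord0 i).

(* The Schwartz seminorm of order N of phi is at most M. *)
Definition schwartz_le (N : nat) (phi : Rn -> C) (M : R) : Prop :=
  forall (s : seq 'I_n) (k : nat) (x : Rn), (size s <= N)%N -> (k <= N)%N ->
    enorm x ^+ k * cmod (partials s (fun y => Re (phi y)) x +i*
                         partials s (fun y => Im (phi y)) x) <= M.

Definition schwartz (phi : Rn -> C) : Prop :=
  [/\ smooth (fun x => Re (phi x)), smooth (fun x => Im (phi x))
    & forall N, exists M, schwartz_le N phi M].

(* F f(xi) = \int e^{-i x.xi} f(x) dx and
   F^{-1} g(x) = (2 pi)^{-n} \int e^{i x.xi} g(xi) dxi. *)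
Definition fourier (f : Rn -> C) : Rn -> C :=
  fun xi => cintegral (fun x => expi (- dotr x xi) * f x).

Definition inv_fourier (g : Rn -> C) : Rn -> C :=
  fun x => (((2 * pi) ^- n : R)%:C) *
           cintegral (fun xi => expi (dotr x xi) * g xi).

(* A tempered distribution is a functional on Rn -> C of which only the values
   on Schwartz functions matter. *)
Definition test_functional := (Rn -> C) -> C.

Definition tempered (T : test_functional) : Prop :=
  (forall (c : C) (phi psi : Rn -> C), schwartz phi -> schwartz psi ->
     T (fun x => c * phi x + psi x) = c * T phi + T psi) /\
  exists (N : nat) (K : R), forall (phi : Rn -> C) (M : R),
    schwartz phi -> schwartz_le N phi M -> cmod (T phi) <= K * M.

Definition dist_of (f : Rn -> C) : test_functional :=
  fun phi => cintegral (fun x => f x * phi x).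

Definition dist_mul (a : Rn -> C) (T : test_functional) : test_functional :=
  fun phi => T (fun x => a x * phi x).

Definition dist_fourier (T : test_functional) : test_functional :=
  fun phi => T (fourier phi).

Definition dist_inv_fourier (T : test_functional) : test_functional :=
  fun phi => T (inv_fourier phi).

(* [T] is the regular distribution given by the function [f]. *)
Definition represents (f : Rn -> C) (T : test_functional) : Prop :=
  cmeasurable f /\ forall phi : Rn -> C, schwartz phi ->
    cintegrable (fun x => f x * phi x) /\ T phi = dist_of f phi.

(* [fhat] is the Fourier transform of [f] (for f in L^m, 1 <= m <= 2) in the
   sense of tempered distributions. *)
Definition is_fourier (f fhat : Rn -> C) : Prop :=
  represents fhat (dist_fourier (dist_of f)).

Definition sq_symbol (xi : Rn) : C := (enorm xi ^+ 2)%:C.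

Definition absD2 (T : test_functional) : test_functional :=
  dist_inv_fourier (dist_mul sq_symbol (dist_fourier T)).

Definition inv_fourier_vec k (g : Rn -> 'cV[C]_k) : Rn -> 'cV[C]_k :=
  fun x => \col_j inv_fourier (fun xi => g xi j ord0) x.

(* || F^{-1} g ||_{\dot H^s} = || |D|^s F^{-1} g ||_{L^2}, where
   |D|^s F^{-1} g = F^{-1} (|xi|^s g); the L^2 norm is taken in x, of the
   Hermitian norm of the values. *)
Definition Hdot_norm_inv_fourier k (s : R) (g : Rn -> 'cV[C]_k) : \bar R :=
  Lnorm (lebesgue_rV R n) 2%:E (fun x =>
    (cvnorm (inv_fourier_vec
       (fun xi => ((enorm xi `^ s)%:C : C) *: g xi) x))%:E).

Definition cutoff (eps : R) (chi : Rn -> R) : Prop :=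
  [/\ smooth chi,
      forall xi, 0 <= chi xi <= 1,
      forall xi, eps < enorm xi -> chi xi = 0
    & forall xi, enorm xi <= eps / 2 -> chi xi = 1].

End fourier.

Section system.
Variable R : realType.
Local Notation C := R[i].

Definition mx3 (rows : seq (seq C)) : 'M[C]_3 :=
  \matrix_(i, j) nth 0 (nth [::] rows i) j.

Definition A0 : 'M[C]_3 := 2^-1 *: mx3
  [:: [:: 0; -2; -2];
      [:: 2;  0; -2];
      [:: 1;  1;  2]].

Definition A1 : 'M[C]_3 := 2^-1 *: mx3
  [:: [:: 1; 1; 0];
      [:: 1; 1; 0];
      [:: 0; 0; 0]].

Definition cbrt (x : R) : R := x `^ (3^-1).

Definition z1 : R := cbrt ((3 * Num.sqrt 69 + 11) / 2) - cbrt ((3 * Num.sqrt 69 - 11) / 2).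
Definition z2 : R := cbrt ((3 * Num.sqrt 69 + 11) / 2) + cbrt ((3 * Num.sqrt 69 - 11) / 2).

Definition y1 : C := ((1 + z1) / 3) +i* 0.
Definition y2 : C := ((1 - z1 / 2) / 3) +i* (Num.sqrt 3 / 2 * z2 / 3).
Definition y3 : C := ((1 - z1 / 2) / 3) -i* (Num.sqrt 3 / 2 * z2 / 3).

Definition diagY : 'M[C]_3 := diag_mx (\row_(j < 3) nth 0 [:: y1; y2; y3] j).

Definition diagonalizes (T0 : 'M[C]_3) : Prop :=
  T0 \in unitmx /\ invmx T0 *m A0 *m T0 = diagY.

(* v' + M v = 0 for t > 0 and v(0) = v0, with v continuous on [0, +oo[; the
   derivative is that of the real and imaginary parts of the components. *)
Definition solves_cauchy (M : 'M[C]_3) (v0 : 'cV[C]_3) (v : R -> 'cV[C]_3) : Prop :=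
  [/\ v 0 = v0,
      forall j,
        {within `[0, +oo[, continuous (fun t => Re (v t j ord0) : R^o)} /\
        {within `[0, +oo[, continuous (fun t => Im (v t j ord0) : R^o)}
    & forall t, 0 < t -> forall j,
        is_derive (t : R^o) (1 : R^o) (fun t => Re (v t j ord0) : R^o)
          (- Re ((M *m v t) j ord0)) /\
        is_derive (t : R^o) (1 : R^o) (fun t => Im (v t j ord0) : R^o)
          (- Im ((M *m v t) j ord0))].

Variable n : nat.
Local Notation Rn := 'rV[R]_n.

(* [q] is |xi|^2 \hat u_0, [p] is \hat u_1, [th] is \hat\theta_0. *)
Definition initial_data (q p th : Rn -> C) (xi : Rn) : 'cV[C]_3 :=
  \col_(j < 3) nth 0 [:: p xi + q xi; p xi - q xi; th xi] j.

Definition solves_S (sigma : R) (w0 : Rn -> 'cV[C]_3)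
    (w : R -> Rn -> 'cV[C]_3) : Prop :=
  forall xi, solves_cauchy
    (((enorm xi ^+ 2)%:C : C) *: A0 + ((enorm xi `^ (2 * sigma))%:C : C) *: A1)
    (w0 xi) (w ^~ xi).

Definition solves_R (T0 : 'M[C]_3) (w0 : Rn -> 'cV[C]_3)
    (w : R -> Rn -> 'cV[C]_3) : Prop :=
  forall xi, solves_cauchy (((enorm xi ^+ 2)%:C : C) *: diagY)
    (invmx T0 *m w0 xi) (w ^~ xi).

End system.

(* Main.v *)
Require Import Defs.
From mathcomp Require Import all_boot all_order all_algebra.
From mathcomp Require Import all_classical all_reals all_analysis.
From mathcomp Require Import complex measurable_realfun ring lra.

(* For fixed xi both systems are linear ODEs governed by |xi|^2 A_0, the first
   one with the perturbation |xi|^(2 sigma) A_1. A quadratic form P with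
   P A_0 + A_0^T P = I and Gronwall's inequality give, for small xi,
     |w - T_0 wt| <= C |xi|^(2 (sigma - 1)) exp(- t |xi|^2 / 40) |w_0|,
   and powers of |xi| are traded for powers of (1 + t)^(-1/2) at the expense of
   half of the exponential.
   There remains the L^2 norm of a Gaussian times the Fourier transform of an
   L^m function. Instead of the Hausdorff-Young inequality we use that, by
   Plancherel, it is the norm of the convolution of that function with a
   Gaussian; Young's inequality with exponents m and r, 1/m + 1/r = 3/2, gives
   the remaining decay (1 + t)^(- (2 - m) n / (4 m)). *)

Set Implicit Arguments.
Unset Strict Implicit.
Unset Printing Implicit Defensive.
Import Order.TTheory GRing.Theory Num.Theory.
Import numFieldNormedType.Exports.
Local Open Scope classical_set_scope.
Local Open Scope ring_scope.

(** The transform [fhat] of an L^m function is known only as a distribution. Testing it against the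
    Gaussian waves [wave c x] identifies, for every x, the transform of the integrable function
    [gauss c 0 * fhat] with a Gaussian convolution of [f]. That function is not known beforehand to
    be square integrable, so Plancherel is needed in the direction that bounds a function by its
    transform. It comes from duality with test functions cut out of the function itself, which costs
    a density argument and a factor 2 for the two signs. The opposite direction serves to return
    from frequencies to x. All estimates are real: complex transforms become cosine and sine
    transforms, and since A_0 and A_1 are real, real and imaginary parts of a solution solve the
    same real system. The reference solution enters as [T0 *m wt], which solves the unperturbed
    equation with the same data. Solutions are given separately for each frequency; their
    measurability in xi is recovered from Taylor polynomials in t, whose coefficients are
    polynomials in the matrix and the data. *)

Section integral_facts.
Context d (T : measurableType d) (R : realType) (mu : {measure set T -> \bar R}).

Lemma dominated_integrable_fun (f g : T -> R) : measurable_fun setT f ->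
  (forall x, `|f x| <= g x) -> mu.-integrable setT (EFin \o g) ->
  mu.-integrable setT (EFin \o f).
Proof.
move=> mf fg ig; apply: (le_integrable measurableT _ _ ig) => /=.
  exact/measurable_EFinP.
by move=> x _; rewrite lee_fin (le_trans (fg x))// ler_norm.
Qed.

Lemma integrable_bounded_mul (f g : T -> R) (K : R) : measurable_fun setT f ->
  (forall x, `|f x| <= K) -> mu.-integrable setT (EFin \o g) ->
  mu.-integrable setT (EFin \o (fun x => f x * g x)).
Proof.
move=> mf fK ig.
have mg : measurable_fun setT g by have /integrableP[/measurable_EFinP] := ig.
apply: (@dominated_integrable_fun _ (fun x => K * `|g x|)).
- exact: measurable_funM.
- by move=> x; rewrite normrM ler_wpM2r.
- have -> : EFin \o (fun x => K * `|g x|) = (fun x => K%:E * (abse \o (EFin \o g)) x)%E.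
    by apply/funext => x.
  by apply: integrableZl => //; exact: integrable_abse.
Qed.

Lemma integrable_mul_bounded (f g : T -> R) (K : R) : measurable_fun setT f ->
  (forall x, `|f x| <= K) -> mu.-integrable setT (EFin \o g) ->
  mu.-integrable setT (EFin \o (fun x => g x * f x)).
Proof.
move=> mf fK ig; rewrite (_ : (fun x => g x * f x) = (fun x => f x * g x)).
  exact: integrable_bounded_mul mf fK ig.
by apply/funext => x; rewrite mulrC.
Qed.

Lemma integrable_funD (f g : T -> R) :
  mu.-integrable setT (EFin \o f) -> mu.-integrable setT (EFin \o g) ->
  mu.-integrable setT (EFin \o (fun x => f x + g x)).
Proof.
move=> fi gi; have -> : EFin \o (fun x => f x + g x) = ((EFin \o f) \+ (EFin \o g))%E.
  by apply/funext => x.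
exact: integrableD.
Qed.

Lemma integrable_funB (f g : T -> R) :
  mu.-integrable setT (EFin \o f) -> mu.-integrable setT (EFin \o g) ->
  mu.-integrable setT (EFin \o (fun x => f x - g x)).
Proof.
move=> fi gi; have -> : EFin \o (fun x => f x - g x) = ((EFin \o f) \- (EFin \o g))%E.
  by apply/funext => x.
exact: integrableB.
Qed.

Lemma integrable_funZ (k : R) (f : T -> R) :
  mu.-integrable setT (EFin \o f) ->
  mu.-integrable setT (EFin \o (fun x => k * f x)).
Proof.
move=> fi; have -> : EFin \o (fun x => k * f x) = (fun x => k%:E * (EFin \o f) x)%E.
  by apply/funext => x.
exact: integrableZl.
Qed.

Lemma integrable_measurable (f : T -> R) :
  mu.-integrable setT (EFin \o f) -> measurable_fun setT f.
Proof. by move=> /integrableP[/measurable_EFinP]. Qed.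

Lemma EFin_Rintegral (f : T -> R) : mu.-integrable setT (EFin \o f) ->
  (\int[mu]_x f x)%:E = (\int[mu]_x (f x)%:E)%E.
Proof. by move=> fi; rewrite fineK//; exact: integrable_fin_num. Qed.

(** Bundles the side conditions of integrals of nonnegative functions, so that bounds can be added,
    scaled and compared in one step; integrability is a consequence. *)
Definition integral_bound (F : T -> R) (B : R) :=
  [/\ measurable_fun setT F, forall x, 0 <= F x & (\int[mu]_x (F x)%:E <= B%:E)%E].

Lemma integral_boundD (F G : T -> R) (a b : R) : integral_bound F a -> integral_bound G b ->
  integral_bound (fun x => F x + G x) (a + b).
Proof.
move=> [mF F0 Fa] [mG G0 Gb]; split; [exact: measurable_funD|by move=> x; exact: addr_ge0|].
under eq_integral do rewrite EFinD.
rewrite (@ge0_integralD _ _ _ mu _ measurableT (EFin \o F) (EFin \o G)); first by rewrite EFinD; exact: leeD.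
- by move=> x _; rewrite /= lee_fin.
- exact/measurable_EFinP.
- by move=> x _; rewrite /= lee_fin.
- exact/measurable_EFinP.
Qed.

Lemma integral_boundZ (k : R) (F : T -> R) (a : R) : 0 <= k -> integral_bound F a ->
  integral_bound (fun x => k * F x) (k * a).
Proof.
move=> k0 [mF F0 Fa]; split; [exact: measurable_funM|by move=> x; exact: mulr_ge0|].
under eq_integral do rewrite EFinM.
rewrite (@ge0_integralZl _ _ _ mu _ measurableT (EFin \o F)).
- by rewrite EFinM; exact: lee_wpmul2l.
- exact/measurable_EFinP.
- by move=> x _; rewrite /= lee_fin.
- by rewrite lee_fin.
Qed.

Lemma integral_bound_sum (I : Type) (r : seq I) (F : I -> T -> R) (a : I -> R) :
  (forall i, integral_bound (F i) (a i)) ->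
  integral_bound (fun x => \sum_(i <- r) F i x) (\sum_(i <- r) a i).
Proof.
move=> Fa; elim: r => [|i r IH].
  under eq_fun do rewrite big_nil.
  by rewrite big_nil; split => //; rewrite integral0.
under eq_fun do rewrite big_cons.
by rewrite big_cons; exact: integral_boundD.
Qed.

Lemma integral_bound_le (F G : T -> R) (a : R) : measurable_fun setT G -> (forall x, 0 <= G x <= F x) ->
  integral_bound F a -> integral_bound G a.
Proof.
move=> mG GF [mF F0 Fa]; split=> // [x|]; first by have /andP[] := GF x.
apply: le_trans Fa; apply: ge0_le_integral => //; try exact/measurable_EFinP.
  by move=> x _; rewrite lee_fin; have /andP[] := GF x.
by move=> x _; rewrite lee_fin; have /andP[] := GF x.
Qed.

Lemma integral_bound_sq (u : T -> R) (a : R) : measurable_fun setT u ->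
  (\int[mu]_x (u x ^+ 2)%:E <= a%:E)%E -> integral_bound (fun x => u x ^+ 2) a.
Proof. by move=> mu0 ua; split=> //; [exact: measurable_funX|move=> x; exact: sqr_ge0]. Qed.

Lemma integral_bound_integrable (F : T -> R) (a : R) : integral_bound F a -> mu.-integrable setT (EFin \o F).
Proof.
move=> [mF F0 Fa]; apply/integrableP; split; first exact/measurable_EFinP.
apply: le_lt_trans (ltry a); apply: le_trans Fa.
by under eq_integral do rewrite /= ger0_norm//.
Qed.

Lemma Rintegral_dominated_cvg (f_ : nat -> T -> R) (f g : T -> R) :
  (forall n, measurable_fun setT (f_ n)) -> (forall x, f_ n x @[n --> \oo] --> f x) ->
  (forall n x, `|f_ n x| <= g x) -> mu.-integrable setT (EFin \o g) ->
  mu.-integrable setT (EFin \o f) /\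
  \int[mu]_x f_ n x @[n --> \oo] --> \int[mu]_x f x.
Proof.
move=> mf cf fg ig.
have mlim : measurable_fun setT (EFin \o f).
  apply: (emeasurable_fun_cvg (fun n => EFin \o f_ n)) => //.
    by move=> n; apply/measurable_EFinP.
  by move=> x _; apply/fine_cvgP; split; [exact: nearW|exact: cf].
have [] := @dominated_convergence _ _ _ mu setT measurableT (fun n => EFin \o f_ n)
    (EFin \o f) (EFin \o g) _ mlim _ ig _.
- by move=> n; apply/measurable_EFinP.
- by apply/aeW => x _; apply/fine_cvgP; split; [exact: nearW|exact: cf].
- by apply/aeW => x n _ /=; rewrite lee_fin.
move=> fi _ fcv; split=> //.
move: fcv; rewrite /= -EFin_Rintegral// => /fine_cvgP[_].
exact.
Qed.

End integral_facts.

(** * Gaussians *)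

Section gauss1.
Variable R : realType.
Notation mu := (@lebesgue_measure R).
Implicit Types (a b c x y : R).

Definition gauss1 c a x : R := expR (- (c * (x - a) ^+ 2)).

Lemma continuous_gauss1 c a : continuous (gauss1 c a).
Proof.
move=> x; apply: (cvg_comp _ expR); last exact: continuous_expR.
apply: (@cvgN _ R^o); apply: cvgM; first exact: cvg_cst.
apply: (cvg_comp (fun x => x - a) (fun x => x ^+ 2)); last exact: sqr_continuous.
exact: (@cvgB _ R^o _ _ _ _ _ _ _ cvg_id (cvg_cst _)).
Qed.

Lemma measurable_gauss1 c a : measurable_fun setT (gauss1 c a).
Proof. by apply: continuous_measurable_fun; exact: continuous_gauss1. Qed.

Lemma ge0_integral_gauss1 c a : 0 < c ->
  (\int[mu]_x (gauss1 c a x)%:E = (Num.sqrt (pi / c))%:E)%E.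
Proof.
(* The normal density of variance [(2 * c)^-1] is a constant multiple of [gauss1 c a], and its mass
   is known to be 1. *)
move=> c0; pose s := Num.sqrt (2 * c)^-1.
have s2 : s ^+ 2 = (2 * c)^-1 by rewrite sqr_sqrtr// invr_ge0 mulr_ge0// ltW.
have s0 : s != 0.
  by rewrite gt_eqF// sqrtr_gt0 invr_gt0 mulr_gt0.
have np0 : normal_peak s != 0 by rewrite gt_eqF// normal_peak_gt0.
have E x : gauss1 c a x = (normal_peak s)^-1 * normal_pdf a s x.
  rewrite normal_pdfE// mulKf// /gauss1 /normal_fun s2; congr expR.
  by field; rewrite gt_eqF.
under eq_integral do rewrite E EFinM.
rewrite integralZl//; last exact: integrable_normal_pdf.
rewrite integral_normal_pdf mule1; congr EFin.
rewrite /normal_peak invrK s2; congr Num.sqrt.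
by field; rewrite gt_eqF.
Qed.

Lemma integrable_gauss1 c a : 0 < c -> mu.-integrable setT (EFin \o gauss1 c a).
Proof.
move=> c0; apply/integrableP; split.
  by apply/measurable_EFinP; exact: measurable_gauss1.
under eq_integral do rewrite /= ger0_norm ?expR_ge0//.
by rewrite ge0_integral_gauss1// ltry.
Qed.

Lemma Rintegral_gauss1 c a : 0 < c -> \int[mu]_x gauss1 c a x = Num.sqrt (pi / c).
Proof.
by move=> c0; apply: EFin_inj; rewrite EFin_Rintegral ?ge0_integral_gauss1//; exact: integrable_gauss1.
Qed.

(** Half of the exponent absorbs the linear factor, by |u| <= (1 + u^2) / 2 and 1 + v <= exp v. It
    dominates first moments and also forces decay at infinity. *)
Lemma abs_gauss1_le c a x : 0 < c ->
  `|x - a| * gauss1 c a x <= (1 + c^-1) * gauss1 (c / 2) a x.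
Proof.
move=> c0; rewrite /gauss1; set u := x - a.
have -> : - (c * u ^+ 2) = - (c / 2 * u ^+ 2) + - (c / 2 * u ^+ 2) by field.
rewrite expRD mulrA ler_wpM2r ?expR_ge0//.
have u1 : `|u| <= 1 + u ^+ 2.
  have := sqr_ge0 (`|u| - 1); rewrite sqrrB real_normK ?num_real// mulr1; have := normr_ge0 u; lra.
have h1 : 1 + c / 2 * u ^+ 2 <= expR (c / 2 * u ^+ 2) by exact: expR_ge1Dx.
rewrite expRN ler_pdivrMr ?expR_gt0//.
apply: (@le_trans _ _ ((1 + c^-1) * (1 + c / 2 * u ^+ 2))); last first.
  by rewrite ler_wpM2l// addr_ge0// invr_ge0 ltW.
have -> : (1 + c^-1) * (1 + c / 2 * u ^+ 2) = 1 + c^-1 + (c / 2) * u ^+ 2 + u ^+ 2 / 2.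
  by field; rewrite gt_eqF.
have : 0 <= c^-1 by rewrite invr_ge0 ltW.
have : 0 <= c / 2 * u ^+ 2 by rewrite mulr_ge0 ?sqr_ge0// divr_ge0// ltW.
have := sqr_ge0 (`|u| - 1); rewrite sqrrB real_normK ?num_real// mulr1; lra.
Qed.

End gauss1.

(** * Fourier transform of the one-dimensional Gaussian *)

Section fourier1.
Variable R : realType.
Notation mu := (@lebesgue_measure R).
Implicit Types (a b c x y xi : R).

Lemma is_derive_gauss1 c a x :
  is_derive x 1 (gauss1 c a : R -> R^o) (- (2 * c * (x - a)) * gauss1 c a x).
Proof.
rewrite /gauss1.
have H : is_derive x 1 (fun x : R => - (c * (x - a) ^+ 2) : R^o) (- (2 * c * (x - a))).
  apply: is_derive_eq; rewrite /GRing.scale /=; ring.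
have E := is_derive_expR (- (c * (x - a) ^+ 2)).
apply: (is_derive_eq (@is_derive1_comp _ expR (fun x : R => - (c * (x - a) ^+ 2)) _ _ _ E H)).
by rewrite /GRing.scale /= mulrC.
Qed.

Lemma is_derive_phase (f : R -> R) (f' : R -> R) (k b x : R) :
  (forall y, is_derive y (1:R) (f : R -> R^o) (f' y)) ->
  is_derive x (1:R) (fun x : R => f (k * x + b) : R^o) (k * f' (k * x + b)).
Proof.
move=> df.
have H : is_derive x 1 (fun x : R => (k * x + b) : R^o) k.
  apply: is_derive_eq; rewrite /GRing.scale /=; ring.
apply: (is_derive_eq (@is_derive1_comp _ f (fun x : R => k * x + b) _ _ _ (df (k * x + b)) H)).
by rewrite /GRing.scale /= mulrC.
Qed.

(** The fundamental theorem of calculus on symmetric intervals growing to the line, then dominated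
    convergence with |f| as dominating function. *)
Lemma Rintegral_derivative_eq0 (F f : R -> R) :
  (forall x, is_derive x (1:R) (F : R -> R^o) (f x)) -> continuous f ->
  mu.-integrable setT (EFin \o f) ->
  F n%:R @[n --> \oo] --> (0 : R) -> F (- n%:R) @[n --> \oo] --> (0 : R) ->
  \int[mu]_x f x = 0.
Proof.
move=> dF cf fi Fp Fm.
have mf := integrable_measurable fi.
have cF : continuous F.
  by move=> x; apply: differentiable_continuous; apply/derivable1_diffP; have [] := dF x.
pose f_ (n : nat) (x : R) : R := (f \_ `[- n.+1%:R, n.+1%:R]) x.
have E n : \int[mu]_x f_ n x = F n.+1%:R - F (- n.+1%:R).
  rewrite /f_ -Rintegral_mkcond.
  have lt : - n.+1%:R < n.+1%:R :> R by rewrite (@lt_trans _ _ 0)// ?oppr_lt0.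
  apply: EFin_inj; rewrite /Rintegral (@continuous_FTC2 _ f F _ _ lt).
  - by rewrite -EFinB.
  - exact: continuous_subspaceT.
  - split.
    + by move=> x _; have [] := dF x.
    + by apply: cvg_at_right_filter; exact: cF.
    + by apply: cvg_at_left_filter; exact: cF.
  - by move=> x _; rewrite derive1E; have [_ ->] := dF x.
have [] := @Rintegral_dominated_cvg _ _ _ mu f_ f (fun x => `|f x|) _ _ _ _.
- move=> n; apply/(measurable_restrictT _ _).1 => //.
  exact: measurable_funTS.
- move=> x; apply: cvg_near_cst.
  exists (Num.trunc `|x|).+1 => // n /= hn.
  rewrite /f_ patchE ifT// inE /= in_itv /=.
  rewrite -ler_norml ltW//.
  have := truncnS_gt `|x|; move=> /lt_le_trans; apply.
  by rewrite ler_nat (leq_trans hn).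
- by move=> n x; rewrite /f_ patchE; case: ifP; rewrite ?normr0.
- have -> : EFin \o (fun x => `|f x|) = abse \o (EFin \o f) by apply/funext.
  exact: integrable_abse.
move=> _.
under eq_fun do rewrite E.
have : F n.+1%:R - F (- n.+1%:R) @[n --> \oo] --> (0 - 0 : R).
  apply: cvgB.
    by have := Fp; rewrite -(cvg_shiftS (fun n : nat => F n%:R)).
  by have := Fm; rewrite -(cvg_shiftS (fun n : nat => F (- n%:R))).
move=> h0 h1; rewrite (cvg_unique _ h1 h0)// ?subrr//.
Qed.

Lemma gauss1_le1 c a x : 0 < c -> gauss1 c a x <= 1.
Proof.
move=> c0; rewrite /gauss1 -expR0 ler_expR oppr_le0.
by rewrite mulr_ge0 ?sqr_ge0// ltW.
Qed.

(** Makes the boundary terms of the integration by parts vanish: by [abs_gauss1_le] the Gaussian is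
    at most (1 + 1/c) / |x - a|. *)
Lemma gauss1_phase_cvg0 c a (u : R -> R) (s : nat -> R) : 0 < c ->
  (forall x, `|u x| <= 1) -> (forall n, n%:R = `|s n|) ->
  gauss1 c a (s n) * u (s n) @[n --> \oo] --> (0 : R).
Proof.
move=> c0 u1 sn; apply/cvgr0Pnorm_le => e e0; near=> n.
have K0 : 0 < 1 + c^-1 by rewrite ltr_pwDl// invr_ge0 ltW.
have hn : `|a| + (1 + c^-1) / e <= n%:R.
  rewrite (le_trans (ltW (truncnS_gt _)))// ler_nat.
  by near: n; exists (Num.trunc (`|a| + (1 + c^-1) / e)).+1 => // k /=.
have hd : (1 + c^-1) / e <= `|s n - a|.
  rewrite (@le_trans _ _ (`|s n| - `|a|)) ?lerB_normD ?lerB_dist//.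
  by rewrite -sn lerBrDl.
have g0 : 0 <= gauss1 c a (s n) by exact: expR_ge0.
rewrite normrM ger0_norm//.
rewrite (@le_trans _ _ (gauss1 c a (s n)))// ?ler_piMr//.
have d0 : 0 < `|s n - a| by rewrite (lt_le_trans _ hd)// divr_gt0.
rewrite -(ler_pM2l d0) (le_trans (abs_gauss1_le _ _ c0))//.
rewrite (@le_trans _ _ (1 + c^-1))//.
  by rewrite ler_piMr ?gauss1_le1 ?divr_gt0// ltW.
by rewrite -ler_pdivrMr.
Unshelve. all: end_near. Qed.

Lemma integrable_gauss1_mul c a (u : R -> R) (K : R) : 0 < c ->
  measurable_fun setT u -> (forall x, `|u x| <= K) ->
  mu.-integrable setT (EFin \o (fun x => gauss1 c a x * u x)).
Proof.
move=> c0 mu1 u1.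
exact: (@integrable_mul_bounded _ _ _ mu _ _ _ mu1 u1 (integrable_gauss1 a c0)).
Qed.

Lemma integrable_moment_gauss1 c a (u : R -> R) : 0 < c ->
  measurable_fun setT u -> (forall x, `|u x| <= 1) ->
  mu.-integrable setT (EFin \o (fun x => (x - a) * gauss1 c a x * u x)).
Proof.
move=> c0 mu1 u1.
apply: (@dominated_integrable_fun _ _ _ mu _ (fun x => (1 + c^-1) * gauss1 (c / 2) a x)).
- apply: measurable_funM => //; apply: measurable_funM; last exact: measurable_gauss1.
  exact: measurable_funB.
- move=> x; rewrite 2!normrM (ger0_norm (expR_ge0 _)).
  apply: le_trans (abs_gauss1_le a x c0).
  by rewrite ler_piMr// mulr_ge0// expR_ge0.
- by apply: integrable_funZ; apply: integrable_gauss1; rewrite divr_gt0.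
Qed.

Lemma continuous_phase (f : R -> R) k a b :
  continuous f -> continuous (fun x : R => f (k * (x - a) + b)).
Proof.
move=> cf x; apply: (cvg_comp (fun x => k * (x - a) + b) f); last exact: cf.
apply: (@cvgD _ R^o); last exact: cvg_cst.
apply: cvgM; first exact: cvg_cst.
exact: (@cvgB _ R^o _ _ _ _ _ _ _ cvg_id (cvg_cst _)).
Qed.

Lemma normr_cos_le1 x : `|cos x| <= 1.
Proof. by rewrite ler_norml cos_le1 cos_geN1. Qed.

Lemma normr_sin_le1 x : `|sin x| <= 1.
Proof. by rewrite ler_norml sin_le1 sin_geN1. Qed.

(** Integration by parts, since the derivative of [gauss1 c a] is -2 c (x - a) times itself. *)
Lemma Rintegral_moment_gauss1_sin c a xi b : 0 < c ->
  \int[mu]_x ((x - a) * gauss1 c a x * sin (xi * (x - a) + b)) =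
  xi / (2 * c) * \int[mu]_x (gauss1 c a x * cos (xi * (x - a) + b)).
Proof.
move=> c0.
have ms := continuous_measurable_fun (@continuous_phase _ xi a b (@continuous_sin R)).
have mc := continuous_measurable_fun (@continuous_phase _ xi a b (@continuous_cos R)).
have i1 := integrable_moment_gauss1 a c0 ms (fun x => normr_sin_le1 _).
have i2 := integrable_gauss1_mul a c0 mc (fun x => normr_cos_le1 _).
have : \int[mu]_x (xi * (gauss1 c a x * cos (xi * (x - a) + b)) -
     2 * c * ((x - a) * gauss1 c a x * sin (xi * (x - a) + b))) = 0.
  apply: (@Rintegral_derivative_eq0 (fun x => gauss1 c a x * sin (xi * (x - a) + b))).
  - move=> x.
    have dg := is_derive_gauss1 c a x.
    have ds : is_derive x 1 (fun x => sin (xi * (x - a) + b) : R^o)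
        (xi * cos (xi * (x - a) + b)).
      have -> : (fun x => sin (xi * (x - a) + b)) = (fun x => sin (xi * x + (b - xi * a))).
        by apply/funext => y; congr sin; ring.
      have -> : xi * (x - a) + b = xi * x + (b - xi * a) by ring.
      exact: (@is_derive_phase sin cos).
    have := is_deriveM dg ds.
    move=> D; apply: (is_derive_eq D).
    rewrite /GRing.scale /=; ring.
  - move=> x; apply: (@cvgB _ R^o).
      apply: cvgM; first exact: cvg_cst.
      by apply: cvgM; [exact: continuous_gauss1|exact: continuous_phase (@continuous_cos R) x].
    apply: cvgM; first exact: cvg_cst.
    apply: cvgM; last exact: continuous_phase (@continuous_sin R) x.
    apply: cvgM; last exact: continuous_gauss1.
    exact: (@cvgB _ R^o _ _ _ _ _ _ _ cvg_id (cvg_cst _)).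
  - by apply: integrable_funB; apply: integrable_funZ.
  - apply: (@gauss1_phase_cvg0 c a (fun x => sin (xi * (x - a) + b)) (fun n => n%:R)) => //.
      by move=> x; exact: normr_sin_le1.
    by move=> n; rewrite normr_nat.
  - apply: (@gauss1_phase_cvg0 c a (fun x => sin (xi * (x - a) + b)) (fun n => - n%:R)) => //.
      by move=> x; exact: normr_sin_le1.
    by move=> n; rewrite normrN normr_nat.
rewrite RintegralB ?RintegralZl//; [|exact: integrable_funZ..].
move=> /eqP; rewrite subr_eq0 => /eqP E.
by rewrite mulrAC E; field; rewrite gt_eqF.
Qed.

(** As a function of the frequency k, the integral satisfies Phi' = - k / (2 c) Phi, so Phi(k)
    exp(k^2 / (4 c)) keeps its value at k = 0. The free phase [b] covers cosine and sine at once and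
    carries the other coordinates in the induction on the dimension. *)
Lemma fourier_gauss1 c a xi b : 0 < c ->
  \int[mu]_x (gauss1 c a x * cos (xi * (x - a) + b)) =
  Num.sqrt (pi / c) * expR (- (xi ^+ 2 / (4 * c))) * cos b.
Proof.
move=> c0.
pose Phi (k : R) : R := \int[mu]_x (gauss1 c a x * cos (k * (x - a) + b)).
have mc k := continuous_measurable_fun (@continuous_phase _ k a b (@continuous_cos R)).
have ic k := integrable_gauss1_mul a c0 (mc k) (fun x => normr_cos_le1 _).
have df (k x : R) : is_derive k (1:R) (fun k : R => gauss1 c a x * cos (k * (x - a) + b) : R^o)
    (- ((x - a) * gauss1 c a x * sin (k * (x - a) + b))).
  have D : is_derive k (1:R) (fun k => cos (k * (x - a) + b) : R^o)
      ((x - a) * - sin (k * (x - a) + b)).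
    have -> : (fun k => cos (k * (x - a) + b)) = (fun k => cos ((x - a) * k + b)).
      by apply/funext => y; congr cos; ring.
    have -> : k * (x - a) + b = (x - a) * k + b by ring.
    exact: (@is_derive_phase cos (fun x => - sin x)).
  have D2 := is_deriveM (is_derive_cst (gauss1 c a x : R^o) k 1) D.
  apply: (is_derive_eq D2); rewrite /GRing.scale /=; ring.
have dPhi (k : R) : is_derive k (1:R) (Phi : R -> R^o) (- (k / (2 * c) * Phi k)).
  have intG : mu.-integrable setT (EFin \o (fun x => (1 + c^-1) * gauss1 (c / 2) a x)).
    by apply: integrable_funZ; apply: integrable_gauss1; rewrite divr_gt0.
  have d1E y x : partial1of2 (fun k x => gauss1 c a x * cos (k * (x - a) + b)) y x =
      - ((x - a) * gauss1 c a x * sin (y * (x - a) + b)).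
    by rewrite /partial1of2 derive1E; have [_ ->] := df y x.
  have G0 x : 0 <= (1 + c^-1) * gauss1 (c / 2) a x.
    by rewrite mulr_ge0 ?expR_ge0// addr_ge0// invr_ge0 ltW.
  have Ik : `]k - 1, k + 1[%classic k by rewrite /= in_itv /=; apply/andP; split; lra.
  have der y x : `]k - 1, k + 1[%classic y -> setT x ->
     derivable (fun k : R => gauss1 c a x * cos (k * (x - a) + b) : R^o) y 1.
    by move=> _ _; have [] := df y x.
  have ub y x : `]k - 1, k + 1[%classic y -> setT x ->
     `|partial1of2 (fun k x => gauss1 c a x * cos (k * (x - a) + b)) y x| <=
     (1 + c^-1) * gauss1 (c / 2) a x.
    move=> _ _; rewrite d1E normrN 2!normrM (ger0_norm (expR_ge0 _)).
    apply: le_trans (abs_gauss1_le a x c0).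
    by rewrite ler_piMr ?normr_sin_le1// mulr_ge0// expR_ge0.
  have D := @derivable_under_integral R _ _ mu _ setT measurableT k _ _ Ik
    (fun k _ => ic k) der _ G0 intG ub.
  have V := @differentiation_under_integral R _ _ mu _ setT measurableT k _ _ Ik
    (fun k _ => ic k) der _ G0 intG ub.
  apply: DeriveDef; first exact: D.
  rewrite -derive1E [LHS]V; under eq_Rintegral do rewrite d1E.
  have -> : \int[mu]_x (- ((x - a) * gauss1 c a x * sin (k * (x - a) + b))) =
     (-1) * \int[mu]_x ((x - a) * gauss1 c a x * sin (k * (x - a) + b)).
    rewrite -RintegralZl//.
      by apply: eq_Rintegral => x _; rewrite mulN1r.
    apply: integrable_moment_gauss1 => //.
      exact: continuous_measurable_fun (@continuous_phase _ k a b (@continuous_sin R)).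
    by move=> x; exact: normr_sin_le1.
  by rewrite Rintegral_moment_gauss1_sin// mulN1r.
have dcst (x : R) : is_derive x (1:R) ((fun k => Phi k * expR (k ^+ 2 / (4 * c))) : R -> R^o) 0.
  have d2 : is_derive x (1:R) (fun k : R => k ^+ 2 / (4 * c) : R^o) (x / (2 * c)).
    apply: is_derive_eq; rewrite /GRing.scale /=; field; rewrite gt_eqF//.
  have d1 := @is_derive1_comp _ expR (fun k : R => k ^+ 2 / (4 * c)) x _ _
     (is_derive_expR _) d2.
  have := is_deriveM (dPhi x) d1.
  move=> D; apply: (is_derive_eq D); rewrite /GRing.scale /=; ring.
have := is_derive_0_is_cst xi 0 dcst.
rewrite expr0n /= mul0r expR0 mulr1 expRN /Phi => E.
have e0 : expR (xi ^+ 2 / (4 * c)) != 0 by rewrite gt_eqF ?expR_gt0.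
rewrite -[LHS](mulfK e0) E.
under eq_Rintegral do rewrite mul0r add0r.
rewrite RintegralZr//; last exact: integrable_gauss1.
by rewrite Rintegral_gauss1// mulrAC.
Qed.

End fourier1.

(** * Integration over row vectors and Gaussians in several variables *)

Section lebesgue_rV_integral.
Variables (R : realType).
Notation leb := (@lebesgue_measure R).
Notation rv n := (@lebesgue_rV R n).

Lemma rV_cons0 n p : @rV_cons R n p ord0 ord0 = p.1.
Proof. exact: (congr1 fst (rV_consK p)). Qed.

Lemma rV_cons_lift n p (j : 'I_n) : @rV_cons R n p ord0 (lift ord0 j) = p.2 ord0 j.
Proof. by rewrite -[in RHS](rV_consK p) /= mxE. Qed.

Lemma rV_unconsK n : cancel (@rV_uncons R n) (@rV_cons R n).
Proof.
move=> x; apply/rowP => i; have [j ->|->] := unliftP ord0 i.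
  by rewrite rV_cons_lift mxE.
by rewrite rV_cons0.
Qed.

Lemma ge0_integral_rVS n (f : 'rV[R]_n.+1 -> \bar R) : measurable_fun setT f ->
  (forall x, 0 <= f x)%E ->
  (\int[rv n.+1]_x f x = \int[leb]_x \int[rv n]_y f (rV_cons (x, y)))%E.
Proof.
move=> mf f0.
rewrite (@ge0_integral_pushforward _ _ _ _ _ _ (@measurable_rV_cons R n) (leb \x rv n)%E setT f)//.
rewrite preimage_setT fubini_tonelli1//.
- by apply: measurableT_comp => //; exact: measurable_rV_cons.
- by move=> x; exact: f0.
Qed.

(** Fubini alone makes almost every slice integrable; asking for every slice lets the inner extended
    integral be a real one at each x. *)
Lemma Rintegral_rVS n (f : 'rV[R]_n.+1 -> R) :
  (rv n.+1).-integrable setT (EFin \o f) ->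
  (forall x, (rv n).-integrable setT (EFin \o (fun y => f (rV_cons (x, y))))) ->
  \int[rv n.+1]_x f x = \int[leb]_x \int[rv n]_y f (rV_cons (x, y)).
Proof.
move=> fi fi2.
have mf := integrable_measurable fi.
have mc : measurable_fun setT (fun p => f (@rV_cons R n p)).
  by apply: measurableT_comp => //; exact: measurable_rV_cons.
have fi' : (leb \x rv n)%E.-integrable setT (EFin \o (fun p => f (@rV_cons R n p))).
  apply/integrableP; split; first exact/measurable_EFinP.
  move/integrableP: (fi) => [_].
  rewrite (@ge0_integral_pushforward _ _ _ _ _ _ (@measurable_rV_cons R n) (leb \x rv n)%E setT)//.
  apply: measurableT_comp => //; exact/measurable_EFinP.
rewrite /Rintegral.
rewrite (@integral_pushforward _ _ _ _ _ _ (@measurable_rV_cons R n) (leb \x rv n)%E setT)//; last exact/measurable_EFinP.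
rewrite preimage_setT /= -integral12_prod_meas1//; congr fine.
apply: eq_integral => x _; rewrite /fubini_F -EFin_Rintegral//; exact: fi2.
Qed.

Lemma dotrC n (x y : 'rV[R]_n) : dotr x y = dotr y x.
Proof. by apply: eq_bigr => i _; rewrite mulrC. Qed.

Lemma dotrDr n (x y z : 'rV[R]_n) : dotr x (y + z) = dotr x y + dotr x z.
Proof. by rewrite /dotr -big_split; apply: eq_bigr => i _; rewrite /= mxE mulrDr. Qed.

Lemma dotrNr n (x y : 'rV[R]_n) : dotr x (- y) = - dotr x y.
Proof. by rewrite /dotr -sumrN; apply: eq_bigr => i _; rewrite /= mxE mulrN. Qed.

Lemma dotrBr n (x y z : 'rV[R]_n) : dotr x (y - z) = dotr x y - dotr x z.
Proof. by rewrite dotrDr dotrNr. Qed.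

Lemma dotrDl n (x y z : 'rV[R]_n) : dotr (y + z) x = dotr y x + dotr z x.
Proof. by rewrite !(dotrC _ x) dotrDr. Qed.

Lemma dotrNl n (x y : 'rV[R]_n) : dotr (- y) x = - dotr y x.
Proof. by rewrite !(dotrC _ x) dotrNr. Qed.

Lemma dotrBl n (x y z : 'rV[R]_n) : dotr (y - z) x = dotr y x - dotr z x.
Proof. by rewrite dotrDl dotrNl. Qed.

Lemma dotr0 n (x : 'rV[R]_n) : dotr x 0 = 0.
Proof. by rewrite /dotr big1// => i _; rewrite mxE mulr0. Qed.

Lemma dotr0l n (x : 'rV[R]_n) : dotr 0 x = 0.
Proof. by rewrite dotrC dotr0. Qed.

Lemma dotr_ge0 n (x : 'rV[R]_n) : 0 <= dotr x x.
Proof. by rewrite /dotr sumr_ge0// => i _; exact: sqr_ge0. Qed.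

Lemma dotr_subC n (x y : 'rV[R]_n) : dotr (x - y) (x - y) = dotr (y - x) (y - x).
Proof. by rewrite -(opprB y) dotrNl dotrNr opprK. Qed.

Lemma dotr_cons n p q :
  dotr (@rV_cons R n p) (@rV_cons R n q) = p.1 * q.1 + dotr p.2 q.2.
Proof.
rewrite /dotr big_ord_recl !rV_cons0; congr (_ + _).
by apply: eq_bigr => i _; rewrite !rV_cons_lift.
Qed.

Lemma rV_consB n p q :
  @rV_cons R n p - rV_cons q = rV_cons (p.1 - q.1, p.2 - q.2).
Proof.
have E m (x y : 'rV[R]_m) i : (x - y) ord0 i = x ord0 i - y ord0 i by rewrite !mxE.
apply/rowP => i; have [j ->|->] := unliftP ord0 i.
  by rewrite E !rV_cons_lift E.
by rewrite E !rV_cons0.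
Qed.

Lemma measurable_coord n (i : 'I_n) :
  measurable_fun setT (fun x : 'rV[R]_n => x ord0 i : R).
Proof. exact: (measurable_rV_coord i). Qed.

Lemma measurable_dotr n d (T : measurableType d) (f g : T -> 'rV[R]_n) :
  measurable_fun setT f -> measurable_fun setT g ->
  measurable_fun setT (fun x => dotr (f x) (g x)).
Proof.
move=> mf mg; rewrite /dotr; elim: (index_enum _) => [|i r IH].
  by under eq_fun do rewrite big_nil; exact: measurable_cst.
under eq_fun do rewrite big_cons.
apply: measurable_funD => //.
by apply: measurable_funM; [exact: (measurableT_comp (@measurable_coord n i) mf)|exact: (measurableT_comp (@measurable_coord n i) mg)].
Qed.

Lemma measurable_fun_rVB n d (T : measurableType d) (f g : T -> 'rV[R]_n) :
  measurable_fun setT f -> measurable_fun setT g ->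
  measurable_fun setT (fun x => f x - g x).
Proof.
move=> mf mg; apply: measurable_fun_rVP => i.
have -> : @rV_coord R n i \o (fun x => f x - g x) =
    (fun x => f x ord0 i - g x ord0 i).
  by apply/funext => x; rewrite /= /rV_coord !mxE.
by apply: measurable_funB; [exact: (measurableT_comp (@measurable_coord n i) mf)|exact: (measurableT_comp (@measurable_coord n i) mg)].
Qed.

Definition gauss n (c : R) (a x : 'rV[R]_n) : R := expR (- (c * dotr (x - a) (x - a))).

Lemma gauss_ge0 n c (a x : 'rV[R]_n) : 0 <= gauss c a x.
Proof. exact: expR_ge0. Qed.

Lemma gauss_gt0 n c (a x : 'rV[R]_n) : 0 < gauss c a x.
Proof. exact: expR_gt0. Qed.

Lemma gauss_le1 n c (a x : 'rV[R]_n) : 0 <= c -> gauss c a x <= 1.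
Proof.
by move=> c0; rewrite /gauss -expR0 ler_expR oppr_le0 mulr_ge0// dotr_ge0.
Qed.

Lemma gaussC n c (a x : 'rV[R]_n) : gauss c a x = gauss c x a.
Proof. by rewrite /gauss dotr_subC. Qed.

Lemma measurable_gauss2 n c d (T : measurableType d) (f g : T -> 'rV[R]_n) :
  measurable_fun setT f -> measurable_fun setT g ->
  measurable_fun setT (fun x => gauss c (f x) (g x)).
Proof.
move=> mf mg; apply: measurableT_comp => //.
apply: measurableT_comp => //; apply: measurable_funM => //.
by apply: measurable_dotr; exact: measurable_fun_rVB.
Qed.

Lemma measurable_gauss n c (a : 'rV[R]_n) : measurable_fun setT (gauss c a).
Proof. exact: (@measurable_gauss2 n c _ _ (cst a) id). Qed.

Lemma gauss_cons n c p q :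
  gauss c (@rV_cons R n p) (rV_cons q) = gauss1 c p.1 q.1 * gauss c p.2 q.2.
Proof.
by rewrite /gauss rV_consB dotr_cons /= /gauss1 mulrDr opprD expRD.
Qed.

Lemma ge0_integral_gauss n c (a : 'rV[R]_n) : 0 < c ->
  (\int[rv n]_x (gauss c a x)%:E = (Num.sqrt (pi / c) ^+ n)%:E)%E.
Proof.
move=> c0; elim: n a => [|n IH] a.
  rewrite [lebesgue_rV R 0]/= integral_dirac//; last first.
    by apply/measurable_EFinP; exact: measurable_gauss.
  rewrite diracT mul1e /gauss /dotr big_ord0 mulr0 oppr0 expR0 expr0//.
rewrite ge0_integral_rVS; last first.
- by move=> x; rewrite lee_fin gauss_ge0.
- by apply/measurable_EFinP; exact: measurable_gauss.
rewrite -[a]rV_unconsK; set p := rV_uncons a.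
transitivity (\int[leb]_x ((gauss1 c p.1 x)%:E * (Num.sqrt (pi / c) ^+ n)%:E))%E.
  apply: eq_integral => x _; rewrite -(IH p.2) -ge0_integralZl//.
  - by apply: eq_integral => y _; rewrite gauss_cons.
  - by apply/measurable_EFinP; exact: measurable_gauss.
  - by move=> y _; rewrite lee_fin gauss_ge0.
  - by rewrite lee_fin expR_ge0.
rewrite ge0_integralZr//.
- by rewrite ge0_integral_gauss1// -EFinM exprS.
- by apply/measurable_EFinP; exact: measurable_gauss1.
- by move=> x _; rewrite lee_fin expR_ge0.
Qed.

Lemma integrable_gauss n c (a : 'rV[R]_n) : 0 < c ->
  (rv n).-integrable setT (EFin \o gauss c a).
Proof.
move=> c0; apply/integrableP; split.
  by apply/measurable_EFinP; exact: measurable_gauss.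
under eq_integral do rewrite /= ger0_norm ?expR_ge0//.
by rewrite ge0_integral_gauss// ltry.
Qed.

Lemma Rintegral_gauss n c (a : 'rV[R]_n) : 0 < c ->
  \int[rv n]_x gauss c a x = Num.sqrt (pi / c) ^+ n.
Proof.
move=> c0; apply: EFin_inj; rewrite EFin_Rintegral ?ge0_integral_gauss//.
exact: integrable_gauss.
Qed.

Lemma measurable_cos_phase n (a xi : 'rV[R]_n) (b : R) :
  measurable_fun setT (fun x : 'rV[R]_n => cos (dotr xi (x - a) + b)).
Proof.
apply: measurableT_comp.
  by apply: continuous_measurable_fun; exact: continuous_cos.
apply: measurable_funD => //; apply: measurable_dotr => //.
exact: measurable_fun_rVB.
Qed.

Lemma integrable_gauss_mul n c (a : 'rV[R]_n) (u : 'rV[R]_n -> R) (K : R) : 0 < c ->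
  measurable_fun setT u -> (forall x, `|u x| <= K) ->
  (rv n).-integrable setT (EFin \o (fun x => gauss c a x * u x)).
Proof.
move=> c0 mu1 u1.
exact: (integrable_mul_bounded mu1 u1 (integrable_gauss a c0)).
Qed.

(** Induction on the dimension: [gauss_cons] splits off the first coordinate, whose contribution to
    the scalar product moves into the phase of the inner integral. *)
Lemma fourier_gauss n c (a xi : 'rV[R]_n) (b : R) : 0 < c ->
  \int[rv n]_x (gauss c a x * cos (dotr xi (x - a) + b)) =
  Num.sqrt (pi / c) ^+ n * expR (- (dotr xi xi / (4 * c))) * cos b.
Proof.
move=> c0; elim: n a xi b => [|n IH] a xi b.
  rewrite /Rintegral [lebesgue_rV R 0]/= integral_dirac//; last first.
    apply/measurable_EFinP; apply: measurable_funM; last exact: measurable_cos_phase.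
    exact: measurable_gauss.
  rewrite diracT mul1e /gauss /dotr !big_ord0 mulr0 mul0r oppr0 expR0 expr0.
  by rewrite /= !mul1r add0r.
rewrite Rintegral_rVS; last first.
- move=> x; rewrite -[a]rV_unconsK -[xi]rV_unconsK; set p := rV_uncons a; set k := rV_uncons xi.
  have -> : (fun y => gauss c (rV_cons p) (rV_cons (x, y)) *
      cos (dotr (rV_cons k) (rV_cons (x, y) - rV_cons p) + b)) =
      (fun y => gauss1 c p.1 x * (gauss c p.2 y *
         cos (dotr k.2 (y - p.2) + (k.1 * (x - p.1) + b)))).
    apply/funext => y; rewrite gauss_cons rV_consB dotr_cons /= mulrA.
    by congr (_ * cos _); ring.
  apply: integrable_funZ; apply: integrable_gauss_mul => //.
    exact: measurable_cos_phase.
  by move=> y; exact: normr_cos_le1.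
- apply: integrable_gauss_mul => //; first exact: measurable_cos_phase.
  by move=> y; exact: normr_cos_le1.
rewrite -[a]rV_unconsK -[xi]rV_unconsK; set p := rV_uncons a; set k := rV_uncons xi.
transitivity (\int[leb]_x ((gauss1 c p.1 x * cos (k.1 * (x - p.1) + b)) *
   (Num.sqrt (pi / c) ^+ n * expR (- (dotr k.2 k.2 / (4 * c)))))).
  apply: eq_Rintegral => x _.
  have -> : (fun y => gauss c (rV_cons p) (rV_cons (x, y)) *
      cos (dotr (rV_cons k) (rV_cons (x, y) - rV_cons p) + b)) =
      (fun y => gauss1 c p.1 x * (gauss c p.2 y *
         cos (dotr k.2 (y - p.2) + (k.1 * (x - p.1) + b)))).
    apply/funext => y; rewrite gauss_cons rV_consB dotr_cons /= mulrA.
    by congr (_ * cos _); ring.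
  rewrite RintegralZl//; last first.
    apply: integrable_gauss_mul => //; first exact: measurable_cos_phase.
    by move=> y; exact: normr_cos_le1.
  by rewrite IH; ring.
rewrite RintegralZr//; last first.
  apply: integrable_gauss1_mul => //.
    exact: continuous_measurable_fun (continuous_phase (@continuous_cos R)).
  by move=> x; exact: normr_cos_le1.
rewrite fourier_gauss1// dotr_cons.
have -> : - ((k.1 * k.1 + dotr k.2 k.2) / (4 * c)) =
    - (k.1 ^+ 2 / (4 * c)) + - (dotr k.2 k.2 / (4 * c)) by rewrite expr2 mulrDl opprD.
rewrite expRD [_ ^+ n.+1]exprS; ring.
Qed.

End lebesgue_rV_integral.

(** * Fubini for two integrable functions and a bounded kernel *)

Section fubini_bounded.
Context d1 d2 (T1 : measurableType d1) (T2 : measurableType d2) (R : realType).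
Variables (m1 : {sigma_finite_measure set T1 -> \bar R})
  (m2 : {sigma_finite_measure set T2 -> \bar R}).
Variables (f : T1 -> R) (g : T2 -> R) (K : T1 * T2 -> R) (C : R).
Hypotheses (fi : m1.-integrable setT (EFin \o f))
  (gi : m2.-integrable setT (EFin \o g)) (mK : measurable_fun setT K)
  (KC : forall p, `|K p| <= C).

Let F p := f p.1 * g p.2 * K p.

Let mF : measurable_fun setT F.
Proof.
apply: measurable_funM => //; apply: measurable_funM.
  exact: measurableT_comp (integrable_measurable fi) measurable_fst.
exact: measurableT_comp (integrable_measurable gi) measurable_snd.
Qed.

Let mK1 x : measurable_fun setT (fun y => K (x, y)).
Proof. by apply: measurableT_comp => //; exact: measurable_pair1. Qed.

Let mK2 y : measurable_fun setT (fun x => K (x, y)).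
Proof. by apply: measurableT_comp => //; exact: measurable_pair2. Qed.

Let gKi x : m2.-integrable setT (EFin \o (fun y => g y * K (x, y))).
Proof. exact: (integrable_mul_bounded (mK1 x) (fun y => KC (x, y)) gi). Qed.

Let fKi y : m1.-integrable setT (EFin \o (fun x => f x * K (x, y))).
Proof. exact: (integrable_mul_bounded (mK2 y) (fun x => KC (x, y)) fi). Qed.

Lemma integrable_prod_bounded : (m1 \x m2)%E.-integrable setT (EFin \o F).
Proof.
have C0 (p : T1 * T2) : 0 <= C by exact: le_trans (KC p).
apply/integrable12ltyP; first exact/measurable_EFinP.
have gfin : (\int[m2]_y `|(EFin \o g) y| < +oo)%E by case/integrableP: gi.
have ffin : (\int[m1]_x `|(EFin \o f) x| < +oo)%E by case/integrableP: fi.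
apply: (@le_lt_trans _ _ (\int[m1]_x (`|(EFin \o f) x| *
   (`|C|%:E * \int[m2]_y `|(EFin \o g) y|)))%E).
  apply: ge0_le_integral => //.
  - by move=> x _; exact: integral_ge0.
  - have mFE : measurable_fun setT (fun p => `|(EFin \o F) p|)%E.
      by apply: measurableT_comp => //; exact/measurable_EFinP.
    exact: (measurable_fun_fubini_tonelli_F (fun p => `|(EFin \o F) p|%E)).
  - apply: emeasurable_funM => //; apply: measurableT_comp => //.
    exact/measurable_EFinP/(integrable_measurable fi).
  - move=> x _; rewrite muleA -ge0_integralZl//.
    + apply: ge0_le_integral => //.
      * by apply/measurable_EFinP/measurableT_comp => //;
         apply: (measurableT_comp mF); exact: measurable_pair1.
      * by apply: emeasurable_funM => //; apply: measurableT_comp => //; exact/measurable_EFinP/(integrable_measurable gi).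
      * move=> y _; rewrite /F /= lee_fin 2!normrM -mulrA -mulrA.
        rewrite ler_wpM2l// mulrC ler_wpM2r//.
        by rewrite (le_trans (KC _))// ler_norm.
    + by apply: measurableT_comp => //; exact/measurable_EFinP/(integrable_measurable gi).
rewrite ge0_integralZr//.
- apply: lte_mul_pinfty => //; first exact: integral_ge0.
    by rewrite ge0_fin_numE//; exact: integral_ge0.
  apply: lte_mul_pinfty => //.
- by apply: measurableT_comp => //; exact/measurable_EFinP/(integrable_measurable fi).
- by apply: mule_ge0 => //; exact: integral_ge0.
Qed.

Let E1 x : (fubini_F m2 (EFin \o F) x = (f x * \int[m2]_y (g y * K (x, y)))%:E)%E.
Proof.
rewrite /fubini_F -RintegralZl// EFin_Rintegral.
  by apply: eq_integral => y _; rewrite /= /F /= mulrA.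
exact: integrable_funZ.
Qed.

Let E2 y : (fubini_G m1 (EFin \o F) y = (g y * \int[m1]_x (f x * K (x, y)))%:E)%E.
Proof.
rewrite /fubini_G -RintegralZl// EFin_Rintegral.
  by apply: eq_integral => x _; rewrite /= /F /= mulrA (mulrC (g y)).
exact: integrable_funZ.
Qed.

(** Serves also as a source of measurability: the inner integral is measurable in x once multiplied
    by a positive weight [f]. *)
Lemma integrable_bounded_kernel :
  m1.-integrable setT (EFin \o (fun x => f x * \int[m2]_y (g y * K (x, y)))).
Proof.
have := integrable_fubini_F integrable_prod_bounded.
by rewrite (_ : fubini_F _ _ = EFin \o (fun x => f x * \int[m2]_y (g y * K (x, y))))//; apply/funext => x; rewrite E1.
Qed.

Lemma Fubini_bounded_kernel :
  \int[m1]_x (f x * \int[m2]_y (g y * K (x, y))) =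
  \int[m2]_y (g y * \int[m1]_x (f x * K (x, y))).
Proof.
rewrite /Rintegral; congr fine.
transitivity (\int[m1]_x fubini_F m2 (EFin \o F) x)%E.
  by apply: eq_integral => x _; rewrite E1.
rewrite [LHS](Fubini integrable_prod_bounded).
by apply: eq_integral => y _; rewrite -E2.
Qed.

End fubini_bounded.

(** * Cosine and sine transforms *)

Local Notation L1 h := ((lebesgue_rV _ _).-integrable setT (EFin \o h)).

Section trig_transforms.
Variables (R : realType) (n : nat).
Notation Rn := 'rV[R]_n.
Notation mu := (@lebesgue_rV R n).
Implicit Types (h k : Rn -> R) (x xi eta : Rn) (c : R).

Definition fcos h x : R := \int[mu]_xi (h xi * cos (dotr x xi)).
Definition fsin h x : R := \int[mu]_xi (h xi * sin (dotr x xi)).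

Lemma measurable_cos : measurable_fun setT (@cos R).
Proof. by apply: continuous_measurable_fun; exact: continuous_cos. Qed.

Lemma measurable_sin : measurable_fun setT (@sin R).
Proof. by apply: continuous_measurable_fun; exact: continuous_sin. Qed.

Lemma measurable_dot1 x : measurable_fun setT (fun xi => dotr x xi).
Proof. exact: measurable_dotr. Qed.

Lemma measurable_dot2 : measurable_fun setT (fun p : Rn * Rn => dotr p.1 p.2).
Proof. exact: measurable_dotr measurable_fst measurable_snd. Qed.

Lemma integrable_normr h : L1 h -> L1 (fun x => `|h x|).
Proof. by move=> hi; apply: (integrable_abse hi). Qed.

Lemma measurable_gaussV : measurable_fun setT (fun x : Rn => (gauss 1 0 x)^-1).
Proof.
have -> : (fun x => (gauss 1 0 x)^-1) = (fun x => expR (1 * dotr (x - 0) (x - 0))) :> (Rn -> R).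
  by apply/funext => x; rewrite /gauss expRN invrK.
by apply: measurableT_comp => //; apply: measurable_funM => //; apply: measurable_dotr; exact: measurable_fun_rVB.
Qed.

Section bounded_transform.
Variable u : R -> R.
Hypotheses (mu1 : measurable_fun setT u) (u1 : forall z, `|u z| <= 1).

Lemma integrable_transform h x : L1 h -> L1 (fun xi => h xi * u (dotr x xi)).
Proof.
move=> hi; apply: integrable_mul_bounded hi; last by move=> y; exact: u1.
exact: measurableT_comp mu1 (measurable_dot1 x).
Qed.

Lemma transform_le h x : L1 h -> `|\int[mu]_xi (h xi * u (dotr x xi))| <= \int[mu]_xi `|h xi|.
Proof.
move=> hi; apply: le_trans (le_normr_Rintegral _ (integrable_transform x hi)) _ => //.
apply: le_Rintegral => //.
- exact: integrable_normr (integrable_transform x hi).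
- exact: integrable_normr.
- by move=> y _; rewrite normrM ler_piMr.
Qed.

(** The kernel is not integrable in x, so Fubini is applied with a Gaussian weight in x, which is
    divided out afterwards. *)
Lemma measurable_transform h : L1 h ->
  measurable_fun setT (fun x => \int[mu]_xi (h xi * u (dotr x xi))).
Proof.
move=> hi.
have := integrable_bounded_kernel (integrable_gauss (0 : Rn) (@ltr01 R)) hi
  (measurableT_comp mu1 measurable_dot2) (fun p => u1 _).
move=> /integrable_measurable mg.
have -> : (fun x => \int[mu]_xi (h xi * u (dotr x xi))) =
    (fun x => (gauss 1 0 x)^-1 * (gauss 1 0 x * \int[mu]_xi (h xi * u (dotr x xi)))).
  by apply/funext => x; rewrite mulKf// gt_eqF ?gauss_gt0.
exact: measurable_funM measurable_gaussV mg.
Qed.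

End bounded_transform.

Lemma integrable_cos h x : L1 h -> L1 (fun xi => h xi * cos (dotr x xi)).
Proof. by move=> hi; exact: (integrable_transform measurable_cos (@normr_cos_le1 R) x hi). Qed.

Lemma fcos_le h x : L1 h -> `|fcos h x| <= \int[mu]_xi `|h xi|.
Proof. by move=> hi; exact: (transform_le measurable_cos (@normr_cos_le1 R) x hi). Qed.

Lemma measurable_fcos h : L1 h -> measurable_fun setT (fcos h).
Proof. by move=> hi; exact: (measurable_transform measurable_cos (@normr_cos_le1 R) hi). Qed.

Lemma integrable_sin h x : L1 h -> L1 (fun xi => h xi * sin (dotr x xi)).
Proof. by move=> hi; exact: (integrable_transform measurable_sin (@normr_sin_le1 R) x hi). Qed.

Lemma fsin_le h x : L1 h -> `|fsin h x| <= \int[mu]_xi `|h xi|.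
Proof. by move=> hi; exact: (transform_le measurable_sin (@normr_sin_le1 R) x hi). Qed.

Lemma measurable_fsin h : L1 h -> measurable_fun setT (fsin h).
Proof. by move=> hi; exact: (measurable_transform measurable_sin (@normr_sin_le1 R) hi). Qed.

(* The Fourier transform of [gauss c 0], as a function of the difference of its arguments. *)
Definition fgauss c eta xi : R := Num.sqrt (pi / c) ^+ n * gauss (4 * c)^-1 eta xi.

(** Convolution with the Fourier transform of [gauss c 0]; this is (2 pi)^n times an approximate
    identity as c tends to 0. *)
Definition mollify c k xi : R := \int[mu]_eta (k eta * fgauss c xi eta).

Lemma fgauss_ge0 c eta xi : 0 <= fgauss c eta xi.
Proof. by apply: mulr_ge0; [exact: exprn_ge0 (sqrtr_ge0 _)|exact: gauss_ge0]. Qed.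

Lemma measurable_fgauss2 c : measurable_fun setT (fun p : Rn * Rn => fgauss c p.1 p.2).
Proof.
apply: measurable_funM => //.
exact: measurable_gauss2 measurable_fst measurable_snd.
Qed.

Lemma fgauss_le c eta xi : 0 < c -> `|fgauss c eta xi| <= Num.sqrt (pi / c) ^+ n.
Proof.
move=> c0; rewrite ger0_norm ?fgauss_ge0// ler_piMr//.
by rewrite gauss_le1// invr_ge0 mulr_ge0// ltW.
Qed.

Lemma sqrt_gauss_norm c : 0 < c ->
  Num.sqrt (pi / c) ^+ n * Num.sqrt (pi / (4 * c)^-1) ^+ n = (2 * pi) ^+ n.
Proof.
move=> c0; rewrite -exprMn -sqrtrM ?divr_ge0 ?pi_ge0// ?ltW//.
rewrite invrK (_ : pi / c * _ = (2 * pi) ^+ 2); last by field; rewrite gt_eqF.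
by rewrite sqrtr_sqr ger0_norm// mulr_ge0// pi_ge0.
Qed.

Lemma ge0_integral_fgauss c eta : 0 < c ->
  (\int[mu]_xi (fgauss c eta xi)%:E = ((2 * pi) ^+ n)%:E)%E.
Proof.
move=> c0; rewrite -(sqrt_gauss_norm c0).
under eq_integral do rewrite EFinM.
rewrite ge0_integralZl//.
- by rewrite ge0_integral_gauss// invr_gt0 mulr_gt0.
- by apply/measurable_EFinP; exact: measurable_gauss.
- by move=> x _; rewrite lee_fin gauss_ge0.
Qed.

Lemma measurable_fgauss c eta : measurable_fun setT (fgauss c eta).
Proof. by apply: measurable_funM => //; exact: measurable_gauss. Qed.

Lemma integrable_fgauss c eta : 0 < c -> L1 (fgauss c eta).
Proof.
move=> c0; apply: integrable_funZ; apply: integrable_gauss.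
by rewrite invr_gt0 mulr_gt0.
Qed.

Lemma Rintegral_fgauss c eta : 0 < c -> \int[mu]_xi fgauss c eta xi = (2 * pi) ^+ n.
Proof.
move=> c0; apply: EFin_inj; rewrite EFin_Rintegral ?ge0_integral_fgauss//.
exact: integrable_fgauss.
Qed.

Lemma integrable_mulr_fgauss c k xi : 0 < c -> L1 k ->
  L1 (fun eta => k eta * fgauss c xi eta).
Proof.
move=> c0 ki; apply: integrable_mul_bounded ki; first exact: measurable_fgauss.
by move=> eta; exact: fgauss_le.
Qed.

Lemma fcos_fsin_mul k x xi : L1 k ->
  cos (dotr x xi) * fcos k x + sin (dotr x xi) * fsin k x =
  \int[mu]_eta (k eta * cos (dotr x (xi - eta))).
Proof.
move=> ki; rewrite /fcos /fsin -!RintegralZl//; [|exact: integrable_sin|exact: integrable_cos].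
rewrite -RintegralD//; [|exact/integrable_funZ/integrable_cos|exact/integrable_funZ/integrable_sin].
by apply: eq_Rintegral => eta _; rewrite dotrBr cosB; ring.
Qed.

(** Polarised Plancherel identity with a Gaussian cutoff in x, the bracket being the real part of
    the transform of h times the conjugate transform of k. Two uses of Fubini leave the integral in
    x of [gauss c 0 x] against cos (x . (xi - eta)), which is [fgauss c xi eta]. *)
Lemma gauss_fcos_fsin c h k : 0 < c -> L1 h -> L1 k ->
  \int[mu]_x (gauss c 0 x * (fcos h x * fcos k x + fsin h x * fsin k x)) =
  \int[mu]_xi (h xi * mollify c k xi).
Proof.
move=> c0 hi ki.
pose K (p : Rn * Rn) := cos (dotr p.1 p.2) * fcos k p.1 + sin (dotr p.1 p.2) * fsin k p.1.
pose M := \int[mu]_xi `|k xi|.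
have mK : measurable_fun setT K.
  apply: measurable_funD; apply: measurable_funM.
  - exact: measurableT_comp measurable_cos measurable_dot2.
  - exact: measurableT_comp (measurable_fcos ki) measurable_fst.
  - exact: measurableT_comp measurable_sin measurable_dot2.
  - exact: measurableT_comp (measurable_fsin ki) measurable_fst.
have KM p : `|K p| <= M + M.
  rewrite (le_trans (ler_normD _ _))// !normrM lerD//.
    by rewrite (le_trans _ (fcos_le p.1 ki))// ler_piMl// normr_cos_le1.
  by rewrite (le_trans _ (fsin_le p.1 ki))// ler_piMl// normr_sin_le1.
have gi := integrable_gauss (0 : Rn) c0.
transitivity (\int[mu]_x (gauss c 0 x * \int[mu]_xi (h xi * K (x, xi)))).
  apply: eq_Rintegral => x _; congr (_ * _).
  rewrite mulrC [X in _ + X]mulrC /fcos /fsin -!RintegralZl//; [|exact: integrable_sin|exact: integrable_cos].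
  rewrite -RintegralD//; [|exact/integrable_funZ/integrable_cos|exact/integrable_funZ/integrable_sin].
  by apply: eq_Rintegral => xi _; rewrite /K /= /fcos /fsin; ring.
rewrite (Fubini_bounded_kernel gi hi mK KM).
apply: eq_Rintegral => xi _; congr (_ * _).
have mK2 : measurable_fun setT (fun p : Rn * Rn => cos (dotr p.1 (xi - p.2))).
  apply: measurableT_comp measurable_cos _; apply: measurable_dotr => //.
  exact: measurable_fun_rVB.
transitivity (\int[mu]_x (gauss c 0 x * \int[mu]_eta (k eta * cos (dotr x (xi - eta))))).
  by apply: eq_Rintegral => x _; rewrite /K fcos_fsin_mul.
rewrite (@Fubini_bounded_kernel _ _ _ _ _ _ _ _ _ _ _ gi ki mK2 (fun p => normr_cos_le1 _)).
apply: eq_Rintegral => eta _; congr (_ * _).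
transitivity (\int[mu]_x (gauss c 0 x * cos (dotr (xi - eta) (x - 0) + 0))).
  by apply: eq_Rintegral => x _; rewrite subr0 addr0 dotrC.
rewrite fourier_gauss// cos0 mulr1 /fgauss gaussC /gauss; congr (_ * expR _).
by rewrite mulrC dotr_subC.
Qed.

End trig_transforms.

(** * Young's inequality *)

Section young.
Variable R : realType.
Implicit Types a u m : R.

(** A convex power lies above its tangent at a. It follows from u v <= u^m / m + v^q / q with v =
    a^(m - 1) and q = m / (m - 1), which is why m = 1 is treated apart. *)
Lemma powR_tangent m a u : 1 <= m -> 0 <= a -> 0 <= u ->
  a `^ m + m * a `^ (m - 1) * (u - a) <= u `^ m.
Proof.
rewrite le_eqVlt => /predU1P[<- a0 u0|m1 a0 u0].
  rewrite subrr powRr0 mulr1 mul1r !powRr1//; lra.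
have m0 : 0 < m by rewrite (lt_trans ltr01).
have m10 : 0 < m - 1 by rewrite subr_gt0.
have q0 : 0 < m / (m - 1) by rewrite divr_gt0.
have := conjugate_powR u0 (powR_ge0 a (m - 1)) m0 q0.
have -> : m^-1 + (m / (m - 1))^-1 = 1 by field; rewrite !gt_eqF.
move=> /(_ erefl); rewrite -powRrM.
have -> : (m - 1) * (m / (m - 1)) = m by field; rewrite gt_eqF.
have E := mulr_powRB1 a0 m0.
have mn : m != 0 by rewrite gt_eqF.
have mn1 : m - 1 != 0 by rewrite gt_eqF.
move=> H; have := ler_wpM2l (ltW m0) H.
have -> : m * (u `^ m / m + a `^ m / (m / (m - 1))) = u `^ m + (m - 1) * a `^ m.
  by field; apply/andP; split.
rewrite -E; nra.
Qed.

Lemma le_add1_powR m u : 1 <= m -> 0 <= u -> u <= 1 + u `^ m.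
Proof.
move=> m1 u0; have [u1|u1] := leP u 1.
  by rewrite (le_trans u1)// lerDl powR_ge0.
rewrite (@le_trans _ _ (u `^ m))// ?lerDr//.
exact: le1r_powR (ltW u1) m1.
Qed.

Variable n : nat.
Notation Rn := 'rV[R]_n.
Notation mu := (@lebesgue_rV R n).
Variables (k : Rn * Rn -> R) (S : R).
Hypotheses (mk : measurable_fun setT k) (k01 : forall p, 0 <= k p <= 1) (S0 : 0 < S)
  (k1S : forall x, (\int[mu]_y (k (x, y))%:E = S%:E)%E)
  (k2S : forall y, (\int[mu]_x (k (x, y))%:E = S%:E)%E).
Variables (f : Rn -> R) (m N : R).
Hypotheses (mf : measurable_fun setT f) (m12 : 1 <= m <= 2) (N0 : 0 <= N)
  (fN : (\int[mu]_x (`|f x| `^ m)%:E <= (N `^ m)%:E)%E).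

Let m1 : 1 <= m. Proof. by have /andP[] := m12. Qed.
Let m0 : 0 < m. Proof. exact: lt_le_trans ltr01 m1. Qed.

Let k0 p : 0 <= k p. Proof. by have /andP[] := k01 p. Qed.
Let k1 p : k p <= 1. Proof. by have /andP[] := k01 p. Qed.

Let mkx x : measurable_fun setT (fun y => k (x, y)).
Proof. by apply: measurableT_comp => //; exact: measurable_pair1. Qed.

Let mfm : measurable_fun setT (fun x => `|f x| `^ m).
Proof. by apply: (measurableT_comp (measurable_powR m)); exact: measurableT_comp. Qed.

Let fmi : L1 (fun x => `|f x| `^ m).
Proof.
apply/integrableP; split; first exact/measurable_EFinP.
apply: le_lt_trans (ltry (N `^ m)); apply: le_trans fN; rewrite le_eqVlt; apply/orP; left.
by apply/eqP; apply: eq_integral => x _; rewrite /= ger0_norm ?powR_ge0.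
Qed.

Let ki x : L1 (fun y => k (x, y)).
Proof.
apply/integrableP; split; first exact/measurable_EFinP.
under eq_integral do rewrite /= ger0_norm//.
by rewrite k1S ltry.
Qed.

Let fmki x : L1 (fun y => `|f y| `^ m * k (x, y)).
Proof.
apply: (@integrable_mul_bounded _ _ _ mu _ _ 1) => //.
by move=> y; rewrite ger0_norm.
Qed.

(** Uses |f| <= 1 + |f|^m in place of Hölder's inequality: [k] has finite mass and |f|^m is
    integrable. *)
Lemma young_integrable x : L1 (fun y => f y * k (x, y)).
Proof.
apply: (@dominated_integrable_fun _ _ _ mu _ (fun y => k (x, y) + `|f y| `^ m * k (x, y))).
- exact: measurable_funM.
- move=> y; rewrite normrM (ger0_norm (k0 _)) -[X in _ <= X + _]mul1r -mulrDl.
  by rewrite ler_wpM2r// le_add1_powR.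
- exact: integrable_funD.
Qed.

(** Jensen's inequality for the probability density k(x, .) / S: integrate [powR_tangent] at the
    mean [a] of |f|, where the linear term integrates to zero. *)
Let jensen x : `|\int[mu]_y (f y * k (x, y))| `^ m <=
  S `^ (m - 1) * \int[mu]_y (`|f y| `^ m * k (x, y)).
Proof.
have ai : L1 (fun y => `|f y| * k (x, y)).
  have := integrable_normr (young_integrable x).
  have -> // : (fun y => `|f y * k (x, y)|) = (fun y => `|f y| * k (x, y)).
  by apply/funext => y; rewrite normrM (ger0_norm (k0 _)).
pose a := (\int[mu]_y (`|f y| * k (x, y))) / S.
have I0 : 0 <= \int[mu]_y (`|f y| * k (x, y)).
  by apply: Rintegral_ge0 => y _; rewrite mulr_ge0.
have a0 : 0 <= a by rewrite divr_ge0// ltW.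
have aS : a * S = \int[mu]_y (`|f y| * k (x, y)) by rewrite divfK// gt_eqF.
have kS : \int[mu]_y k (x, y) = S by rewrite /Rintegral k1S.
have H : a `^ m * S <= \int[mu]_y (`|f y| `^ m * k (x, y)).
  have -> : a `^ m * S = \int[mu]_y (a `^ m * k (x, y) +
     (m * a `^ (m - 1)) * (`|f y| * k (x, y) - a * k (x, y))).
    rewrite RintegralD//; last 2 first.
    - exact: integrable_funZ.
    - by apply: integrable_funZ; apply: integrable_funB => //; exact: integrable_funZ.
    rewrite RintegralZl// kS RintegralZl//; last first.
      by apply: integrable_funB => //; exact: integrable_funZ.
    rewrite RintegralB//; last exact: integrable_funZ.
    by rewrite RintegralZl// kS aS subrr mulr0 addr0.
  apply: le_Rintegral => //.
    apply: integrable_funD; first exact: integrable_funZ.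
    by apply: integrable_funZ; apply: integrable_funB => //; exact: integrable_funZ.
  move=> y _; rewrite -mulrBl mulrA -mulrDl ler_wpM2r//.
  exact: powR_tangent.
apply: (@le_trans _ _ ((a * S) `^ m)).
  rewrite ge0_ler_powR ?nnegrE ?(mulr_ge0 a0) ?(ltW m0) ?(ltW S0)//.
  rewrite aS.
  apply: (le_trans (le_normr_Rintegral _ (young_integrable x))) => //.
  rewrite le_eqVlt; apply/orP; left; apply/eqP; apply: eq_Rintegral => y _.
  by rewrite normrM (ger0_norm (k0 _)).
rewrite powRM ?(ltW S0)// -(mulr_powRB1 (ltW S0) m0).
rewrite mulrA [leRHS]mulrC ler_wpM2r ?powR_ge0//.
Qed.

Let V x := \int[mu]_y (`|f y| `^ m * k (x, y)).

Let V0 x : 0 <= V x.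
Proof. by apply: Rintegral_ge0 => y _; rewrite mulr_ge0// powR_ge0. Qed.

Let EV x : ((V x)%:E = \int[mu]_y (`|f y| `^ m * k (x, y))%:E)%E.
Proof. by rewrite /V EFin_Rintegral. Qed.

Let VN x : V x <= N `^ m.
Proof.
rewrite -lee_fin EV; apply: le_trans fN; apply: ge0_le_integral => //.
- by move=> y _; rewrite lee_fin mulr_ge0// powR_ge0.
- by apply/measurable_EFinP; apply: measurable_funM.
- exact/measurable_EFinP.
- by move=> y _; rewrite lee_fin ler_piMr// powR_ge0.
Qed.

Let mkk : measurable_fun setT (fun p : Rn * Rn => (`|f p.2| `^ m * k p)%:E).
Proof.
apply/measurable_EFinP; apply: measurable_funM => //.
exact: measurableT_comp mfm measurable_snd.
Qed.

Let mV : measurable_fun setT V.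
Proof.
apply/measurable_EFinP.
have -> : EFin \o V = (fun x => \int[mu]_y (`|f y| `^ m * k (x, y))%:E)%E.
  by apply/funext => x; rewrite /= EV.
apply: (@measurable_fun_fubini_tonelli_F _ _ _ _ _ mu (fun p => (`|f p.2| `^ m * k p)%:E)) => //.
by move=> p; rewrite lee_fin mulr_ge0// powR_ge0.
Qed.

Let intV : (\int[mu]_x (V x)%:E <= (N `^ m * S)%:E)%E.
Proof.
under eq_integral do rewrite EV.
rewrite (fubini_tonelli (fun p => (`|f p.2| `^ m * k p)%:E)) //; last first.
  by move=> p; rewrite lee_fin mulr_ge0// powR_ge0.
apply: (@le_trans _ _ (\int[mu]_y ((`|f y| `^ m)%:E * S%:E))%E).
  rewrite le_eqVlt; apply/orP; left; apply/eqP; apply: eq_integral => y _ /=.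
  rewrite -(k2S y) -ge0_integralZl//.
  - apply/measurable_EFinP; apply: measurableT_comp => //; exact: measurable_pair2.
  - by move=> x _; rewrite lee_fin.
rewrite ge0_integralZr//.
- by rewrite EFinM lee_wpmul2r// lee_fin ltW.
- exact/measurable_EFinP.
- by rewrite lee_fin ltW.
Qed.

Let e2 : 0 <= 2 / m - 1.
Proof. by rewrite subr_ge0 ler_pdivlMr// mul1r; have /andP[] := m12. Qed.

(** Write F^2 = |F|^m (|F|^m)^(2/m - 1). Jensen bounds the first factor by [V x]; in the second,
    whose exponent is nonnegative because m <= 2, [V x] is further bounded by N^m because k <= 1. *)
Lemma young_pointwise x : (\int[mu]_y (f y * k (x, y))) ^+ 2 <=
  (N `^ (2 - m) * S `^ (2 - 2 / m)) * V x.
Proof.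
set F := \int[mu]_y _; have [F0|F0] := eqVneq F 0.
  by rewrite F0 expr0n /= !mulr_ge0 ?powR_ge0.
have u0 : 0 < `|F| `^ m by rewrite powR_gt0// normr_gt0.
have SV := jensen x; rewrite -/F -/(V x) in SV.
have -> : F ^+ 2 = (`|F| `^ m) * (`|F| `^ m) `^ (2 / m - 1).
  rewrite -{1}[`|F| `^ m]powRr1 ?powR_ge0// -powRD; last by rewrite (gt_eqF u0) implybT.
  rewrite addrC subrK -powRrM mulrC divfK ?gt_eqF//.
  by rewrite -[2]/(2%:R) powR_mulrn// real_normK ?num_real.
have b0 : (`|F| `^ m) `^ (2 / m - 1) <= (S `^ (m - 1) * N `^ m) `^ (2 / m - 1).
  apply: ge0_ler_powR; rewrite ?nnegrE ?mulr_ge0 ?powR_ge0//.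
  by rewrite (le_trans SV)// ler_wpM2l ?powR_ge0.
apply: (le_trans (ler_pM (powR_ge0 _ _) (powR_ge0 _ _) SV b0)).
rewrite powRM ?powR_ge0// -!powRrM.
have -> : m * (2 / m - 1) = 2 - m by field; rewrite gt_eqF.
have -> : S `^ (2 - 2 / m) = S `^ (m - 1) * S `^ ((m - 1) * (2 / m - 1)).
  rewrite -powRD; last by rewrite (gt_eqF S0) implybT.
  by congr powR; field; rewrite gt_eqF.
by rewrite le_eqVlt; apply/orP; left; apply/eqP; ring.
Qed.

(** Tonelli gives measurability for nonnegative integrands, hence the splitting f = (f + |f|) -
    |f|. *)
Lemma young_measurable : measurable_fun setT (fun x => \int[mu]_y (f y * k (x, y))).
Proof.
have g1 (g : Rn -> R) : measurable_fun setT g -> (forall y, 0 <= g y) ->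
    (forall x, L1 (fun y => g y * k (x, y))) ->
    measurable_fun setT (fun x => \int[mu]_y (g y * k (x, y))).
  move=> mg g0 gi; apply/measurable_EFinP.
  have -> : EFin \o (fun x => \int[mu]_y (g y * k (x, y))) =
      (fun x => \int[mu]_y (g y * k (x, y))%:E)%E.
    by apply/funext => x; rewrite /= EFin_Rintegral.
  apply: (@measurable_fun_fubini_tonelli_F _ _ _ _ _ mu (fun p => (g p.2 * k p)%:E)) => //.
    apply/measurable_EFinP; apply: measurable_funM => //.
    exact: measurableT_comp mg measurable_snd.
  by move=> p; rewrite lee_fin mulr_ge0.
have ai x : L1 (fun y => `|f y| * k (x, y)).
  have := integrable_normr (young_integrable x).
  have -> // : (fun y => `|f y * k (x, y)|) = (fun y => `|f y| * k (x, y)).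
  by apply/funext => y; rewrite normrM (ger0_norm (k0 _)).
have bi x : L1 (fun y => (f y + `|f y|) * k (x, y)).
  have -> : (fun y => (f y + `|f y|) * k (x, y)) = (fun y => f y * k (x, y) + `|f y| * k (x, y)).
    by apply/funext => y; rewrite mulrDl.
  by apply: integrable_funD => //; exact: young_integrable.
have -> : (fun x => \int[mu]_y (f y * k (x, y))) =
   (fun x => \int[mu]_y ((f y + `|f y|) * k (x, y)) - \int[mu]_y (`|f y| * k (x, y))).
  apply/funext => x; rewrite -RintegralB//; apply: eq_Rintegral => y _.
  by rewrite -mulrBl addrK.
apply: measurable_funB; apply: g1 => //.
- by apply: measurable_funD => //; exact: measurableT_comp.
- by move=> y; have := ler_norm (- f y); rewrite normrN; lra.
- exact: measurableT_comp.
Qed.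

(** A kernel with values in [0, 1] and mass S has L^r norm at most S^(1/r); with 1/r = 3/2 - 1/m the
    power S^(3 - 2/m) is the square of that bound. The kernel is general rather than a function of x
    - y, so that x may also be reflected. *)
Lemma young_L2 : (\int[mu]_x ((\int[mu]_y (f y * k (x, y))) ^+ 2)%:E <=
  (N ^+ 2 * S `^ (3 - 2 / m))%:E)%E.
Proof.
have C0 : 0 <= N `^ (2 - m) * S `^ (2 - 2 / m) by rewrite mulr_ge0 ?powR_ge0.
apply: (@le_trans _ _ (\int[mu]_x ((N `^ (2 - m) * S `^ (2 - 2 / m))%:E * (V x)%:E))%E).
  apply: ge0_le_integral => //.
  - by move=> x _; rewrite lee_fin sqr_ge0.
  - by apply/measurable_EFinP; apply: measurable_funX; exact: young_measurable.
  - by apply: emeasurable_funM => //; exact/measurable_EFinP.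
  - by move=> x _; rewrite -EFinM lee_fin young_pointwise.
rewrite ge0_integralZl//; last 2 first.
- exact/measurable_EFinP.
- by move=> x _; rewrite lee_fin.
apply: (@le_trans _ _ ((N `^ (2 - m) * S `^ (2 - 2 / m))%:E * (N `^ m * S)%:E)%E).
  by rewrite lee_wpmul2l// lee_fin.
rewrite -EFinM lee_fin.
have -> : S `^ (3 - 2 / m) = S `^ (2 - 2 / m) * S.
  rewrite -{3}[S]powRr1 ?(ltW S0)// -powRD; last by rewrite (gt_eqF S0) implybT.
  by congr powR; ring.
have [->|Nn] := eqVneq N 0.
  by rewrite (powR0 (lt0r_neq0 m0)) mul0r mulr0 expr0n mul0r.
have -> : N ^+ 2 = N `^ (2 - m) * N `^ m.
  rewrite -powRD; last by rewrite Nn implybT.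
  by rewrite subrK -[2]/(2%:R) powR_mulrn.
by rewrite le_eqVlt; apply/orP; left; apply/eqP; ring.
Qed.

End young.

(** * Plancherel *)

Section plancherel_le.
Variables (R : realType) (n : nat).
Notation Rn := 'rV[R]_n.
Notation mu := (@lebesgue_rV R n).
Implicit Types (h k f : Rn -> R) (x xi eta : Rn) (c : R).

Lemma pi2n_gt0 : 0 < (2 * pi) ^+ n :> R.
Proof. by rewrite exprn_gt0// mulr_gt0// pi_gt0. Qed.

Lemma integrable_gauss_sq h k c : 0 < c -> L1 h -> L1 k ->
  L1 (fun x => gauss c 0 x * (fcos h x * fcos k x + fsin h x * fsin k x)).
Proof.
move=> c0 hi ki.
pose M := (\int[mu]_xi `|h xi|) * (\int[mu]_xi `|k xi|).
apply: (@integrable_gauss_mul _ _ _ _ _ (M + M)) => //.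
  exact: measurable_funD (measurable_funM (measurable_fcos hi) (measurable_fcos ki))
    (measurable_funM (measurable_fsin hi) (measurable_fsin ki)).
move=> x; rewrite (le_trans (ler_normD _ _))// !normrM.
apply: lerD.
  exact: ler_pM (normr_ge0 _) (normr_ge0 _) (fcos_le x hi) (fcos_le x ki).
exact: ler_pM (normr_ge0 _) (normr_ge0 _) (fsin_le x hi) (fsin_le x ki).
Qed.

Lemma measurable_fcos_fsin_sq h : L1 h ->
  measurable_fun setT (fun x => fcos h x ^+ 2 + fsin h x ^+ 2).
Proof.
by move=> hi; apply: measurable_funD; apply: measurable_funX;
  [exact: measurable_fcos|exact: measurable_fsin].
Qed.

(* [mollify c] is a convolution with an integral kernel of mass (2 pi)^n, so
   Young's inequality applies. *)
Lemma gauss_plancherel_le h c : 0 < c -> L1 h ->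
  (\int[mu]_x (gauss c 0 x * (fcos h x ^+ 2 + fsin h x ^+ 2))%:E <=
   ((2 * pi) ^+ n)%:E * \int[mu]_x (h x ^+ 2)%:E)%E.
Proof.
move=> c0 hi.
have mh := integrable_measurable hi.
have P0 := pi2n_gt0.
have c1 : 0 < (4 * c)^-1 by rewrite invr_gt0 mulr_gt0.
have -> : (\int[mu]_x (gauss c 0 x * (fcos h x ^+ 2 + fsin h x ^+ 2))%:E =
  (\int[mu]_xi (h xi * mollify c h xi))%:E)%E.
  rewrite -gauss_fcos_fsin// EFin_Rintegral//; last exact: integrable_gauss_sq.
have : (0 <= \int[mu]_x (h x ^+ 2)%:E)%E by apply: integral_ge0 => x _; rewrite lee_fin sqr_ge0.
case E : (\int[mu]_x (h x ^+ 2)%:E)%E => [V| |] //= V0; last by rewrite gt0_muley ?lte_fin// leey.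
rewrite lee_fin in V0; rewrite -EFinM lee_fin.
pose p : R := Num.sqrt (pi / c) ^+ n.
pose S : R := Num.sqrt (pi / (4 * c)^-1) ^+ n.
have S0 : 0 < S by rewrite exprn_gt0// sqrtr_gt0 divr_gt0// pi_gt0.
have pS : p * S = (2 * pi) ^+ n by exact: sqrt_gauss_norm.
pose F x := \int[mu]_y (h y * gauss (4 * c)^-1 x y).
have k01 (q : Rn * Rn) : 0 <= gauss (4 * c)^-1 q.1 q.2 <= 1.
  by rewrite gauss_ge0 gauss_le1// ltW.
have mk : measurable_fun setT (fun q : Rn * Rn => gauss (4 * c)^-1 q.1 q.2).
  exact: measurable_gauss2 measurable_fst measurable_snd.
have kS x : (\int[mu]_y (gauss (4 * c)^-1 x y)%:E = S%:E)%E by exact: ge0_integral_gauss.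
have kS2 y : (\int[mu]_x (gauss (4 * c)^-1 x y)%:E = S%:E)%E.
  by under eq_integral do rewrite gaussC; exact: ge0_integral_gauss.
have hV : (\int[mu]_x (`|h x| `^ 2)%:E <= (Num.sqrt V `^ 2)%:E)%E.
  rewrite powR_mulrn ?sqrtr_ge0// sqr_sqrtr// -E.
  by under eq_integral do rewrite powR_mulrn// real_normK ?num_real//.
have m2 : 1 <= (2 : R) <= 2 by rewrite lexx ler1n.
have iF x := @young_integrable R n _ _ mk k01 kS h 2 _ mh m2 hV x.
have mF : measurable_fun setT F := @young_measurable R n _ _ mk k01 kS h 2 _ mh m2 hV.
have bF : (\int[mu]_x (F x ^+ 2)%:E <= (V * S ^+ 2)%:E)%E.
  have := @young_L2 R n _ _ mk k01 S0 kS kS2 h 2 _ mh m2 (sqrtr_ge0 V) hV.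
  rewrite sqr_sqrtr// divff ?gt_eqF// (_ : 3 - 1 = 2); last by ring.
  by rewrite powR_mulrn ?(ltW S0)//; apply: le_trans.
have F2i := integral_bound_integrable (integral_bound_sq mF bF).
have h2i : L1 (fun x => h x ^+ 2).
  by apply: (integral_bound_integrable (integral_bound_sq (a := V) mh _)); rewrite E.
have mol : L1 (fun x => h x * mollify c h x).
  exact: (integrable_bounded_kernel hi hi (measurable_fgauss2 c) (fun q => fgauss_le _ _ c0)).
have molE x : mollify c h x = p * F x.
  transitivity (\int[mu]_y (p * (h y * gauss (4 * c)^-1 x y))); last by rewrite RintegralZl//; exact: iF.
  by apply: eq_Rintegral => y _; rewrite mulrCA.
(* Weighted arithmetic-geometric mean for h (p F). As the integral of F^2 is at most V S^2, each of
   the two terms contributes at most p S V / 2, and p S = (2 pi)^n. *)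
apply: (@le_trans _ _ (\int[mu]_x ((p * S / 2) * h x ^+ 2 + (p / S / 2) * F x ^+ 2))).
  apply: le_Rintegral => //.
    exact: integrable_funD (integrable_funZ _ h2i) (integrable_funZ _ F2i).
  move=> x _; rewrite molE -subr_ge0.
  have -> : p * S / 2 * h x ^+ 2 + p / S / 2 * F x ^+ 2 - h x * (p * F x) =
      p * ((2 * S)^-1 * (S * h x - F x) ^+ 2) by field; rewrite gt_eqF.
  apply: mulr_ge0; first exact: exprn_ge0 (sqrtr_ge0 _).
  by apply: mulr_ge0; rewrite ?sqr_ge0// invr_ge0 mulr_ge0// ltW.
rewrite RintegralD//; [|exact: integrable_funZ..].
rewrite !RintegralZl// {1}/Rintegral E /=.
have FV : \int[mu]_x (F x ^+ 2) <= V * S ^+ 2 by rewrite -lee_fin EFin_Rintegral.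
have pS0 : 0 <= p / S / 2.
  by rewrite divr_ge0// divr_ge0 ?(ltW S0)//; exact: exprn_ge0 (sqrtr_ge0 _).
apply: (le_trans (lerD (lexx _) (ler_wpM2l pS0 FV))).
rewrite -pS le_eqVlt; apply/orP; left; apply/eqP.
by field; rewrite gt_eqF.
Qed.

(** Monotone convergence along c = 1 / (k + 1), for which the Gaussian weights increase to 1. *)
Lemma ge0_integral_cvg_gauss (f : Rn -> R) (A : \bar R) : measurable_fun setT f ->
  (forall x, 0 <= f x) ->
  (forall c, 0 < c -> (\int[mu]_x (gauss c 0 x * f x)%:E <= A)%E) ->
  (\int[mu]_x (f x)%:E <= A)%E.
Proof.
move=> mf f0 fA.
pose g (k : nat) x : \bar R := (gauss k.+1%:R^-1 0 x * f x)%:E.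
have mg (k : nat) : measurable_fun setT (g k).
  by apply/measurable_EFinP; apply: measurable_funM => //; exact: measurable_gauss.
have g0 (k : nat) x : setT x -> (0 <= g k x)%E by move=> _; rewrite lee_fin mulr_ge0 ?gauss_ge0.
have cg x : g k x @[k --> \oo] --> (f x)%:E.
  apply/fine_cvgP; split; first exact: nearW.
  rewrite -[X in _ --> X]mul1r; apply: cvgM; last exact: cvg_cst.
  set d := dotr (x - 0) (x - 0).
  have : - (j.+1%:R^-1 * d) @[j --> \oo] --> - (0 * d).
    by apply: cvgN; apply: cvgM; [exact: cvg_harmonic|exact: cvg_cst].
  rewrite mul0r oppr0 => H.
  have := cvg_comp _ expR H (@continuous_expR R 0).
  by rewrite expR0.
have ndg x : setT x -> {homo g^~ x : a b / (a <= b)%N >-> (a <= b)%E}.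
  move=> _ a b ab; rewrite lee_fin ler_wpM2r// ler_expR lerN2 ler_wpM2r ?dotr_ge0//.
  by rewrite lef_pV2 ?posrE// ler_nat.
have := @cvg_monotone_convergence _ _ _ mu setT measurableT g mg g0 ndg.
have -> : (\int[mu]_x limn (g^~ x) = \int[mu]_x (f x)%:E)%E.
  by apply: eq_integral => x _; apply/cvg_lim => //; exact: cg.
move=> cv; rewrite -(cvg_lim _ cv)//; apply: lime_le; first by apply/cvg_ex; eexists; exact: cv.
by apply: nearW => k; apply: fA; rewrite invr_gt0.
Qed.

Lemma plancherel_le h : L1 h ->
  (\int[mu]_x (fcos h x ^+ 2 + fsin h x ^+ 2)%:E <=
   ((2 * pi) ^+ n)%:E * \int[mu]_x (h x ^+ 2)%:E)%E.
Proof.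
move=> hi; apply: ge0_integral_cvg_gauss.
- exact: measurable_fcos_fsin_sq.
- by move=> x; rewrite addr_ge0 ?sqr_ge0.
- by move=> c c0; exact: gauss_plancherel_le.
Qed.

End plancherel_le.

(** * Density of continuous functions in a weighted L^1 space *)

Section density.
Variables (R : realType) (n : nat).
Notation Rn := 'rV[R]_n.
Notation mu := (@lebesgue_rV R n).
Variable lam : Rn -> R.
Hypotheses (lam0 : forall x, 0 <= lam x) (lami : L1 lam).

Lemma integrable_lamM (u : Rn -> R) (M : R) : measurable_fun setT u ->
  (forall x, `|u x| <= M) -> L1 (fun x => lam x * u x).
Proof. by move=> mu1 u1; exact: integrable_mul_bounded mu1 u1 lami. Qed.

(** The sup bound [M] is chosen before [e]: it lets an L^1 error control a difference of squares
    later. *)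
Definition approximable (psi : Rn -> R) := exists M : R, forall e : R, 0 < e ->
  exists phi : Rn -> R, [/\ continuous phi, measurable_fun setT phi,
    (forall x, `|phi x| <= M) & \int[mu]_x (lam x * `|phi x - psi x|) <= e].

(** Approximants with values in [0, 1] are stable under products and complements to 1, so these sets
    can be shown to form a sigma-algebra. *)
Definition approximable_set (A : set Rn) := measurable A /\ forall e : R, 0 < e ->
  exists phi : Rn -> R, [/\ continuous phi, measurable_fun setT phi,
    (forall x, 0 <= phi x <= 1) & \int[mu]_x (lam x * `|phi x - \1_A x|) <= e].

Lemma indic01 (A : set Rn) x : 0 <= (\1_A x : R) <= 1.
Proof. by rewrite indicE ler0n lern1 leq_b1. Qed.

Lemma dist01_le1 (a b : R) : 0 <= a <= 1 -> 0 <= b <= 1 -> `|a - b| <= 1.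
Proof. by move=> /andP[a0 a1] /andP[b0 b1]; rewrite ler_norml; apply/andP; split; lra. Qed.

Lemma integrable_lam_dist (phi psi : Rn -> R) :
  measurable_fun setT phi -> measurable_fun setT psi ->
  (forall x, 0 <= phi x <= 1) -> (forall x, 0 <= psi x <= 1) ->
  L1 (fun x => lam x * `|phi x - psi x|).
Proof.
move=> m1 m2 h1 h2; apply: (@integrable_lamM _ 1).
  by apply: measurableT_comp => //; exact: measurable_funB.
by move=> x; rewrite normr_id dist01_le1.
Qed.

Lemma approximable_setC A : approximable_set A -> approximable_set (~` A).
Proof.
move=> [mA hA]; split; first exact: measurableC.
move=> e e0; have [phi [cphi mphi phi01 ephi]] := hA e e0.
exists (fun x => 1 - phi x); split.
- by move=> x; exact: (cvgB (cvg_cst _) (cphi x)).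
- exact: measurable_funB.
- by move=> x; have /andP[] := phi01 x => ? ?; apply/andP; split; lra.
- apply: le_trans ephi; rewrite le_eqVlt; apply/orP; left; apply/eqP.
  apply: eq_Rintegral => x _; congr (_ * _); rewrite -normrN; congr `|_|.
  by rewrite !indicE in_setC; case: (x \in A) => /=; ring.
Qed.

Lemma approximable_setI A B : approximable_set A -> approximable_set B ->
  approximable_set (A `&` B).
Proof.
move=> [mA hA] [mB hB]; split; first exact: measurableI.
move=> e e0; have e20 : 0 < e / 2 by rewrite divr_gt0.
have [phi [cphi mphi phi01 ephi]] := hA _ e20.
have [psi [cpsi mpsi psi01 epsi]] := hB _ e20.
have mind C : measurable C -> measurable_fun setT (\1_C : Rn -> R) by move=> mC; exact: measurable_indic.
have p01 x : 0 <= phi x * psi x <= 1.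
  by have /andP[? ?] := phi01 x; have /andP[? ?] := psi01 x; rewrite mulr_ge0 ?mulr_ile1.
exists (fun x => phi x * psi x); split => //.
- by move=> x; exact: (cvgM (cphi x) (cpsi x)).
- exact: measurable_funM.
have i1 := integrable_lam_dist mphi (mind _ mA) phi01 (indic01 A).
have i2 := integrable_lam_dist mpsi (mind _ mB) psi01 (indic01 B).
rewrite (splitr e); apply: le_trans (lerD ephi epsi).
rewrite -RintegralD//; apply: le_Rintegral => //.
- apply: integrable_lam_dist => //; first exact: measurable_funM.
    by apply: mind; exact: measurableI.
  exact: indic01.
- exact: integrable_funD.
move=> x _; rewrite -mulrDr ler_wpM2l// indicI /=.
have -> : phi x * psi x - \1_A x * \1_B x =
    (phi x - \1_A x) * psi x + \1_A x * (psi x - \1_B x) by ring.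
rewrite (le_trans (ler_normD _ _))// !normrM lerD//.
  by rewrite ler_piMr//; have /andP[? ?] := psi01 x; rewrite ger0_norm.
by rewrite ler_piMl//; have /andP[? ?] := indic01 A x; rewrite ger0_norm.
Qed.

Lemma approximable_setU A B : approximable_set A -> approximable_set B ->
  approximable_set (A `|` B).
Proof.
move=> hA hB; rewrite -[A `|` B]setCK setCU; apply: approximable_setC.
by apply: approximable_setI; exact: approximable_setC.
Qed.

Lemma approximable_set0 : approximable_set set0.
Proof.
split; first exact: measurable0.
move=> e e0; exists (cst 0); split => //.
- exact: cst_continuous.
- by move=> x; rewrite lexx ler01.
- under eq_Rintegral do rewrite indic0 subrr normr0 mulr0.
  by rewrite Rintegral_cst// mul0r ltW.
Qed.

(** Dominated convergence with [lam] selects one [psi_ k] close to the indicator, which is then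
    approximated itself. The [psi_ k] are indicators of finite unions in one use and continuous
    ramps in the other. *)
Lemma approximable_set_cvg (psi_ : nat -> Rn -> R) (A : set Rn) : measurable A ->
  (forall k e, 0 < e -> exists phi : Rn -> R, [/\ continuous phi, measurable_fun setT phi,
    (forall x, 0 <= phi x <= 1) & \int[mu]_x (lam x * `|phi x - psi_ k x|) <= e]) ->
  (forall k, measurable_fun setT (psi_ k)) ->
  (forall k x, 0 <= psi_ k x <= 1) ->
  (forall x, psi_ k x @[k --> \oo] --> (\1_A x : R)) -> approximable_set A.
Proof.
move=> mA happ mpsi psi01 cpsi; split=> // e e0.
have mind : measurable_fun setT (\1_A : Rn -> R) by exact: measurable_indic.
have [] := @Rintegral_dominated_cvg _ _ _ mu (fun k x => lam x * `|psi_ k x - \1_A x|)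
  (fun x => lam x * `|\1_A x - \1_A x|) lam.
- move=> k; apply: measurable_funM; first exact: integrable_measurable lami.
  by apply: measurableT_comp => //; exact: measurable_funB.
- move=> x; apply: cvgM; first exact: cvg_cst.
  by apply: cvg_norm; exact: (cvgB (cpsi x) (cvg_cst _)).
- move=> k x; rewrite normrM normr_id ger0_norm// ler_piMr// dist01_le1//.
  exact: indic01.
- exact: lami.
move=> _; under [X in _ --> X]eq_Rintegral do rewrite subrr normr0 mulr0.
rewrite Rintegral_cst// mul0r => /cvgr0Pnorm_le /(_ (e / 2)).
have e20 : 0 < e / 2 by rewrite divr_gt0.
move=> /(_ e20) [k _ /(_ k (leqnn k)) /=].
rewrite ger0_norm; last by apply: Rintegral_ge0 => x _; rewrite mulr_ge0.
move=> hk; have [phi [cphi mphi phi01 ephi]] := happ k _ e20.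
exists phi; split => //.
rewrite (splitr e); apply: le_trans (lerD ephi hk).
have i1 := integrable_lam_dist mphi (mpsi k) phi01 (psi01 k).
have i2 := integrable_lam_dist (mpsi k) mind (psi01 k) (indic01 A).
rewrite -RintegralD//; apply: le_Rintegral => //.
- by apply: integrable_lam_dist => //; exact: indic01.
- exact: integrable_funD.
by move=> x _; rewrite -mulrDr ler_wpM2l// ler_distD.
Qed.

Lemma approximable_bigcup (F : nat -> set Rn) :
  (forall k, approximable_set (F k)) -> approximable_set (\bigcup_k F k).
Proof.
move=> hF.
pose G k := \big[setU/set0]_(i < k) F i.
have hG k : approximable_set (G k).
  rewrite /G; elim: k => [|k IH]; first by rewrite big_ord0; exact: approximable_set0.
  by rewrite big_ord_recr; exact: approximable_setU.
have mind C : measurable C -> measurable_fun setT (\1_C : Rn -> R) by move=> mC; exact: measurable_indic.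
apply: (@approximable_set_cvg (fun k => \1_(G k))).
- by apply: bigcup_measurable => k _; have [] := hF k.
- by move=> k e e0; have [_ /(_ e e0)] := hG k.
- by move=> k; apply: mind; have [] := hG k.
- by move=> k x; exact: indic01.
move=> x; apply: cvg_near_cst.
have [[i _ Fix]|nx] := pselect ((\bigcup_k F k) x).
  exists i.+1 => // k /= ik; rewrite !indicE mem_set; last first.
    by rewrite /G -bigcup_mkord; exists i.
  by rewrite mem_set//; exists i.
apply: nearW => k; rewrite !indicE memNset; last first.
  by rewrite /G -bigcup_mkord => -[i _ Fix]; apply: nx; exists i.
by rewrite memNset.
Qed.

(** The ramps of slope k starting at the hyperplane are eventually constant in k at each point. On
    the hyperplane itself they vanish, which matches the strict inequality. *)
Lemma approximable_halfspace (i : 'I_n) (a : R) :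
  approximable_set [set x : Rn | a < x ord0 i].
Proof.
have mcoord := @measurable_coord R n i.
have cont k : continuous (fun x : Rn => Num.min 1 (Num.max 0 (k%:R * (x ord0 i - a)))).
  pose L (x : Rn) : R^o := k%:R * (x ord0 i - a).
  have cL : continuous L.
    by move=> x; exact: (cvgM (cvg_cst _) (cvgB (@coord_continuous _ _ _ _ _ x) (cvg_cst _))).
  move=> x; have c0 : {for x, continuous (cst 0 : Rn -> R^o)} by apply: cst_continuous.
  have c1 : {for x, continuous (cst 1 : Rn -> R^o)} by apply: cst_continuous.
  exact: (continuous_min c1 (continuous_max c0 (cL x))).
have meas k : measurable_fun setT (fun x : Rn => Num.min 1 (Num.max 0 (k%:R * (x ord0 i - a)))).
  apply: measurable_minr => //; apply: measurable_maxr => //.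
  by apply: measurable_funM => //; exact: measurable_funB.
have bnd k (x : Rn) : 0 <= Num.min 1 (Num.max 0 (k%:R * (x ord0 i - a))) <= 1.
  by rewrite le_min ler01 le_max lexx ge_min lexx.
apply: (@approximable_set_cvg (fun k x => Num.min 1 (Num.max 0 (k%:R * (x ord0 i - a))))) => //.
- have -> : [set x : Rn | a < x ord0 i] = setT `&` (fun x : Rn => x ord0 i) @^-1` `]a, +oo[.
    by rewrite setTI; apply/seteqP; split=> x /=; rewrite in_itv /= andbT.
  by apply: mcoord => //; exact: measurable_itv.
- move=> k e e0; eexists; split; [exact: cont|exact: meas|exact: bnd|].
  under eq_Rintegral do rewrite subrr normr0 mulr0.
  by rewrite Rintegral_cst// mul0r ltW.
move=> x; apply: cvg_near_cst; rewrite indicE.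
have [ax|xa] := ltP a (x ord0 i).
  rewrite mem_set//.
  have ax0 : 0 < x ord0 i - a by rewrite subr_gt0.
  exists (Num.trunc (x ord0 i - a)^-1).+1 => // k /= hk.
  have h1 : 1 <= k%:R * (x ord0 i - a).
    rewrite -ler_pdivrMr// div1r.
    by rewrite (le_trans (ltW (truncnS_gt _)))// ler_nat.
  by rewrite max_r ?(le_trans _ h1)// min_l.
rewrite memNset /=; last by rewrite ltNge xa.
apply: nearW => k; rewrite max_l ?min_r//.
by rewrite mulr_ge0_le0// subr_le0.
Qed.

Lemma approximable_coord (i : 'I_n) (Y : set R) : measurable Y ->
  approximable_set ((fun x : Rn => x ord0 i) @^-1` Y).
Proof.
rewrite [measurable Y](_ : _ = (@RGenOInfty.G R).-sigma.-measurable Y); last first.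
  by rewrite -RGenOInfty.measurableE.
move=> /(_ [set Z | approximable_set ((fun x : Rn => x ord0 i) @^-1` Z)]); apply.
split; first split.
- by rewrite /= preimage_set0; exact: approximable_set0.
- by move=> Z /= hZ; rewrite setTD preimage_setC; exact: approximable_setC.
- by move=> F hF /=; rewrite preimage_bigcup; exact: approximable_bigcup.
- move=> _ [a ->] /=.
  rewrite (_ : _ @^-1` _ = [set x : Rn | a < x ord0 i]); first exact: approximable_halfspace.
  by apply/seteqP; split=> x /=; rewrite in_itv /= andbT.
Qed.

(** The approximable sets form a sigma-algebra that contains the generators, the preimages of Borel
    sets under coordinates. *)
Lemma approximable_measurable (A : set Rn) : measurable A -> approximable_set A.
Proof.
move=> /(_ approximable_set); apply; split; first split.
- exact: approximable_set0.
- by move=> Z hZ; rewrite setTD; exact: approximable_setC.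
- by move=> F hF; exact: approximable_bigcup.
- move=> B; rewrite -bigcup_seq => -[i _ [Y mY <-]].
  by rewrite setTI; exact: approximable_coord.
Qed.

End density.

(** * Pointwise convergence of Gaussian mollifications *)

Section mollify_cvg.
Variables (R : realType) (n : nat).
Notation Rn := 'rV[R]_n.
Notation mu := (@lebesgue_rV R n).

(** Neighbourhoods refer to the sup norm, Gaussians to the Euclidean one; every coordinate is
    bounded by the Euclidean norm. *)
Lemma nbhs_dotr (P : set Rn) (x : Rn) : nbhs x P ->
  exists2 d : R, 0 < d & forall y, dotr (y - x) (y - x) < d -> P y.
Proof.
move=> /nbhs_ballP [e /= e0 eP]; exists (e ^+ 2); first exact: exprn_gt0.
move=> y yx; apply: eP; split=> // i j.
rewrite /ball /= (ord1 i) distrC -ltr_sqr ?nnegrE//; last exact: ltW.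
rewrite real_normK ?num_real//; apply: le_lt_trans yx.
rewrite /dotr (bigD1 j)//= !mxE -expr2 lerDl sumr_ge0// => k _.
exact: sqr_ge0.
Qed.

(** With v = u / (8 c), v <= exp v: half of the exponent pays for the factor u. Hence the second
    moment of the kernel is O(c). *)
Lemma dotr_fgauss_le (c : R) (xi eta : Rn) : 0 < c ->
  dotr (eta - xi) (eta - xi) * fgauss c xi eta <=
  8 * c * (Num.sqrt (pi / c) ^+ n * gauss (8 * c)^-1 xi eta).
Proof.
move=> c0; rewrite /fgauss mulrCA [leRHS]mulrCA ler_wpM2l//.
rewrite /gauss; set u := dotr _ _; have u0 : 0 <= u := dotr_ge0 _.
have -> : - ((4 * c)^-1 * u) = - (u / (8 * c)) + - (u / (8 * c)).
  by field; rewrite gt_eqF.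
rewrite expRD mulrA (mulrC (8 * c)^-1) ler_wpM2r ?expR_ge0// expRN.
rewrite ler_pdivrMr ?expR_gt0// mulrC -ler_pdivrMr ?mulr_gt0//.
by rewrite (le_trans _ (expR_ge1Dx _))// lerDr.
Qed.

(** Chebyshev's argument: |k y - k xi| <= e + (2 M / d) u for all y, where u is the squared
    distance. The first term meets the mass of the kernel, the second its second moment. *)
Lemma mollify_dist (c : R) (k : Rn -> R) (M e d : R) (xi : Rn) : 0 < c ->
  measurable_fun setT k -> (forall x, `|k x| <= M) -> 0 <= e -> 0 < d ->
  (forall y, dotr (y - xi) (y - xi) < d -> `|k y - k xi| <= e) ->
  `|mollify c k xi - (2 * pi) ^+ n * k xi| <=
  e * (2 * pi) ^+ n + 2 * M / d * (8 * c * Num.sqrt (8 * pi ^+ 2) ^+ n).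
Proof.
move=> c0 mk kM e0 d0 H.
have M0 : 0 <= M by exact: le_trans (kM xi).
have i1 : L1 (fgauss c xi) by exact: integrable_fgauss.
have i2 : L1 (fun eta => k eta * fgauss c xi eta) by exact: integrable_bounded_mul mk kM i1.
have i3 : L1 (fun eta => (k eta - k xi) * fgauss c xi eta).
  have -> : (fun eta => (k eta - k xi) * fgauss c xi eta) =
     (fun eta => k eta * fgauss c xi eta - k xi * fgauss c xi eta).
    by apply/funext => y; rewrite mulrBl.
  by apply: integrable_funB => //; exact: integrable_funZ.
have c80 : 0 < (8 * c)^-1 by rewrite invr_gt0 mulr_gt0.
have i4 := integrable_gauss xi c80.
have -> : mollify c k xi - (2 * pi) ^+ n * k xi = \int[mu]_eta ((k eta - k xi) * fgauss c xi eta).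
  rewrite -(Rintegral_fgauss xi c0) mulrC -RintegralZl// /mollify -RintegralB//; last exact: integrable_funZ.
  by apply: eq_Rintegral => eta _; rewrite mulrBl.
apply: (le_trans (le_normr_Rintegral _ i3)) => //.
have S : Num.sqrt (pi / c) ^+ n * Num.sqrt (pi / (8 * c)^-1) ^+ n = Num.sqrt (8 * pi ^+ 2) ^+ n.
  rewrite -exprMn -sqrtrM ?divr_ge0 ?pi_ge0// ?ltW//; congr (Num.sqrt _ ^+ n).
  by rewrite invrK; field; rewrite gt_eqF.
have -> : e * (2 * pi) ^+ n + 2 * M / d * (8 * c * Num.sqrt (8 * pi ^+ 2) ^+ n) =
   \int[mu]_eta (e * fgauss c xi eta + 2 * M / d * (8 * c * Num.sqrt (pi / c) ^+ n) * gauss (8 * c)^-1 xi eta).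
  rewrite RintegralD//; [|exact: integrable_funZ..].
  by rewrite RintegralZl// Rintegral_fgauss// RintegralZl// Rintegral_gauss// -S; ring.
apply: le_Rintegral => //.
- exact: integrable_normr.
- by apply: integrable_funD; exact: integrable_funZ.
move=> eta _; rewrite normrM (ger0_norm (fgauss_ge0 _ _ _)).
have F0 := fgauss_ge0 c xi eta.
have := dotr_fgauss_le xi eta c0.
set u := dotr _ _ => hu.
apply: (@le_trans _ _ ((e + 2 * M / d * u) * fgauss c xi eta)).
  rewrite ler_wpM2r//.
  have u0 : 0 <= u := dotr_ge0 _.
  have [ud|du] := ltP u d.
    by rewrite (le_trans (H _ ud))// lerDl mulr_ge0// divr_ge0 ?mulr_ge0// ltW.
  rewrite (@le_trans _ _ (2 * M))//.
    rewrite (le_trans (ler_normB _ _))//.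
    have := kM eta; have := kM xi; lra.
  rewrite (@le_trans _ _ (2 * M / d * u))// ?lerDr//.
  by rewrite mulrAC ler_pdivlMr// ler_wpM2l// mulr_ge0.
have D0 : 0 <= 2 * M / d by rewrite divr_ge0 ?mulr_ge0// ltW.
rewrite mulrDl lerD2l -mulrA -[leRHS]mulrA ler_wpM2l//.
by apply: le_trans hu _; rewrite le_eqVlt mulrA eqxx.
Qed.

Lemma mollify_cvg (k : Rn -> R) (M : R) (xi : Rn) :
  measurable_fun setT k -> (forall x, `|k x| <= M) -> continuous k ->
  mollify j.+1%:R^-1 k xi @[j --> \oo] --> (2 * pi) ^+ n * k xi.
Proof.
move=> mk kM ck; apply/cvgrPdist_le => e e0.
have P0 := pi2n_gt0 R n.
pose e' := e / 2 / (2 * pi) ^+ n.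
have e'0 : 0 < e' by rewrite !divr_gt0.
have /cvgrPdist_le /(_ _ e'0) := ck xi.
move=> /nbhs_dotr [d d0 Hd].
have M0 : 0 <= M by exact: le_trans (kM xi).
pose S := 16 * M / d * Num.sqrt (8 * pi ^+ 2) ^+ n.
have S0 : 0 <= S.
  by rewrite mulr_ge0 ?exprn_ge0 ?sqrtr_ge0// divr_ge0 ?mulr_ge0// ltW.
near=> j.
rewrite distrC; apply: (le_trans (mollify_dist (c := j.+1%:R^-1) _ mk kM (ltW e'0) d0 _)).
- by rewrite invr_gt0.
- by move=> y /Hd; rewrite distrC.
have -> : e' * (2 * pi) ^+ n = e / 2 by rewrite /e' divfK// gt_eqF.
rewrite [leRHS]splitr lerD2l.
have -> : 2 * M / d * (8 * j.+1%:R^-1 * Num.sqrt (8 * pi ^+ 2) ^+ n) = S / j.+1%:R.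
  by rewrite /S; ring.
rewrite ler_pdivrMr// -ler_pdivrMl ?divr_gt0//.
rewrite (le_trans (ltW (truncnS_gt _)))// ler_nat ltnS.
by near: j; exists (Num.trunc ((e / 2)^-1 * S)).+1 => // i /= /ltnW.
Unshelve. all: end_near. Qed.

End mollify_cvg.

(** * Approximation of simple functions *)

Section approximable_simple.
From mathcomp Require Import finmap.
Import HBNNSimple.
Variables (R : realType) (n : nat).
Notation Rn := 'rV[R]_n.
Notation mu := (@lebesgue_rV R n).
Variable lam : Rn -> R.
Hypotheses (lam0 : forall x, 0 <= lam x) (lami : L1 lam).

Lemma approximable_sum (N : nat) (s : nat -> R) (A : nat -> set Rn) :
  (forall i, measurable (A i)) ->
  approximable lam (fun x => \sum_(i < N) (s i * \1_(A i) x)).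
Proof.
move=> mA.
have mind i : measurable_fun setT (\1_(A i) : Rn -> R) by exact: measurable_indic.
pose f N x : R := \sum_(i < N) (s i * \1_(A i) x).
have mf k : measurable_fun setT (f k).
  elim: k => [|k IH]; rewrite /f.
    by under eq_fun do rewrite big_ord0; exact: measurable_cst.
  by under eq_fun do rewrite big_ord_recr /=; apply: measurable_funD => //; exact: measurable_funM.
have bf k x : `|f k x| <= \sum_(i < k) `|s i|.
  rewrite /f (le_trans (ler_norm_sum _ _ _))// ler_sum// => i _.
  rewrite normrM ler_piMr//; have /andP[? ?] := indic01 (R := R) (A i) x.
  by rewrite ger0_norm.
rewrite -/(f N); elim: N => [|N [M IH]].
  exists 0 => e e0; exists (cst 0); split => //.
  - exact: cst_continuous.
  - by move=> x; rewrite normr0.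
  - rewrite /f; under eq_Rintegral do rewrite big_ord0 subrr normr0 mulr0.
    by rewrite Rintegral_cst// mul0r ltW.
exists (M + `|s N|) => e e0.
have e20 : 0 < e / 2 by rewrite divr_gt0.
have sN0 : 0 < 1 + `|s N| by rewrite ltr_pwDl.
have [phi [cphi mphi phiM ephi]] := IH _ e20.
have e30 : 0 < e / 2 / (1 + `|s N|) by rewrite divr_gt0.
have [_ /(_ _ e30) [psi [cpsi mpsi psi01 epsi]]] := approximable_measurable lam0 lami (mA N).
have psi1 x : `|psi x| <= 1 by have /andP[? ?] := psi01 x; rewrite ger0_norm.
exists (fun x => phi x + s N * psi x); split.
- by move=> x; exact: (cvgD (cphi x) (cvgM (cvg_cst _) (cpsi x))).
- by apply: measurable_funD => //; exact: measurable_funM.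
- move=> x; rewrite (le_trans (ler_normD _ _))// lerD// normrM ler_piMr//.
have i1 : L1 (fun x => lam x * `|phi x - f N x|).
  apply: (@integrable_lamM _ _ _ lami _ (M + \sum_(i < N) `|s i|)).
    by apply: measurableT_comp => //; exact: measurable_funB.
  by move=> x; rewrite normr_id (le_trans (ler_normB _ _))// lerD.
have i2 := integrable_lam_dist lami mpsi (mind N) psi01 (indic01 (A N)).
apply: (@le_trans _ _ (\int[mu]_x (lam x * `|phi x - f N x| +
   `|s N| * (lam x * `|psi x - \1_(A N) x|)))).
  apply: le_Rintegral => //.
  - apply: (@integrable_lamM _ _ _ lami _ (M + `|s N| + \sum_(i < N.+1) `|s i|)).
      apply: measurableT_comp => //; apply: measurable_funB => //.
      by apply: measurable_funD => //; exact: measurable_funM.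
    move=> x; rewrite normr_id (le_trans (ler_normB _ _))// lerD//.
    by rewrite (le_trans (ler_normD _ _))// lerD// normrM ler_piMr//.
  - by apply: integrable_funD => //; exact: integrable_funZ.
  move=> x _; rewrite mulrCA -mulrDr ler_wpM2l// -normrM.
  have -> : phi x + s N * psi x - f N.+1 x =
     (phi x - f N x) + s N * (psi x - \1_(A N) x).
    by rewrite /f big_ord_recr /=; ring.
  exact: ler_normD.
rewrite RintegralD//; last exact: integrable_funZ.
rewrite RintegralZl// [leRHS]splitr lerD//.
apply: (le_trans (ler_wpM2l (normr_ge0 _) epsi)).
rewrite mulrA ler_pdivrMr// mulrC ler_wpM2l ?(ltW e20)//.
by rewrite lerDr.
Qed.

Lemma approximable_sfun (f : {nnsfun Rn >-> R}) : approximable lam (fun x => f x).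
Proof.
have := @approximable_sum #|` fset_set (f @` setT)| (fun i => (fset_set (f @` setT))`_i)
  (fun i => f @^-1` [set (fset_set (f @` setT))`_i]).
move=> H; have -> : (fun x => f x) = (fun x => \sum_(i < #|` fset_set (f @` setT)|)
   ((fset_set (f @` setT))`_i * \1_(f @^-1` [set (fset_set (f @` setT))`_i]) x)).
  by apply/funext => x; rewrite fimfunEord.
by apply: H => i; exact: measurable_sfunP.
Qed.

End approximable_simple.

(** * A function bounded by its transform, by duality *)

Section plancherel_ge.
From mathcomp Require Import finmap.
Import HBNNSimple.
Variables (R : realType) (n : nat).
Notation Rn := 'rV[R]_n.
Notation mu := (@lebesgue_rV R n).
Notation gam := (gauss 1 (0 : Rn)).
Variables (h : Rn -> R) (B : R).
Hypotheses (hi : L1 h)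
  (hB : (\int[mu]_x (fcos h x ^+ 2 + fsin h x ^+ 2)%:E <= B%:E)%E).

Let mh := integrable_measurable hi.

Lemma continuous_gauss (c : R) (a : Rn) : continuous (gauss c a).
Proof.
move=> x.
have cc i : (y - a) ord0 i @[y --> x] --> (x - a) ord0 i.
  have -> : (fun y : Rn => (y - a) ord0 i) = (fun y => y ord0 i - a ord0 i).
    by apply/funext => y; rewrite !mxE.
  rewrite !mxE; exact: (cvgB (@coord_continuous _ _ _ _ _ x) (cvg_cst _)).
have cq : dotr (y - a) (y - a) @[y --> x] --> dotr (x - a) (x - a).
  rewrite /dotr; elim: (index_enum _) => [|i r IH].
    under eq_fun do rewrite big_nil.
    by rewrite big_nil; exact: (@cst_continuous Rn R 0 x).
  under eq_fun do rewrite big_cons.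
  by rewrite big_cons; exact: (cvgD (cvgM (cc i) (cc i)) IH).
exact: (cvg_comp _ expR (cvgN (cvgM (cvg_cst c) cq)) (@continuous_expR R _)).
Qed.

Lemma integrable_mul_gam_sq (psi : Rn -> R) (M : R) : measurable_fun setT psi ->
  (forall x, `|psi x| <= M) -> L1 (fun x => (psi x * gam x) ^+ 2).
Proof.
move=> mpsi psiM.
have -> : (fun x => (psi x * gam x) ^+ 2) = (fun x => gam x * (psi x ^+ 2 * gam x)).
  by apply/funext => x; ring.
apply: (@integrable_gauss_mul _ _ _ _ _ (M ^+ 2)) => //.
  by apply: measurable_funM; [exact: measurable_funX|exact: measurable_gauss].
move=> x; rewrite normrM normrX (ger0_norm (gauss_ge0 _ _ _)).
rewrite (@le_trans _ _ (`|psi x| ^+ 2))// ?ler_piMr ?gauss_le1//.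
by rewrite lerXn2r ?nnegrE// (le_trans _ (psiM x)).
Qed.

(** For k = psi gam, integrate 2 (fcos h fcos k + fsin h fsin k) <= |transform of h|^2 + |transform
    of k|^2 against [gauss c 0], bound the last term by [gauss_plancherel_le], and let c tend to 0,
    where continuity of k is used. The factor [gam] makes k integrable and square integrable for
    every bounded psi. *)
Lemma plancherel_duality_continuous (psi : Rn -> R) (M : R) :
  measurable_fun setT psi -> (forall x, `|psi x| <= M) -> continuous psi ->
  2 * (2 * pi) ^+ n * \int[mu]_x (h x * (psi x * gam x)) <=
  B + (2 * pi) ^+ n * \int[mu]_x (psi x * gam x) ^+ 2.
Proof.
move=> mpsi psiM cpsi; pose k x := psi x * gam x.
have mk : measurable_fun setT k by apply: measurable_funM => //; exact: measurable_gauss.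
have kM x : `|k x| <= M.
  rewrite normrM (ger0_norm (gauss_ge0 _ _ _)).
  by rewrite (le_trans _ (psiM x))// ler_piMr ?gauss_le1.
have ck : continuous k by move=> x; exact: (cvgM (cpsi x) (@continuous_gauss _ _ x)).
have ki : L1 k by exact: integrable_bounded_mul mpsi psiM (integrable_gauss _ ltr01).
have ki2 : L1 (fun x => k x ^+ 2) by exact: integrable_mul_gam_sq psiM.
have bound (c : R) : 0 < c ->
    2 * \int[mu]_x (h x * mollify c k x) <= B + (2 * pi) ^+ n * \int[mu]_x (k x ^+ 2).
  move=> c0; rewrite -gauss_fcos_fsin//.
  have s1 := integrable_gauss_sq c0 hi hi.
  have s2 := integrable_gauss_sq c0 ki ki.
  have s3 := integrable_gauss_sq c0 hi ki.
  apply: (@le_trans _ _ (\int[mu]_x (gauss c 0 x * (fcos h x * fcos h x + fsin h x * fsin h x)) +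
    \int[mu]_x (gauss c 0 x * (fcos k x * fcos k x + fsin k x * fsin k x)))).
    rewrite -RintegralZl// -RintegralD//; apply: le_Rintegral => //.
    - exact: integrable_funZ.
    - exact: integrable_funD.
    move=> x _; rewrite mulrCA -mulrDr ler_wpM2l ?gauss_ge0//.
    have := sqr_ge0 (fcos h x - fcos k x); have := sqr_ge0 (fsin h x - fsin k x).
    rewrite !sqrrB; rewrite !expr2; lra.
  apply: lerD.
    rewrite -lee_fin EFin_Rintegral//; apply: le_trans hB.
    apply: ge0_le_integral => //.
    - by move=> x _; rewrite lee_fin mulr_ge0 ?gauss_ge0// -!expr2 addr_ge0 ?sqr_ge0.
    - by apply/measurable_EFinP; exact: integrable_measurable s1.
    - by apply/measurable_EFinP; exact: measurable_fcos_fsin_sq.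
    - move=> x _; rewrite lee_fin -!expr2 ler_piMl ?addr_ge0 ?sqr_ge0//.
      by rewrite gauss_le1// ltW.
  rewrite -lee_fin EFin_Rintegral// EFinM EFin_Rintegral//.
  exact: gauss_plancherel_le.
have [] := @Rintegral_dominated_cvg _ _ _ mu (fun j x => h x * mollify j.+1%:R^-1 k x)
   (fun x => h x * ((2 * pi) ^+ n * k x)) (fun x => `|h x| * ((2 * pi) ^+ n * M)).
- move=> j; apply: integrable_measurable.
  have c0 : 0 < j.+1%:R^-1 :> R by rewrite invr_gt0.
  exact: (integrable_bounded_kernel hi ki (measurable_fgauss2 _) (fun p => fgauss_le _ _ c0)).
- by move=> x; apply: (cvgM (cvg_cst _)); exact: mollify_cvg kM ck.
- move=> j x; rewrite normrM ler_wpM2l//.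
  have c0 : 0 < j.+1%:R^-1 :> R by rewrite invr_gt0.
  rewrite -(Rintegral_fgauss x c0) mulrC -RintegralZl//; last exact: integrable_fgauss.
  have ik := integrable_mulr_fgauss x c0 ki.
  apply: (le_trans (le_normr_Rintegral _ ik)) => //.
  apply: le_Rintegral => //.
  - exact: integrable_normr.
  - by apply: integrable_funZ; exact: integrable_fgauss.
  - by move=> y _; rewrite normrM (ger0_norm (fgauss_ge0 _ _ _)) ler_wpM2r ?fgauss_ge0.
- apply: (integrable_mul_bounded (K := `|(2 * pi) ^+ n * M|)) => //; exact: integrable_normr.
move=> i0 cv.
have hk : L1 (fun x => h x * k x) by exact: integrable_mul_bounded mk kM hi.
have E : \int[mu]_x (h x * ((2 * pi) ^+ n * k x)) = (2 * pi) ^+ n * \int[mu]_x (h x * k x).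
  by rewrite -RintegralZl//; apply: eq_Rintegral => x _; rewrite mulrCA.
rewrite -mulrA -E.
have cv2 : 2 * \int[mu]_x (h x * mollify j.+1%:R^-1 k x) @[j --> \oo] -->
    2 * \int[mu]_x (h x * ((2 * pi) ^+ n * k x)) by exact: (cvgM (cvg_cst _) cv).
rewrite -(cvg_lim _ cv2)//; apply: limr_le; first by apply/cvg_ex; eexists; exact: cv2.
by apply: nearW => j; apply: bound; rewrite invr_gt0.
Qed.

Lemma plancherel_duality_sfun (psi : {nnsfun Rn >-> R}) (K : R) : (forall x, psi x <= K) ->
  2 * (2 * pi) ^+ n * \int[mu]_x (h x * (psi x * gam x)) <=
  B + (2 * pi) ^+ n * \int[mu]_x (psi x * gam x) ^+ 2.
Proof.
move=> psiK; have mpsi : measurable_fun setT psi by exact: measurable_funP.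
have psi0 x : 0 <= psi x by exact: fun_ge0.
have psiN x : `|psi x| <= K by rewrite ger0_norm.
have K0 : 0 <= K by exact: le_trans (psiK 0).
have P0 := pi2n_gt0 R n.
(* This weight dominates both |h|, for the term linear in psi, and [gam], for the quadratic term, so
   one approximation serves both. *)
pose lam x := `|h x| + gam x.
have lam0 x : 0 <= lam x by rewrite addr_ge0 ?gauss_ge0.
have gi : L1 gam by exact: integrable_gauss.
have lami : L1 lam by apply: integrable_funD => //; exact: integrable_normr.
have [M HM] := approximable_sfun lam0 lami psi.
have M0 : 0 <= M by have [phi [_ _ /(_ 0) /(le_trans _) + _]] := HM 1 ltr01; apply.
apply/ler_addgt0Pr => e e0.
(* Total weight of the errors [D1] and [D2] in the final inequality. *)
pose C := (2 * pi) ^+ n * (2 + (M + K)).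
have C0 : 0 < C by rewrite mulr_gt0// ltr_pwDl// addr_ge0.
have eC : 0 < e / C by rewrite divr_gt0.
have [phi [cphi mphi phiM ephi]] := HM _ eC.
have := plancherel_duality_continuous mphi phiM cphi.
have idist : L1 (fun x => lam x * `|phi x - psi x|).
  apply: (@integrable_lamM _ _ _ lami _ (M + K)).
    by apply: measurableT_comp => //; exact: measurable_funB.
  by move=> x; rewrite normr_id (le_trans (ler_normB _ _))// lerD.
have ihM (u : Rn -> R) (L : R) : measurable_fun setT u -> (forall x, `|u x| <= L) -> L1 (fun x => h x * (u x * gam x)).
  move=> mu0 uL; apply: (@integrable_mul_bounded _ _ _ mu _ _ L) => //.
    by apply: measurable_funM => //; exact: measurable_gauss.
  move=> x; rewrite normrM (ger0_norm (gauss_ge0 _ _ _)) (le_trans _ (uL x))//.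
  by rewrite ler_piMr ?gauss_le1.
have ih1 := ihM _ _ mphi phiM; have ih2 := ihM _ _ mpsi psiN.
have is1 := integrable_mul_gam_sq mphi phiM.
have is2 := integrable_mul_gam_sq mpsi psiN.
have D1 : \int[mu]_x (h x * (psi x * gam x)) <= \int[mu]_x (h x * (phi x * gam x)) + e / C.
  rewrite (le_trans _ (lerD (lexx _) ephi))// -RintegralD//.
  apply: le_Rintegral => //; first exact: integrable_funD.
  move=> x _; rewrite -lerBlDl -mulrBr -mulrBl.
  rewrite (le_trans (ler_norm _))// !normrM mulrCA distrC mulrC ler_wpM2r//.
  rewrite (ger0_norm (gauss_ge0 _ _ _)) /lam (@le_trans _ _ `|h x|)//.
    by rewrite ler_piMr ?gauss_le1.
  by rewrite lerDl gauss_ge0.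
have D2 : \int[mu]_x (phi x * gam x) ^+ 2 <= \int[mu]_x (psi x * gam x) ^+ 2 + (M + K) * (e / C).
  rewrite (le_trans _ (lerD (lexx _) (ler_wpM2l (addr_ge0 M0 K0) ephi)))//.
  rewrite -RintegralZl// -RintegralD//; last exact: integrable_funZ.
  apply: le_Rintegral => //.
    by apply: integrable_funD => //; exact: integrable_funZ.
  move=> x _; rewrite -lerBlDl.
  have -> : (phi x * gam x) ^+ 2 - (psi x * gam x) ^+ 2 =
     (phi x + psi x) * ((phi x - psi x) * (gam x * gam x)) by ring.
  rewrite (le_trans (ler_norm _))// normrM; apply: ler_pM => //.
    by rewrite (le_trans (ler_normD _ _))// lerD.
  rewrite normrM mulrC ler_wpM2r// ger0_norm ?mulr_ge0 ?gauss_ge0//.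
  rewrite /lam (@le_trans _ _ (gam x))//.
    by rewrite ler_piMr ?gauss_ge0 ?gauss_le1.
  by rewrite lerDr.
move=> D3.
have D1' := ler_wpM2l (ltW P0) D1.
have D2' := ler_wpM2l (ltW P0) D2.
have EC : (2 * pi) ^+ n * (2 * (e / C) + (M + K) * (e / C)) = e.
  have CN : C != 0 by rewrite gt_eqF.
  have CD (D : R) : (2 * pi) ^+ n * (2 * D + (M + K) * D) = C * D by rewrite /C; ring.
  by rewrite CD mulrC divfK.
move: D1' D2' D3 EC; lra.
Qed.

(** Passage from simple functions by dominated convergence. This generality is what allows a test
    function built from [h] itself. *)
Lemma plancherel_duality (psi : Rn -> R) (K : R) : measurable_fun setT psi ->
  (forall x, 0 <= psi x <= K) ->
  2 * (2 * pi) ^+ n * \int[mu]_x (h x * (psi x * gam x)) <=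
  B + (2 * pi) ^+ n * \int[mu]_x (psi x * gam x) ^+ 2.
Proof.
move=> mpsi psiK.
have mE : measurable_fun setT (EFin \o psi) by exact/measurable_EFinP.
pose f := nnsfun_approx measurableT mE.
have fcv x : f j x @[j --> \oo] --> psi x.
  have p0 y : setT y -> (0 <= (EFin \o psi) y)%E.
    by move=> _; rewrite /= lee_fin; have /andP[] := psiK y.
  have /fine_cvgP[_] := @cvg_nnsfun_approx _ _ _ _ measurableT _ mE p0 x I.
  exact.
have fle j x : f j x <= psi x.
  rewrite -(cvg_lim _ (fcv x))//; apply: nondecreasing_cvgn_le; last by apply/cvg_ex; eexists; exact: fcv.
  by move=> a b ab; have /lefP := @nd_nnsfun_approx _ _ _ _ measurableT _ mE _ _ ab; exact.
have fK j x : f j x <= K by rewrite (le_trans (fle j x))//; have /andP[] := psiK x.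
have f0 j x : 0 <= f j x by exact: fun_ge0.
have mf j : measurable_fun setT (f j) by exact: measurable_funP.
have mg := measurable_gauss 1 (0 : Rn).
have [] := @Rintegral_dominated_cvg _ _ _ mu (fun j x => h x * (f j x * gam x))
   (fun x => h x * (psi x * gam x)) (fun x => K * `|h x|).
- by move=> j; apply: measurable_funM => //; exact: measurable_funM.
- by move=> x; exact: (cvgM (cvg_cst _) (cvgM (fcv x) (cvg_cst _))).
- move=> j x; rewrite normrM mulrC ler_wpM2r// ger0_norm ?mulr_ge0 ?gauss_ge0//.
  by rewrite (le_trans _ (fK j x))// ler_piMr ?gauss_le1.
- by apply: integrable_funZ; exact: integrable_normr.
move=> _ cv1.
have [] := @Rintegral_dominated_cvg _ _ _ mu (fun j x => (f j x * gam x) ^+ 2)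
   (fun x => (psi x * gam x) ^+ 2) (fun x => (psi x * gam x) ^+ 2).
- by move=> j; apply: measurable_funX; exact: measurable_funM.
- by move=> x; exact: (cvgM (cvgM (fcv x) (cvg_cst _)) (cvgM (fcv x) (cvg_cst _))).
- move=> j x; rewrite ger0_norm ?sqr_ge0// lerXn2r ?nnegrE ?mulr_ge0 ?gauss_ge0//.
    by have /andP[] := psiK x.
  by rewrite ler_wpM2r ?gauss_ge0.
- apply: (@integrable_mul_gam_sq _ K) => // x.
  by have /andP[? ?] := psiK x; rewrite ger0_norm.
move=> _ cv2.
have cv1' : 2 * (2 * pi) ^+ n * \int[mu]_x (h x * (f j x * gam x)) @[j --> \oo] -->
    2 * (2 * pi) ^+ n * \int[mu]_x (h x * (psi x * gam x)) by exact: (cvgM (cvg_cst _) cv1).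
have cv2' : B + (2 * pi) ^+ n * \int[mu]_x (f j x * gam x) ^+ 2 @[j --> \oo] -->
    B + (2 * pi) ^+ n * \int[mu]_x (psi x * gam x) ^+ 2.
  exact: (cvgD (cvg_cst _) (cvgM (cvg_cst _) cv2)).
apply: (ler_cvg_to cv1' cv2'); apply: nearW => j.
exact: plancherel_duality_sfun (fK j).
Qed.

(** Take psi gam equal to the positive part of h on the set where it is at most j gam, and 0
    elsewhere. Then h psi gam = (psi gam)^2, and duality reads 2 I <= B + I with I finite, so I <=
    B. Finiteness of I is the reason for the truncation, removed by monotone convergence in j. *)
Lemma plancherel_ge_pos :
  (((2 * pi) ^+ n)%:E * \int[mu]_x ((Num.max 0 (h x)) ^+ 2)%:E <= B%:E)%E.
Proof.
have P0 := pi2n_gt0 R n.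
pose hp x := Num.max 0 (h x).
have mhp : measurable_fun setT hp by exact: measurable_maxr.
have hp0 x : 0 <= hp x by rewrite le_max lexx.
pose A j := [set x | hp x <= j%:R * gam x].
have mA j : measurable (A j).
  have -> : A j = setT `&` [set x | hp x <= j%:R * gam x] by rewrite setTI.
  apply: measurable_fun_le => //.
  by apply: measurable_funM => //; exact: measurable_gauss.
have mind j : measurable_fun setT (\1_(A j) : Rn -> R) by exact: measurable_indic.
have g0 x : 0 < gam x := gauss_gt0 _ _ _.
pose psi j x := hp x / gam x * \1_(A j) x.
have mginv : measurable_fun setT (fun x => (gam x)^-1) := @measurable_gaussV R n.
have mpsi j : measurable_fun setT (psi j).
  by apply: measurable_funM => //; exact: measurable_funM.
have psiK j x : 0 <= psi j x <= j%:R.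
  rewrite /psi indicE; have [xA|xA] := boolP (x \in A j); last by rewrite mulr0 lexx ler0n.
  rewrite mulr1 divr_ge0 ?(ltW (g0 x))//= ler_pdivrMr//.
  exact: (set_mem xA).
have E1 j x : psi j x * gam x = hp x * \1_(A j) x.
  by rewrite /psi mulrAC divfK// gt_eqF.
have E2 j x : h x * (psi j x * gam x) = (psi j x * gam x) ^+ 2.
  rewrite E1 /hp expr2; have [h0|h0] := leP 0 (h x).
    by rewrite indicE; case: (x \in A j); rewrite ?mulr1// !mulr0.
  by rewrite !mul0r mulr0.
have key j : (2 * pi) ^+ n * \int[mu]_x (psi j x * gam x) ^+ 2 <= B.
  have := plancherel_duality (mpsi j) (psiK j).
  under eq_Rintegral do rewrite E2.
  by move=> H; move: H; lra.
have ipsi j : L1 (fun x => (psi j x * gam x) ^+ 2).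
  apply: (@integrable_mul_gam_sq _ j%:R) => // x.
  by have /andP[? ?] := psiK j x; rewrite ger0_norm.
pose g j x : \bar R := (((2 * pi) ^+ n)%:E * ((psi j x * gam x) ^+ 2)%:E)%E.
have mg j : measurable_fun setT (g j).
  by apply: emeasurable_funM => //; apply/measurable_EFinP; exact: integrable_measurable (ipsi j).
have gg0 j x : setT x -> (0 <= g j x)%E.
  by move=> _; rewrite /g -EFinM lee_fin mulr_ge0 ?sqr_ge0// ltW.
have ndg x : setT x -> {homo g^~ x : a b / (a <= b)%N >-> (a <= b)%E}.
  move=> _ a b ab; rewrite /g -!EFinM lee_fin ler_wpM2l ?(ltW P0)// !E1.
  rewrite lerXn2r ?nnegrE ?mulr_ge0//.
  rewrite ler_wpM2l// !indicE ler_nat.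
  have [xA|] := boolP (x \in A a); last by [].
  rewrite mem_set//; move: (set_mem xA) => /le_trans; apply.
  by rewrite ler_wpM2r ?(ltW (g0 x))// ler_nat.
have cg x : g j x @[j --> \oo] --> (((2 * pi) ^+ n)%:E * (hp x ^+ 2)%:E)%E.
  apply: cvg_near_cst.
  exists (Num.trunc (hp x / gam x)).+1 => // j /= hj.
  rewrite /g E1 indicE mem_set ?mulr1// /A /= -ler_pdivrMr//.
  by rewrite (le_trans (ltW (truncnS_gt _)))// ler_nat.
have := @cvg_monotone_convergence _ _ _ mu setT measurableT g mg gg0 ndg.
have -> : (\int[mu]_x limn (g^~ x) = ((2 * pi) ^+ n)%:E * \int[mu]_x (hp x ^+ 2)%:E)%E.
  rewrite -ge0_integralZl//; last 3 first.
  - by apply/measurable_EFinP; exact: measurable_funX.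
  - by move=> x _; rewrite lee_fin sqr_ge0.
  - by rewrite lee_fin ltW.
  by apply: eq_integral => x _; apply/cvg_lim => //; exact: cg.
move=> cv; rewrite -(cvg_lim _ cv)//; apply: lime_le; first by apply/cvg_ex; eexists; exact: cv.
apply: nearW => j; rewrite /g.
have -> : (\int[mu]_x (((2 * pi) ^+ n)%:E * ((psi j x * gam x) ^+ 2)%:E) =
   ((2 * pi) ^+ n * \int[mu]_x (psi j x * gam x) ^+ 2)%:E)%E.
  rewrite EFinM EFin_Rintegral// ge0_integralZl//.
  - by apply/measurable_EFinP; exact: integrable_measurable (ipsi j).
  - by move=> x _; rewrite lee_fin sqr_ge0.
  - by rewrite lee_fin ltW.
by rewrite lee_fin.
Qed.

End plancherel_ge.

(** The positive parts of h and -h each obey the bound B, because both functions have the same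
    squared transform; their sum explains the factor 2. *)
Lemma plancherel_ge (R : realType) (n : nat) (h : 'rV[R]_n -> R) (B : R) :
  (lebesgue_rV R n).-integrable setT (EFin \o h) ->
  (\int[lebesgue_rV R n]_x (fcos h x ^+ 2 + fsin h x ^+ 2)%:E <= B%:E)%E ->
  (((2 * pi) ^+ n)%:E * \int[lebesgue_rV R n]_x (h x ^+ 2)%:E <= (2 * B)%:E)%E.
Proof.
move=> hi hB.
have mh := integrable_measurable hi.
have hNi : (lebesgue_rV R n).-integrable setT (EFin \o (fun x => -1 * h x)).
  exact: integrable_funZ.
have EC x : fcos (fun x => -1 * h x) x = - fcos h x.
  rewrite /fcos -[RHS]mulN1r -RintegralZl//; last exact: integrable_cos.
  by apply: eq_Rintegral => y _; rewrite mulrA.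
have ES x : fsin (fun x => -1 * h x) x = - fsin h x.
  rewrite /fsin -[RHS]mulN1r -RintegralZl//; last exact: integrable_sin.
  by apply: eq_Rintegral => y _; rewrite mulrA.
have hB' : (\int[lebesgue_rV R n]_x (fcos (fun x => (-1 * h x)%R) x ^+ 2 +
   fsin (fun x => (-1 * h x)%R) x ^+ 2)%:E <= B%:E)%E.
  by under eq_integral do rewrite EC ES !sqrrN.
have P0 := pi2n_gt0 R n.
have pos (u : 'rV[R]_n -> R) : (lebesgue_rV R n).-integrable setT (EFin \o u) ->
    (\int[lebesgue_rV R n]_x (fcos u x ^+ 2 + fsin u x ^+ 2)%:E <= B%:E)%E ->
    integral_bound (lebesgue_rV R n) (fun x => Num.max 0 (u x) ^+ 2) ((2 * pi) ^- n * B).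
  move=> ui uB; apply: integral_bound_sq.
    by apply: measurable_maxr => //; exact: integrable_measurable ui.
  by rewrite EFinM lee_pdivlMl//; exact: plancherel_ge_pos.
have [_ _] := integral_boundD (pos _ hi hB) (pos _ hNi hB').
have -> : (\int[lebesgue_rV R n]_x (h x ^+ 2)%:E = \int[lebesgue_rV R n]_x
    (Num.max 0 (h x) ^+ 2 + Num.max 0 (-1 * h x) ^+ 2)%:E)%E.
  apply: eq_integral => x _; congr EFin.
  rewrite mulN1r; have [h0|h0] := leP 0 (h x).
    by rewrite max_l ?oppr_le0// expr0n addr0.
  by rewrite max_r ?oppr_ge0 ?ltW// sqrrN expr0n add0r.
move=> H; rewrite -lee_pdivlMl//; apply: (le_trans H).
by rewrite -EFinM lee_fin le_eqVlt; apply/orP; left; apply/eqP; ring.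
Qed.

(** * Gaussian waves as Schwartz functions *)

Section trig_poly.
Variables (R : realType) (n : nat).
Notation Rn := 'rV[R]_n.
Implicit Types (x v a xi : Rn) (c b : R) (u : Rn -> R).

(** A class closed under partial derivatives; the phase [b] yields the sine as a cosine shifted by
    pi / 2. Multiplied by a Gaussian it stays closed, which gives the Schwartz property of all test
    functions used. *)
Inductive trig_poly : (Rn -> R) -> Prop :=
| trig_poly_cst k : trig_poly (fun=> k)
| trig_poly_coord i : trig_poly (fun x => x ord0 i)
| trig_poly_cos xi b : trig_poly (fun x => cos (dotr xi x + b))
| trig_poly_add u w : trig_poly u -> trig_poly w -> trig_poly (fun x => u x + w x)
| trig_poly_mul u w : trig_poly u -> trig_poly w -> trig_poly (fun x => u x * w x).

Lemma is_derive_line (f : Rn -> R) x v (df : R) :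
  is_derive (0 : R) (1 : R) (fun h : R => f (h *: v + x) : R^o) df ->
  is_derive x v (f : Rn -> R^o) df.
Proof.
move=> [dv dd]; apply: DeriveDef; first exact: ((@derivable1P _ _ _ (f : Rn -> R^o) x v).2 dv).
rewrite -dd /derive; set g1 := fun h => h^-1 *: _; set g2 := fun h => h^-1 *: _.
suff -> : g1 = g2 by [].
by apply/funext => h; rewrite /g1 /g2 /= scale0r add0r addr0 [h *: 1]mulr1.
Qed.

Lemma derive_is_derive (f : Rn -> R) x v (df : R) :
  is_derive x v (f : Rn -> R^o) df -> derive (f : Rn -> R^o) x v = df.
Proof. by move=> []. Qed.

Lemma dotrZr (k : R) x y : dotr x (k *: y) = k * dotr x y.
Proof. by rewrite /dotr big_distrr; apply: eq_bigr => i _; rewrite /= mxE mulrCA. Qed.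

Lemma dotr_delta x (i : 'I_n) : dotr x (delta_mx ord0 i) = x ord0 i.
Proof.
rewrite /dotr (bigD1 i)//= mxE !eqxx mulr1 big1 ?addr0// => j ji.
by rewrite mxE eqxx (negbTE ji) mulr0.
Qed.

Lemma is_derive_line_fun (g : R -> R) (g' : R -> R) (k b : R) :
  (forall y, is_derive y (1:R) (g : R -> R^o) (g' y)) ->
  is_derive (0:R) (1:R) (fun h : R => g (k * h + b) : R^o) (k * g' b).
Proof.
move=> dg; have := is_derive_phase k b 0 dg; rewrite mulr0 add0r; exact.
Qed.

Lemma trig_poly_derive u (i : 'I_n) : trig_poly u -> exists2 u', trig_poly u' &
  forall x, is_derive x (delta_mx ord0 i : Rn) (u : Rn -> R^o) (u' x).
Proof.
elim=> [k|j|xi b|{}u w _ [u' tu' du] _ [w' tw' dw]|{}u w tu [u' tu' du] tw [w' tw' dw]].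
- exists (fun=> 0); first exact: trig_poly_cst.
  by move=> x; exact: is_derive_cst.
- exists (fun=> (delta_mx ord0 i : Rn) ord0 j); first exact: trig_poly_cst.
  move=> x; apply: is_derive_line.
  have -> : (fun h : R => (h *: (delta_mx ord0 i : Rn) + x) ord0 j) =
      (fun h : R => id ((delta_mx ord0 i : Rn) ord0 j * h + x ord0 j)).
    by apply/funext => h; rewrite !mxE mulrC.
  have := @is_derive_line_fun id (fun=> 1) ((delta_mx ord0 i : Rn) ord0 j) (x ord0 j)
    (fun r : R => is_derive_id r 1).
  by rewrite mulr1.
- exists (fun x => - xi ord0 i * cos (dotr xi x + (b - pi / 2))).
    by apply: trig_poly_mul; [exact: trig_poly_cst|exact: trig_poly_cos].
  move=> x; apply: is_derive_line.
  have -> : (fun h : R => cos (dotr xi (h *: (delta_mx ord0 i : Rn) + x) + b)) =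
      (fun h : R => cos (xi ord0 i * h + (dotr xi x + b))).
    by apply/funext => h; rewrite dotrDr dotrZr dotr_delta addrA mulrC.
  have := @is_derive_line_fun cos (fun r : R => - sin r) (xi ord0 i) (dotr xi x + b)
    (fun r : R => is_derive_cos r).
  by rewrite addrA cosBpihalf mulrN mulNr.
- exists (fun x => u' x + w' x); first exact: trig_poly_add.
  by move=> x; exact: (is_deriveD (du x) (dw x)).
- exists (fun x => u x * w' x + w x * u' x).
    by apply: trig_poly_add; exact: trig_poly_mul.
  by move=> x; exact: (is_deriveM (du x) (dw x)).
Qed.

Lemma trig_poly_continuous u : trig_poly u -> continuous u.
Proof.
elim=> [k|j|xi b|{}u w _ cu _ cw|{}u w _ cu _ cw].
- exact: cst_continuous.
- exact: coord_continuous.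
- move=> x.
  have cd : dotr xi y @[y --> x] --> dotr xi x.
    rewrite /dotr; elim: (index_enum _) => [|i r IH].
      under eq_fun do rewrite big_nil.
      by rewrite big_nil; exact: (@cst_continuous Rn R 0 x).
    under eq_fun do rewrite big_cons.
    by rewrite big_cons; exact: (cvgD (cvgM (cvg_cst _) (@coord_continuous _ _ _ _ _ x)) IH).
  exact: (cvg_comp _ cos (cvgD cd (cvg_cst b)) (@continuous_cos R _)).
- by move=> x; exact: (cvgD (cu x) (cw x)).
- by move=> x; exact: (cvgM (cu x) (cw x)).
Qed.

Lemma trig_poly_growth u : trig_poly u ->
  exists N (K : R), 0 <= K /\ forall x, `|u x| <= K * (1 + dotr x x) ^+ N.
Proof.
have q1 x : 1 <= 1 + dotr x x by rewrite lerDl dotr_ge0.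
have mono (k l : nat) x : (k <= l)%N -> (1 + dotr x x) ^+ k <= (1 + dotr x x) ^+ l.
  by move=> ab; rewrite ler_weXn2l.
elim=> [k|j|xi b|{}u w _ [N1 [K1 [K10 h1]]] _ [N2 [K2 [K20 h2]]]|{}u w _ [N1 [K1 [K10 h1]]] _ [N2 [K2 [K20 h2]]]].
- by exists 0%N, `|k|; split=> // x; rewrite expr0 mulr1.
- exists 1%N, 1; split=> // x; rewrite mul1r expr1.
  have : `|x ord0 j| ^+ 2 <= dotr x x.
    rewrite real_normK ?num_real// /dotr (bigD1 j)//= -expr2 lerDl sumr_ge0// => k _.
    exact: sqr_ge0.
  have := sqr_ge0 (`|x ord0 j| - 1); rewrite sqrrB mulr1 expr1n mulr2n; have := normr_ge0 (x ord0 j); lra.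
- by exists 0%N, 1; split=> // x; rewrite expr0 mulr1 normr_cos_le1.
- exists (maxn N1 N2), (K1 + K2); split; first exact: addr_ge0.
  move=> x; rewrite (le_trans (ler_normD _ _))// mulrDl lerD//.
    by rewrite (le_trans (h1 x))// ler_wpM2l// mono// leq_maxl.
  by rewrite (le_trans (h2 x))// ler_wpM2l// mono// leq_maxr.
- exists (N1 + N2)%N, (K1 * K2); split; first exact: mulr_ge0.
  move=> x; rewrite normrM exprD mulrACA ler_pM//.
Qed.

Definition trig_gauss c a (f : Rn -> R) := exists2 u, trig_poly u & f = (fun x => u x * gauss c a x).

Lemma is_derive_gauss c a x (i : 'I_n) :
  is_derive x (delta_mx ord0 i : Rn) (gauss c a : Rn -> R^o)
    ((- (2 * c)) * (x ord0 i - a ord0 i) * gauss c a x).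
Proof.
apply: is_derive_line; set e := (delta_mx ord0 i : Rn).
have E h : gauss c a (h *: e + x) = expR (- (c * (h ^+ 2 + 2 * h * (x ord0 i - a ord0 i) + dotr (x - a) (x - a)))).
  rewrite /gauss; congr (expR (- (c * _))).
  have dl z : dotr (h *: e) z = h * z ord0 i by rewrite dotrC dotrZr dotr_delta.
  have dr z : dotr z (h *: e) = h * z ord0 i by rewrite dotrC dl.
  have he : (h *: e) ord0 i = h by rewrite !mxE !eqxx mulr1.
  have ya : (x - a) ord0 i = x ord0 i - a ord0 i by rewrite !mxE.
  rewrite -addrA; move: (x - a) ya => y ya.
  by rewrite dotrDl !dotrDr !dl dr he ya; ring.
under eq_fun do rewrite E.
set d := x ord0 i - a ord0 i; set D := dotr (x - a) (x - a).
have H : is_derive (0:R) (1:R) (fun h : R => - (c * (h ^+ 2 + 2 * h * d + D)) : R^o) (- (2 * c) * d).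
  apply: is_derive_eq; rewrite /GRing.scale /=; ring.
apply: (is_derive_eq (@is_derive1_comp _ expR (fun h : R => - (c * (h ^+ 2 + 2 * h * d + D))) _ _ _ (is_derive_expR _) H)).
by rewrite /GRing.scale /= expr0n mulr0 mul0r !add0r mulrC /gauss -/D.
Qed.

Lemma trig_gauss_derive c a f (i : 'I_n) : trig_gauss c a f -> exists2 f', trig_gauss c a f' &
  forall x, is_derive x (delta_mx ord0 i : Rn) (f : Rn -> R^o) (f' x).
Proof.
move=> [u tu ->]; have [u' tu' du] := trig_poly_derive i tu.
exists (fun x => (u' x + (- (2 * c)) * (x ord0 i + - a ord0 i) * u x) * gauss c a x).
  exists (fun x => (u' x + (- (2 * c)) * (x ord0 i + - a ord0 i) * u x)) => //.
  apply: trig_poly_add => //; apply: trig_poly_mul => //.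
  apply: trig_poly_mul; first exact: trig_poly_cst.
  by apply: trig_poly_add; [exact: trig_poly_coord|exact: trig_poly_cst].
move=> x; apply: (is_derive_eq (is_deriveM (du x) (is_derive_gauss c a x i))).
by rewrite /GRing.scale /=; ring.
Qed.

Lemma trig_gauss_partial c a f (i : 'I_n) : trig_gauss c a f -> trig_gauss c a (partial i f).
Proof.
move=> /(trig_gauss_derive i) [f' tf' df].
suff -> : partial i f = f' by [].
by apply/funext => x; exact: derive_is_derive (df x).
Qed.

Lemma trig_gauss_partials c a f (s : seq 'I_n) :
  trig_gauss c a f -> trig_gauss c a (partials s f).
Proof. by move=> tf; elim: s => //= i s; exact: trig_gauss_partial. Qed.

Lemma trig_gauss_smooth c a f : trig_gauss c a f -> smooth f.
Proof.
move=> tf s; have tp := trig_gauss_partials s tf; split.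
  have [u tu E] := tp; rewrite E.
  have cu : continuous (fun x => u x * gauss c a x).
    by move=> x; exact: (cvgM (@trig_poly_continuous _ tu x) (@continuous_gauss R n c a x)).
  exact: cu.
by move=> i x; have [f' _ /(_ x) []] := trig_gauss_derive i tp.
Qed.

Lemma expn_le_expR (c : R) (m : nat) : 0 < c ->
  exists2 K : R, 0 <= K & forall v : R, 0 <= v -> (1 + v) ^+ m <= K * expR (c * v).
Proof.
move=> c0; case: m => [|m].
  exists 1 => // v v0; rewrite expr0 mul1r -expR0 ler_expR mulr_ge0// ltW//.
(* With this d, 1 + v <= (1 + 1/d)(1 + d v) <= (1 + 1/d) exp (d v), and the power [m.+1] of exp (d
   v) is exp (c v). *)
pose d := c / m.+1%:R; have d0 : 0 < d by rewrite divr_gt0.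
pose A := 1 + d^-1; have A0 : 0 <= A by rewrite addr_ge0// invr_ge0 ltW.
exists (A ^+ m.+1); first exact: exprn_ge0.
move=> v v0.
have -> : expR (c * v) = expR (d * v) ^+ m.+1.
  rewrite -expRM_natl; congr expR; rewrite /d; field.
  by rewrite addrC natr1 pnatr_eq0.
rewrite -exprMn; apply: lerXn2r; rewrite ?nnegrE ?addr_ge0 ?mulr_ge0 ?expR_ge0//.
apply: (@le_trans _ _ (A * (1 + d * v))); last by rewrite ler_wpM2l// expR_ge1Dx.
have -> : A * (1 + d * v) = 1 + v + (d^-1 + d * v) by rewrite /A; field; rewrite gt_eqF.
by rewrite lerDl addr_ge0 ?invr_ge0 ?mulr_ge0// ltW.
Qed.

Lemma trig_gauss_bounded c a f (k : nat) : 0 < c -> trig_gauss c a f ->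
  exists M : R, forall x, enorm x ^+ k * `|f x| <= M.
Proof.
move=> c0 [u tu ->]; have [N [K [K0 hK]]] := trig_poly_growth tu.
have [M M0 hM] := @expn_le_expR c (k + N)%N c0.
(* From |x|^2 <= 2 |x - a|^2 + 2 |a|^2 one gets 1 + |x|^2 <= A (1 + |x - a|^2), which recentres the
   polynomial growth at the Gaussian. *)
pose A := 2 + 2 * dotr a a.
have A0 : 0 <= A by rewrite addr_ge0// mulr_ge0// dotr_ge0.
exists (K * (A ^+ (k + N) * M)) => x.
have q0 := dotr_ge0 x.
have e1 : enorm x ^+ k <= (1 + dotr x x) ^+ k.
  apply: lerXn2r; rewrite ?nnegrE ?addr_ge0 ?sqrtr_ge0//.
  have := sqr_ge0 (enorm x - 1); rewrite sqrrB mulr1 expr1n mulr2n /enorm sqr_sqrtr//.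
  have := sqrtr_ge0 (dotr x x); lra.
have q1 : 1 + dotr x x <= A * (1 + dotr (x - a) (x - a)).
  have [y ->] : exists y, x = y + a by exists (x - a); rewrite subrK.
  rewrite addrK; have := dotr_ge0 (y - a); have := dotr_ge0 y; have := dotr_ge0 a.
  rewrite /A !dotrDl !dotrDr !dotrNl !dotrNr (dotrC a y).
  move: (dotr a a) (dotr y y) (dotr y a) => p q r; nra.
rewrite normrM (ger0_norm (gauss_ge0 _ _ _)).
apply: (@le_trans _ _ ((1 + dotr x x) ^+ k * (K * (1 + dotr x x) ^+ N * gauss c a x))).
  apply: ler_pM => //; first by rewrite exprn_ge0// sqrtr_ge0.
    by rewrite mulr_ge0// gauss_ge0.
  by rewrite ler_wpM2r ?gauss_ge0.
have -> : (1 + dotr x x) ^+ k * (K * (1 + dotr x x) ^+ N * gauss c a x) =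
   K * ((1 + dotr x x) ^+ (k + N) * gauss c a x) by rewrite exprD; ring.
rewrite ler_wpM2l//.
rewrite /gauss expRN ler_pdivrMr ?expR_gt0//.
apply: (@le_trans _ _ ((A * (1 + dotr (x - a) (x - a))) ^+ (k + N))).
  have B0 : 0 <= 1 + dotr (x - a) (x - a) by rewrite addr_ge0 ?dotr_ge0.
  by apply: lerXn2r; rewrite ?nnegrE ?(mulr_ge0 A0 B0) ?(addr_ge0 ler01 q0).
rewrite exprMn -mulrA ler_wpM2l ?exprn_ge0//.
exact: hM (dotr_ge0 _).
Qed.

Lemma normr_sum_le (I : finType) (F : I -> R) (i : I) : F i <= \sum_j `|F j|.
Proof.
rewrite (bigD1 i)//= (le_trans (ler_norm _))// lerDl sumr_ge0//.
Qed.

Lemma schwartz_trig_gauss c a (f1 f2 : Rn -> R) : 0 < c -> trig_gauss c a f1 ->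
  trig_gauss c a f2 -> schwartz (fun x => Complex (f1 x) (f2 x)).
Proof.
move=> c0 t1 t2; split; [exact: trig_gauss_smooth t1|exact: trig_gauss_smooth t2|].
move=> N.
have H (s : seq 'I_n) (k : nat) : exists M : R, forall x,
    enorm x ^+ k * cmod (Complex (partials s f1 x) (partials s f2 x)) <= M.
  have [M1 h1] := trig_gauss_bounded k c0 (trig_gauss_partials s t1).
  have [M2 h2] := trig_gauss_bounded k c0 (trig_gauss_partials s t2).
  exists (M1 + M2) => x; apply: (le_trans _ (lerD (h1 x) (h2 x))).
  rewrite -mulrDr ler_wpM2l ?exprn_ge0 ?sqrtr_ge0// /cmod /=.
  rewrite -[leRHS]ger0_norm ?addr_ge0// -sqrtr_sqr ler_wsqrtr//.
  rewrite sqrrD !real_normK ?num_real// mulr2n.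
  have := mulr_ge0 (normr_ge0 (partials s f1 x)) (normr_ge0 (partials s f2 x)); lra.
(* A seminorm needs one constant for all words of length at most N and powers at most N. These are
   finitely many, so chosen constants are summed over tuples. *)
pose F s k := projT1 (cid (H s k)); have hF s k := projT2 (cid (H s k)).
pose G (p : 'I_N.+1 * 'I_N.+1) : R := \sum_(t : p.1.-tuple 'I_n) `|F t p.2|.
exists (\sum_p `|G p|) => s k x sN kN.
pose p : 'I_N.+1 * 'I_N.+1 := (Ordinal (sN : (size s < N.+1)%N), Ordinal (kN : (k < N.+1)%N)).
apply: (le_trans (hF s k x)); apply: (le_trans _ (normr_sum_le G p)).
exact: (@normr_sum_le _ (fun t : (size s).-tuple 'I_n => F t k) (in_tuple s)).
Qed.

End trig_poly.

(** * Fourier transforms of L^m functions *)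

Local Open Scope complex_scope.
Local Notation Re := complex.Re.
Local Notation Im := complex.Im.

Section complex_parts.
Variable R : realType.
Implicit Types x y : R[i].

Lemma ReM x y : Re (x * y) = Re x * Re y - Im x * Im y.
Proof. by case: x => a b; case: y => c d. Qed.

Lemma ImM x y : Im (x * y) = Re x * Im y + Im x * Re y.
Proof. by case: x => a b; case: y => c d. Qed.

Lemma ReD x y : Re (x + y) = Re x + Re y.
Proof. by case: x => a b; case: y => c d. Qed.

Lemma ImD x y : Im (x + y) = Im x + Im y.
Proof. by case: x => a b; case: y => c d. Qed.

Lemma ReB x y : Re (x - y) = Re x - Re y.
Proof. by case: x => a b; case: y => c d. Qed.

Lemma ImB x y : Im (x - y) = Im x - Im y.
Proof. by case: x => a b; case: y => c d. Qed.

Lemma ReZ (k : R) x : Re (k%:C * x) = k * Re x.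
Proof. by rewrite ReM /= mul0r subr0. Qed.

Lemma ImZ (k : R) x : Im (k%:C * x) = k * Im x.
Proof. by rewrite ImM /= mul0r addr0. Qed.

Lemma normr_Re_le x : `|Re x| <= cmod x.
Proof.
by rewrite -sqrtr_sqr /cmod ler_wsqrtr// lerDl sqr_ge0.
Qed.

Lemma normr_Im_le x : `|Im x| <= cmod x.
Proof.
by rewrite -sqrtr_sqr /cmod ler_wsqrtr// lerDr sqr_ge0.
Qed.

Lemma complex_eqP x y : Re x = Re y -> Im x = Im y -> x = y.
Proof. by case: x => a b; case: y => c d /= -> ->. Qed.

End complex_parts.

Section gauss_pair.
Variables (R : realType) (n : nat).
Notation Rn := 'rV[R]_n.
Notation mu := (@lebesgue_rV R n).
Notation C := R[i].
Implicit Types (c b : R) (x y xi : Rn).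

(** The function exp (i x . xi) times a centred Gaussian. Its Fourier transform is the real Gaussian
    [fgauss c x], so testing against it evaluates a Gaussian convolution at x. *)
Definition wave (c : R) (x xi : Rn) : C :=
  (gauss c 0 xi * cos (dotr x xi)) +i* (gauss c 0 xi * sin (dotr x xi)).

Lemma sin_cos_shift (z : R) : sin z = cos (z + - (pi / 2)).
Proof. by rewrite cosBpihalf. Qed.

Lemma trig_gauss_cos c x : trig_gauss c 0 (fun xi => gauss c 0 xi * cos (dotr x xi)).
Proof.
exists (fun xi : Rn => cos (dotr x xi + 0)); first exact: trig_poly_cos.
by apply/funext => xi; rewrite addr0 mulrC.
Qed.

Lemma trig_gauss_sin c x : trig_gauss c 0 (fun xi => gauss c 0 xi * sin (dotr x xi)).
Proof.
exists (fun xi : Rn => cos (dotr x xi + - (pi / 2))); first exact: trig_poly_cos.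
by apply/funext => xi; rewrite -sin_cos_shift mulrC.
Qed.

Lemma schwartz_wave c x : 0 < c -> schwartz (wave c x).
Proof.
by move=> c0; apply: (schwartz_trig_gauss c0); [exact: trig_gauss_cos|exact: trig_gauss_sin].
Qed.

Lemma schwartz_fgauss c x : 0 < c -> schwartz (fun y : Rn => (fgauss c x y)%:C : C).
Proof.
move=> c0; have c1 : 0 < (4 * c)^-1 by rewrite invr_gt0 mulr_gt0.
apply: (@schwartz_trig_gauss R n (4 * c)^-1 x (fgauss c x) (fun=> 0)) => //.
  by exists (fun=> Num.sqrt (pi / c) ^+ n); first exact: trig_poly_cst.
exists (fun=> 0); first exact: trig_poly_cst.
by apply/funext => y; rewrite mul0r.
Qed.

Lemma fourier_wave c x : 0 < c -> fourier (wave c x) = (fun y => (fgauss c x y)%:C).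
Proof.
move=> c0; apply/funext => y; apply: complex_eqP; rewrite /fourier /cintegral.
  transitivity (\int[mu]_xi (gauss c 0 xi * cos (dotr (x - y) (xi - 0) + 0))).
    apply: eq_Rintegral => xi _; rewrite ReM /wave /expi /=.
    rewrite subr0 addr0 dotrBl cosB cosN sinN (dotrC xi y); ring.
  rewrite fourier_gauss// cos0 mulr1 [RHS]/= /fgauss /gauss; congr (_ * expR _).
  by rewrite mulrC (dotr_subC x y).
transitivity (\int[mu]_xi (gauss c 0 xi * cos (dotr (x - y) (xi - 0) + - (pi / 2)))).
  apply: eq_Rintegral => xi _; rewrite ImM /wave /expi /=.
  rewrite -sin_cos_shift subr0 dotrBl sinB cosN sinN (dotrC xi y); ring.
by rewrite fourier_gauss// cosN cos_pihalf mulr0.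
Qed.

Lemma inv_fourier_fgauss c x : 0 < c ->
  inv_fourier (fun y : Rn => (fgauss c x y)%:C) = wave c x.
Proof.
move=> c0; have c1 : 0 < (4 * c)^-1 by rewrite invr_gt0 mulr_gt0.
have P0 : (2 * pi) ^+ n != 0 :> R by rewrite gt_eqF// pi2n_gt0.
have key xi b : (2 * pi) ^- n * \int[mu]_y (fgauss c x y * cos (dotr xi (y - x) + b)) =
    gauss c 0 xi * cos b.
  transitivity ((2 * pi) ^- n * (Num.sqrt (pi / c) ^+ n *
      \int[mu]_y (gauss (4 * c)^-1 x y * cos (dotr xi (y - x) + b)))).
    congr (_ * _); rewrite -RintegralZl//.
      by apply: eq_Rintegral => y _; rewrite mulrA.
    apply: integrable_gauss_mul => //; first exact: measurable_cos_phase.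
    by move=> y; exact: normr_cos_le1.
  rewrite fourier_gauss// !mulrA -[_ * _ * Num.sqrt (pi / (4 * c)^-1) ^+ n]mulrA sqrt_gauss_norm//.
  rewrite mulVf// mul1r /gauss subr0; congr (expR (- _) * _).
  by field; rewrite gt_eqF.
apply/funext => xi; apply: complex_eqP; rewrite /inv_fourier ?ReZ ?ImZ.
  rewrite [RHS]/= -key /cintegral; congr (_ * _).
  apply: eq_Rintegral => y _; rewrite ReM /expi /=.
  by rewrite mulr0 subr0 dotrBr (dotrC x xi) subrK mulrC.
rewrite [RHS]/= sin_cos_shift -key /cintegral; congr (_ * _).
apply: eq_Rintegral => y _; rewrite ImM /expi /=.
by rewrite mulr0 add0r dotrBr (dotrC x xi) addrA subrK -sin_cos_shift mulrC.
Qed.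

(* What [is_fourier f fhat] says on the test functions [wave c x]. *)
Definition gauss_pair (f fhat : Rn -> C) := cmeasurable fhat /\
  forall c x, 0 < c -> cintegrable (fun xi => fhat xi * wave c x xi) /\
    cintegral (fun xi => fhat xi * wave c x xi) =
    cintegral (fun y => f y * (fgauss c x y)%:C).

Lemma is_fourier_gauss_pair f fhat : is_fourier f fhat -> gauss_pair f fhat.
Proof.
move=> [mf H]; split=> // c x c0; have [ci E] := H _ (schwartz_wave x c0).
by split=> //; move: E; rewrite /dist_fourier /dist_of fourier_wave// => ->.
Qed.

(** Evaluate [absD2 u0] on [fgauss c x]: one side is a pairing with [D2u0], the other a pairing of
    [q] with the inverse transform of [fgauss c x], which is [wave c x]. *)
Lemma absD2_gauss_pair (u0 : test_functional R n) (D2u0 q : Rn -> C) :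
  represents D2u0 (absD2 u0) ->
  represents q (dist_mul (@sq_symbol R n) (dist_fourier u0)) ->
  gauss_pair D2u0 q.
Proof.
move=> [mD HD] [mq Hq]; split=> // c x c0; have [ci E] := Hq _ (schwartz_wave x c0).
split=> //; have [_ ED] := HD _ (schwartz_fgauss x c0).
by move: ED; rewrite /absD2 /dist_inv_fourier inv_fourier_fgauss// E /dist_of.
Qed.

End gauss_pair.

Section gauss_pair_L2.
Variables (R : realType) (n : nat).
Notation Rn := 'rV[R]_n.
Notation mu := (@lebesgue_rV R n).
Notation C := R[i].
Implicit Types (c : R) (x y xi : Rn) (h : Rn -> R).
Variables (f fhat : Rn -> C) (m : R).
Hypotheses (ffhat : gauss_pair f fhat) (m12 : 1 <= m <= 2) (fLm : in_Lp m f).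

Let m0 : 0 < m. Proof. by have /andP[m1 _] := m12; exact: lt_le_trans ltr01 m1. Qed.

Let N := fine (Lpnorm m f).

Let N0 : 0 <= N.
Proof. by rewrite fine_ge0// Lnorm_ge0. Qed.

Let Lpnorm_part (g : Rn -> R) : measurable_fun setT g -> (forall x, `|g x| <= cmod (f x)) ->
  (\int[mu]_x (`|g x| `^ m)%:E <= (N `^ m)%:E)%E.
Proof.
move=> mg gf; have [[mfR mfI] Nfin] := fLm.
have NE : (N%:E = Lpnorm m f)%E by rewrite fineK// ge0_fin_numE// Lnorm_ge0.
have : (Lpnorm m f `^ m = \int[mu]_x (`|(cmod (f x))%:E| `^ m))%E.
  by rewrite /Lpnorm poweR_Lnorm// lt0r_neq0.
rewrite -NE poweR_EFin => ->; apply: ge0_le_integral => //.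
- by apply/measurable_EFinP; apply: (measurableT_comp (measurable_powR m)); exact: measurableT_comp.
- apply/measurable_EFinP; apply: (measurableT_comp (measurable_powR m)).
  apply: measurableT_comp => //; apply: measurableT_comp.
    by apply: continuous_measurable_fun; exact: sqrt_continuous.
  by apply: measurable_funD; exact: measurable_funX.
move=> x _; rewrite lee_fin; apply: ge0_ler_powR; rewrite ?nnegrE//.
  exact: ltW.
by rewrite (le_trans (gf x))// ler_norm.
Qed.

Lemma integrable_gauss_fhat c : 0 < c ->
  L1 (fun xi => gauss c 0 xi * Re (fhat xi)) /\ L1 (fun xi => gauss c 0 xi * Im (fhat xi)).
Proof.
move=> c0; have [[iR iI] _] := ffhat.2 c 0 c0; split.
  apply: eq_integrable iR => // xi _; rewrite /= ReM /wave /=.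
  by rewrite dotr0l cos0 sin0 mulr1 mulr0 mulr0 subr0 mulrC.
apply: eq_integrable iI => // xi _; rewrite /= ImM /wave /=.
by rewrite dotr0l cos0 sin0 mulr1 mulr0 mulr0 add0r mulrC.
Qed.

(** The real and imaginary parts of the [gauss_pair] identity mix transforms of [h1] and [h2].
    Evaluating them at x and -x separates the two by parity; Young bounds the four right-hand sides
    and [plancherel_ge] returns to [h1] and [h2]. The base of the last power is the mass of the
    Gaussian kernel, which grows with c, while the exponent is at most 0. *)
Lemma gauss_fhat_L2 c : 0 < c ->
  (\int[mu]_xi ((gauss c 0 xi * Re (fhat xi)) ^+ 2)%:E <=
    (4 * (2 * pi) ^+ n * N ^+ 2 * (Num.sqrt (pi / (4 * c)^-1) ^+ n) `^ (1 - 2 / m))%:E)%E /\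
  (\int[mu]_xi ((gauss c 0 xi * Im (fhat xi)) ^+ 2)%:E <=
    (4 * (2 * pi) ^+ n * N ^+ 2 * (Num.sqrt (pi / (4 * c)^-1) ^+ n) `^ (1 - 2 / m))%:E)%E.
Proof.
move=> c0.
have P0 := pi2n_gt0 R n.
have c1 : 0 < (4 * c)^-1 by rewrite invr_gt0 mulr_gt0.
have [i1 i2] := integrable_gauss_fhat c0.
set h1 := fun xi => gauss c 0 xi * Re (fhat xi) in i1 *.
set h2 := fun xi => gauss c 0 xi * Im (fhat xi) in i2 *.
have [[mfR mfI] _] := fLm.
pose S : R := Num.sqrt (pi / (4 * c)^-1) ^+ n.
have S0 : 0 < S by rewrite exprn_gt0// sqrtr_gt0 divr_gt0// pi_gt0.
pose P : R := Num.sqrt (pi / c) ^+ n.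
have PS : P * S = (2 * pi) ^+ n by exact: sqrt_gauss_norm.
pose F (g : Rn -> R) x := \int[mu]_y (g y * fgauss c x y).
have FE (g : Rn -> R) x : L1 (fun y => g y * gauss (4 * c)^-1 x y) ->
    F g x = P * \int[mu]_y (g y * gauss (4 * c)^-1 x y).
  move=> gi; rewrite /F -RintegralZl//; apply: eq_Rintegral => y _.
  by rewrite mulrCA.
have gN x y : gauss (4 * c)^-1 (- x) y = gauss (4 * c)^-1 (- y) x.
  by rewrite gaussC /gauss -opprD dotrNl dotrNr !opprK.
have mN : measurable_fun setT (fun p : Rn * Rn => - p.1).
  have -> : (fun p : Rn * Rn => - p.1) = (fun p => 0 - p.1) by apply/funext => p; rewrite sub0r.
  exact: measurable_fun_rVB.
pose D := P ^+ 2 * (N ^+ 2 * S `^ (3 - 2 / m)).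
(* [phi] will be the identity or the reflection, since values at x and at -x are both needed. *)
have young (phi : Rn -> Rn) (g : Rn -> R) : measurable_fun setT (fun p : Rn * Rn => phi p.1) ->
    (forall y, (\int[mu]_x (gauss (4 * c)^-1 (phi x) y)%:E = S%:E)%E) ->
    measurable_fun setT g -> (forall x, `|g x| <= cmod (f x)) ->
  integral_bound mu (fun x => F g (phi x) ^+ 2) D.
  move=> mphi phiS mg gf; have gN' := Lpnorm_part mg gf.
  have k01 (p : Rn * Rn) : 0 <= gauss (4 * c)^-1 (phi p.1) p.2 <= 1.
    by rewrite gauss_ge0 gauss_le1// ltW.
  have mk : measurable_fun setT (fun p : Rn * Rn => gauss (4 * c)^-1 (phi p.1) p.2).
    exact: measurable_gauss2 mphi measurable_snd.
  have kS x : (\int[mu]_y (gauss (4 * c)^-1 (phi x) y)%:E = S%:E)%E by exact: ge0_integral_gauss.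
  have ia x := @young_integrable R n _ _ mk k01 kS g m N mg m12 gN' x.
  have m1 := @young_measurable R n _ _ mk k01 kS g m N mg m12 gN'.
  have b1 := @young_L2 R n _ _ mk k01 S0 kS phiS g m N mg m12 N0 gN'.
  have E : (fun x => F g (phi x)) = fun x => P * \int[mu]_y (g y * gauss (4 * c)^-1 (phi x) y).
    by apply/funext => x; rewrite FE//; exact: ia.
  have mF : measurable_fun setT (fun x => F g (phi x)).
    by rewrite E; exact: (measurable_funM (measurable_cst P) m1).
  have := integral_boundZ (sqr_ge0 P) (integral_bound_sq m1 b1).
  apply: integral_bound_le; first exact: measurable_funX.
  move=> x; have -> : F g (phi x) = P * _ := congr1 (@^~ x) E.
  by rewrite sqr_ge0 exprMn lexx.
have kS2 y : (\int[mu]_x (gauss (4 * c)^-1 x y)%:E = S%:E)%E.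
  by under eq_integral do rewrite gaussC; exact: ge0_integral_gauss.
have kS2' y : (\int[mu]_x (gauss (4 * c)^-1 (- x) y)%:E = S%:E)%E.
  by under eq_integral do rewrite gN; exact: ge0_integral_gauss.
have bF1 := young id _ measurable_fst kS2 mfR (fun x => normr_Re_le (f x)).
have bF1' := young -%R _ mN kS2' mfR (fun x => normr_Re_le (f x)).
have bF2 := young id _ measurable_fst kS2 mfI (fun x => normr_Im_le (f x)).
have bF2' := young -%R _ mN kS2' mfI (fun x => normr_Im_le (f x)).
set F1 := F (fun x => Re (f x)) in bF1 bF1'.
set F2 := F (fun x => Im (f x)) in bF2 bF2'.
have eq1 x : fcos h1 x - fsin h2 x = F1 x.
  have [_ /(congr1 (fun z : C => Re z))] := ffhat.2 c x c0; rewrite /cintegral /= => E.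
  transitivity (\int[mu]_y Re (f y * (fgauss c x y)%:C)).
    rewrite -E /fcos /fsin -RintegralB//; [|exact: integrable_cos|exact: integrable_sin].
    by apply: eq_Rintegral => xi _; rewrite ReM /h1 /h2 /wave /=; ring.
  by apply: eq_Rintegral => y _; rewrite ReM /= mulr0 subr0.
have eq2 x : fsin h1 x + fcos h2 x = F2 x.
  have [_ /(congr1 (fun z : C => Im z))] := ffhat.2 c x c0; rewrite /cintegral /= => E.
  transitivity (\int[mu]_y Im (f y * (fgauss c x y)%:C)).
    rewrite -E /fcos /fsin -RintegralD//; [|exact: integrable_sin|exact: integrable_cos].
    by apply: eq_Rintegral => xi _; rewrite ImM /h1 /h2 /wave /=; ring.
  by apply: eq_Rintegral => y _; rewrite ImM /= mulr0 add0r.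
have even h x : fcos h (- x) = fcos h x.
  by apply: eq_Rintegral => xi _; rewrite dotrNl cosN.
have odd h x : L1 h -> fsin h (- x) = - fsin h x.
  move=> hi; rewrite /fsin -[RHS]mulN1r -RintegralZl//; last exact: integrable_sin.
  by apply: eq_Rintegral => xi _; rewrite dotrNl sinN; ring.
have eq1' x : fcos h1 x + fsin h2 x = F1 (- x).
  by rewrite -eq1 even odd// opprK.
have eq2' x : - fsin h1 x + fcos h2 x = F2 (- x).
  by rewrite -eq2 even odd.
(* By the parallelogram law this integrand is the sum of the squared cosine and sine transforms of
   [h1] and [h2]; four bounds [D] with weight 1/2 make 2 D. *)
have total : integral_bound mu
    (fun x => 2^-1 * (F1 x ^+ 2 + F1 (- x) ^+ 2 + F2 x ^+ 2 + F2 (- x) ^+ 2)) (2 * D).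
  have -> : 2 * D = 2^-1 * (D + D + D + D) by field.
  apply: integral_boundZ; first by rewrite invr_ge0.
  exact: integral_boundD (integral_boundD (integral_boundD bF1 bF1') bF2) bF2'.
have fin h : L1 h -> (forall x, fcos h x ^+ 2 + fsin h x ^+ 2 <=
     2^-1 * (F1 x ^+ 2 + F1 (- x) ^+ 2 + F2 x ^+ 2 + F2 (- x) ^+ 2)) ->
   (\int[mu]_xi (h xi ^+ 2)%:E <= (4 * (2 * pi) ^+ n * N ^+ 2 * S `^ (1 - 2 / m))%:E)%E.
  move=> hi hb.
  have : (\int[mu]_x (fcos h x ^+ 2 + fsin h x ^+ 2)%:E <= (2 * D)%:E)%E.
    have b x : 0 <= fcos h x ^+ 2 + fsin h x ^+ 2 <=
        2^-1 * (F1 x ^+ 2 + F1 (- x) ^+ 2 + F2 x ^+ 2 + F2 (- x) ^+ 2).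
      by rewrite hb addr_ge0 ?sqr_ge0.
    by have [_ _] := integral_bound_le (measurable_fcos_fsin_sq hi) b total.
  move=> /(plancherel_ge hi).
  have -> : (2 * (2 * D) = (2 * pi) ^+ n * (4 * (2 * pi) ^+ n * N ^+ 2 * S `^ (1 - 2 / m))).
    rewrite /D -PS; have -> : S `^ (3 - 2 / m) = S `^ (1 - 2 / m) * S ^+ 2.
      rewrite -[S ^+ 2]powR_mulrn ?(ltW S0)// -powRD; last by rewrite (gt_eqF S0) implybT.
      by congr powR; ring.
    by ring.
  by rewrite EFinM lee_pmul2l// ?lte_fin.
split; apply: fin => // x.
  rewrite -eq1 -eq1' -eq2 -eq2'.
  have := sqr_ge0 (fsin h2 x); have := sqr_ge0 (fcos h2 x).
  move: (fcos h1 x) (fsin h1 x) (fcos h2 x) (fsin h2 x) => a b d e; nra.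
rewrite -eq1 -eq1' -eq2 -eq2'.
have := sqr_ge0 (fsin h1 x); have := sqr_ge0 (fcos h1 x).
move: (fcos h1 x) (fsin h1 x) (fcos h2 x) (fsin h2 x) => a b d e; nra.
Qed.

End gauss_pair_L2.

(** * Linear differential equations *)

Section linear_ode.
Variable R : realType.
Implicit Types (t k : R) (f df : R -> R).

Definition cont_half f := {within `[0, +oo[, continuous f}.

Lemma cont_half_cst k : cont_half (fun=> k).
Proof. by move=> x; exact: cst_continuous. Qed.

Lemma cont_half_continuous f : continuous f -> cont_half f.
Proof. exact: continuous_subspaceT. Qed.

Lemma cont_halfD f g : cont_half f -> cont_half g -> cont_half (fun t => f t + g t).
Proof. by move=> cf cg x; exact: (cvgD (cf x) (cg x)). Qed.

Lemma cont_halfM f g : cont_half f -> cont_half g -> cont_half (fun t => f t * g t).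
Proof. by move=> cf cg x; exact: (cvgM (cf x) (cg x)). Qed.

(** The mean value theorem needs the derivative only for t > 0 and continuity up to 0, exactly what
    [solves_cauchy] offers. *)
Lemma le_init f df : cont_half f ->
  (forall t, 0 < t -> is_derive t (1 : R) (f : R -> R^o) (df t)) ->
  forall T, 0 <= T -> (forall t, 0 < t -> t <= T -> df t <= 0) -> f T <= f 0.
Proof.
move=> cf dF T; rewrite le_eqVlt => /predU1P[<-//|T0] dT.
have [||c cT E] := @MVT R f df 0 T T0.
- by move=> x; rewrite in_itv /= => /andP[x0 _]; exact: dF.
- apply: continuous_subspaceW cf => x /=; rewrite !in_itv /= andbT.
  by move=> /andP[].
move: cT; rewrite in_itv /= => /andP[c0 cT].
rewrite -subr_le0 E mulr_le0_ge0 ?subr0 ?(ltW T0)//.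
exact: dT (ltW cT).
Qed.

Lemma is_derive_expRM k t : is_derive t (1 : R) (fun t : R => expR (k * t) : R^o) (k * expR (k * t)).
Proof.
have := @is_derive_phase R expR expR k 0 t (fun y => is_derive_expR y).
by under eq_fun do rewrite addr0; rewrite addr0.
Qed.

Lemma continuous_expRM k : continuous (fun t : R => expR (k * t)).
Proof.
by move=> t; exact: (cvg_comp _ expR (cvgM (cvg_cst k) (@cvg_id _ (nbhs t))) (@continuous_expR R _)).
Qed.

(** The function exp (k t) f(t) has nonpositive derivative. *)
Lemma gronwall f df k : cont_half f ->
  (forall t, 0 < t -> is_derive t (1 : R) (f : R -> R^o) (df t)) ->
  (forall t, 0 < t -> df t <= - k * f t) ->
  forall T, 0 <= T -> f T <= expR (- (k * T)) * f 0.
Proof.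
move=> cf dF H T T0.
have := @le_init (fun t => expR (k * t) * f t) (fun t => expR (k * t) * df t + f t * (k * expR (k * t))).
move=> /(_ _ _ T T0); rewrite mulr0 expR0 mul1r => G.
rewrite expRN mulrC ler_pdivlMr ?expR_gt0// mulrC; apply: G.
- apply: cont_halfM => //; apply: cont_half_continuous; exact: continuous_expRM.
- by move=> t t0; have := is_deriveM (is_derive_expRM k t) (dF t t0).
- move=> t t0 _.
  have -> : expR (k * t) * df t + f t * (k * expR (k * t)) = expR (k * t) * (df t + k * f t) by ring.
  by rewrite mulr_ge0_le0 ?expR_ge0//; have := H t t0; lra.
Qed.

Definition real_sol (M : 'M[R]_3) (x : 'I_3 -> R -> R) :=
  (forall i, cont_half (x i)) /\
  (forall t i, 0 < t -> is_derive t (1 : R) (x i : R -> R^o) (- \sum_j M i j * x j t)).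

Definition rmx3 (rows : seq (seq R)) : 'M[R]_3 :=
  \matrix_(i, j) nth 0 (nth [::] rows i) j.

Definition A0r : 'M[R]_3 := rmx3 [:: [:: 0; -1; -1]; [:: 1; 0; -1]; [:: 2^-1; 2^-1; 1]].
Definition A1r : 'M[R]_3 := rmx3 [:: [:: 2^-1; 2^-1; 0]; [:: 2^-1; 2^-1; 0]; [:: 0; 0; 0]].

Definition i0 : 'I_3 := ord0.
Definition i1 : 'I_3 := lift ord0 ord0.
Definition i2 : 'I_3 := lift ord0 (lift ord0 ord0).

Lemma sum3 (F : 'I_3 -> R) : \sum_j F j = F i0 + (F i1 + F i2).
Proof. by rewrite !big_ord_recl big_ord0 addr0. Qed.

Lemma all3 (P : 'I_3 -> Prop) : P i0 -> P i1 -> P i2 -> forall i, P i.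
Proof.
move=> p0 p1 p2 i; case: (unliftP ord0 i) => [j ->|->//].
case: (unliftP ord0 j) => [k ->|->//].
by rewrite (ord1 k).
Qed.

(* The solution P of P A0 + A0^T P = I, as a quadratic form. *)
Definition lyap (x0 x1 x2 : R) : R :=
  3 * x0 ^+ 2 + 2 * x1 ^+ 2 + 5 / 2 * x2 ^+ 2 + x0 * x1 / 2 + x0 * x2 + 3 * (x1 * x2).

Lemma lyap_ge (x0 x1 x2 : R) : (x0 ^+ 2 + x1 ^+ 2 + x2 ^+ 2) / 2 <= lyap x0 x1 x2.
Proof.
rewrite /lyap.
(* Gaussian elimination on P - I/2: squares are completed in x0, then in x1, with pivots 5/2, 59/40
   and a positive last one. *)
have -> : 3 * x0 ^+ 2 + 2 * x1 ^+ 2 + 5 / 2 * x2 ^+ 2 + x0 * x1 / 2 + x0 * x2 + 3 * (x1 * x2) =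
  (x0 ^+ 2 + x1 ^+ 2 + x2 ^+ 2) / 2 +
  (5 / 2 * (x0 + x1 / 10 + x2 / 5) ^+ 2 + (59 / 40) * (x1 + 58 / 59 * x2) ^+ 2 +
    (19 / 10 - 59 / 40 * (58 / 59) ^+ 2) * x2 ^+ 2) by field.
rewrite lerDl; apply: addr_ge0; first apply: addr_ge0.
- by rewrite mulr_ge0 ?sqr_ge0// divr_ge0.
- by rewrite mulr_ge0 ?sqr_ge0// divr_ge0.
- rewrite mulr_ge0 ?sqr_ge0//; lra.
Qed.

Lemma lyap_le (x0 x1 x2 : R) : lyap x0 x1 x2 <= 5 * (x0 ^+ 2 + x1 ^+ 2 + x2 ^+ 2).
Proof.
rewrite /lyap.
have := sqr_ge0 (x0 - x1); have := sqr_ge0 (x0 - x2); have := sqr_ge0 (x1 - x2).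
have := sqr_ge0 x0; have := sqr_ge0 x1; have := sqr_ge0 x2.
nra.
Qed.

(* z^T P A1 x *)
Definition pert (z0 z1 z2 x0 x1 : R) : R := (x0 + x1) * (13 / 8 * z0 + 9 / 8 * z1 + z2).

(** With u = rho (x0 + x1), 2 u q >= - 10 u^2 - q^2 / 10. Cauchy-Schwarz gives q^2 <= 5 |z|^2, as
    (13/8)^2 + (9/8)^2 + 1 < 5, and u^2 <= 2 rho^2 |x|^2. The constant 32 leaves room above the
    resulting 20. *)
Lemma pert_le (rho z0 z1 z2 x0 x1 x2 : R) :
  - ((z0 ^+ 2 + z1 ^+ 2 + z2 ^+ 2) / 2) - 32 * rho ^+ 2 * (x0 ^+ 2 + x1 ^+ 2 + x2 ^+ 2) <=
  2 * rho * pert z0 z1 z2 x0 x1.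
Proof.
rewrite /pert; set q := 13 / 8 * z0 + 9 / 8 * z1 + z2; set u := rho * (x0 + x1).
have hq : q ^+ 2 <= 5 * (z0 ^+ 2 + z1 ^+ 2 + z2 ^+ 2).
  rewrite /q; have := sqr_ge0 (9 / 8 * z0 - 13 / 8 * z1); have := sqr_ge0 (z0 - 13 / 8 * z2).
  have := sqr_ge0 (z1 - 9 / 8 * z2); have := sqr_ge0 z0; have := sqr_ge0 z1; have := sqr_ge0 z2.
  nra.
have hu : u ^+ 2 <= 2 * (rho ^+ 2 * (x0 ^+ 2 + x1 ^+ 2 + x2 ^+ 2)).
  rewrite /u exprMn [leRHS]mulrCA ler_wpM2l ?sqr_ge0//.
  have := sqr_ge0 (x0 - x1); have := sqr_ge0 x2; nra.
have h3 := sqr_ge0 (10 * u + q).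
have -> : 2 * rho * ((x0 + x1) * q) = 2 * u * q by rewrite /u; ring.
have r0 : 0 <= rho ^+ 2 * (x0 ^+ 2 + x1 ^+ 2 + x2 ^+ 2) by rewrite mulr_ge0 ?addr_ge0 ?sqr_ge0.
rewrite -[32 * _ * _]mulrA; set W := rho ^+ 2 * _ in hu r0 *; set Z := z0 ^+ 2 + _ + _ in hq *.
move: hq hu r0 h3; clearbody W Z q u => hq hu r0 h3; nra.
Qed.

(** Cauchy-Schwarz gives 2 pert >= - (2 + 5) |x|^2, and 7 / 16 < 1 / 2. The threshold 1/16, and with
    it the size of the low-frequency zone, originates here. *)
Lemma pert_self_le (rho x0 x1 x2 : R) : 0 <= rho <= 16^-1 ->
  - ((x0 ^+ 2 + x1 ^+ 2 + x2 ^+ 2) / 2) <= 2 * rho * pert x0 x1 x2 x0 x1.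
Proof.
move=> /andP[r0 r1].
have : - 7 * (x0 ^+ 2 + x1 ^+ 2 + x2 ^+ 2) <= 2 * pert x0 x1 x2 x0 x1.
  rewrite /pert; have := sqr_ge0 (x0 + x1 + (13 / 8 * x0 + 9 / 8 * x1 + x2)).
  have := sqr_ge0 (x0 - x1); have := sqr_ge0 (9 / 8 * x0 - 13 / 8 * x1); have := sqr_ge0 (x0 - 13 / 8 * x2).
  have := sqr_ge0 (x1 - 9 / 8 * x2); have := sqr_ge0 x0; have := sqr_ge0 x1; have := sqr_ge0 x2.
  nra.
have : 0 <= x0 ^+ 2 + x1 ^+ 2 + x2 ^+ 2 by rewrite !addr_ge0 ?sqr_ge0.
move: (x0 ^+ 2 + x1 ^+ 2 + x2 ^+ 2) (pert x0 x1 x2 x0 x1) => A B; nra.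
Qed.

End linear_ode.

Section real_sol.
Variable R : realType.
Implicit Types (t a b rho : R) (x y : 'I_3 -> R -> R).

Definition nsq (v : 'I_3 -> R) : R := v (i0) ^+ 2 + v (i1) ^+ 2 + v (i2) ^+ 2.

Lemma A0r_sum (v : 'I_3 -> R) : [/\ \sum_j (A0r R) i0 j * v j = - v i1 - v i2,
  \sum_j (A0r R) i1 j * v j = v i0 - v i2 &
  \sum_j (A0r R) i2 j * v j = v i0 / 2 + v i1 / 2 + v i2].
Proof. by split; rewrite sum3 !mxE /=; field. Qed.

Lemma A1r_sum (v : 'I_3 -> R) : [/\ \sum_j (A1r R) i0 j * v j = (v i0 + v i1) / 2,
  \sum_j (A1r R) i1 j * v j = (v i0 + v i1) / 2 &
  \sum_j (A1r R) i2 j * v j = 0].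
Proof. by split; rewrite sum3 !mxE /=; field. Qed.

Lemma Ar_sum a b (v : 'I_3 -> R) i :
  \sum_j (a *: A0r R + b *: A1r R) i j * v j =
  a * \sum_j (A0r R) i j * v j + b * \sum_j (A1r R) i j * v j.
Proof.
rewrite !big_distrr -big_split /=; apply: eq_bigr => j _.
by rewrite mxE [X in (X + _) * _]mxE [X in (_ + X) * _]mxE mulrDl !mulrA.
Qed.

Lemma cont_half_lyap (x0 x1 x2 : R -> R) : cont_half x0 -> cont_half x1 -> cont_half x2 ->
  cont_half (fun t => lyap (x0 t) (x1 t) (x2 t)).
Proof.
move=> c0 c1 c2.
have cM := @cont_halfM R; have cD := @cont_halfD R; have cC := @cont_half_cst R.
exact: (cD _ _ (cD _ _ (cD _ _ (cD _ _ (cD _ _ (cM _ _ (cC 3) (cM _ _ c0 c0))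
  (cM _ _ (cC 2) (cM _ _ c1 c1))) (cM _ _ (cC (5 / 2)) (cM _ _ c2 c2)))
  (cM _ _ (cM _ _ c0 c1) (cC 2^-1))) (cM _ _ c0 c2)) (cM _ _ (cC 3) (cM _ _ c1 c2))).
Qed.

Lemma is_derive_lyap (x0 x1 x2 : R -> R) t (d0 d1 d2 : R) :
  is_derive t (1:R) (x0 : R -> R^o) d0 -> is_derive t (1:R) (x1 : R -> R^o) d1 ->
  is_derive t (1:R) (x2 : R -> R^o) d2 ->
  is_derive t (1:R) (fun t => lyap (x0 t) (x1 t) (x2 t) : R^o)
   (6 * x0 t * d0 + 4 * x1 t * d1 + 5 * x2 t * d2 + (x0 t * d1 + x1 t * d0) / 2 +
    (x0 t * d2 + x2 t * d0) + 3 * (x1 t * d2 + x2 t * d1)).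
Proof.
move=> h0 h1 h2.
have dc k := is_derive_cst (k : R^o) t 1.
have -> : (fun t => lyap (x0 t) (x1 t) (x2 t) : R^o) =
  ((cst 3 * (x0 * x0) + cst 2 * (x1 * x1) + cst (5 / 2) * (x2 * x2) + cst 2^-1 * (x0 * x1) + x0 * x2 +
   cst 3 * (x1 * x2)) : R -> R^o).
  by apply/funext => s; rewrite /lyap !fctE; field.
have M1 (f g : R -> R^o) df dg := @is_deriveM _ _ f g t 1 df dg.
have D1 (f g : R -> R^o) df dg := @is_deriveD _ _ _ f g t 1 df dg.
apply: (is_derive_eq (D1 _ _ _ _ (D1 _ _ _ _ (D1 _ _ _ _ (D1 _ _ _ _ (D1 _ _ _ _
  (M1 _ _ _ _ (dc 3) (M1 _ _ _ _ h0 h0)) (M1 _ _ _ _ (dc 2) (M1 _ _ _ _ h1 h1)))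
  (M1 _ _ _ _ (dc (5 / 2)) (M1 _ _ _ _ h2 h2))) (M1 _ _ _ _ (dc 2^-1) (M1 _ _ _ _ h0 h1)))
  (M1 _ _ _ _ h0 h2)) (M1 _ _ _ _ (dc 3) (M1 _ _ _ _ h1 h2)))).
by rewrite /GRing.scale /=; field.
Qed.

(* Gronwall for lyap (x - y) + 128 rho^2 lyap x. *)
Lemma real_sol_diff a rho x y :
  0 <= a -> 0 <= rho <= 16^-1 ->
  real_sol (a *: A0r R + (a * rho) *: A1r R) x ->
  real_sol (a *: A0r R) y -> (forall i, x i 0 = y i 0) ->
  forall t, 0 <= t ->
  nsq (fun i => x i t - y i t) <= 1280 * rho ^+ 2 * expR (- (a / 20 * t)) * nsq (fun i => x i 0).
Proof.
move=> a0 rhob [cx dx] [cy dy] xy0 T T0.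
pose z i t := x i t - y i t.
have cz i : cont_half (z i).
  have -> : z i = (fun t => x i t + (-1) * y i t) by apply/funext => t; rewrite mulN1r.
  by apply: cont_halfD => //; apply: cont_halfM => //; exact: cont_half_cst.
(* The perturbation of z costs 32 rho^2 |x|^2 by [pert_le]; the weighted second term dissipates at
   least 64 rho^2 |x|^2. The remaining 32 is 1/20 of 128 times the 5 of [lyap_le], whence the rate a
   / 20. *)
pose L t := lyap (z i0 t) (z i1 t) (z i2 t) + 128 * rho ^+ 2 * lyap (x i0 t) (x i1 t) (x i2 t).
have cL : cont_half L.
  apply: cont_halfD; first exact: cont_half_lyap.
  by apply: cont_halfM; [exact: cont_half_cst|exact: cont_half_lyap].
pose Q t := a * (nsq (z ^~ t) + 2 * rho * pert (z i0 t) (z i1 t) (z i2 t) (x i0 t) (x i1 t) +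
   128 * rho ^+ 2 * (nsq (x ^~ t) + 2 * rho * pert (x i0 t) (x i1 t) (x i2 t) (x i0 t) (x i1 t))).
have dL t : 0 < t -> is_derive t (1 : R) (L : R -> R^o) (- Q t).
  move=> t0.
  have dz i : is_derive t (1 : R) (z i : R -> R^o)
     (- (a * \sum_j (A0r R) i j * z j t + a * rho * \sum_j (A1r R) i j * x j t)).
    have hy := dy t i t0; have hx := dx t i t0.
    have := is_deriveB hx hy; move=> D; apply: (is_derive_eq D).
    rewrite Ar_sum.
    have -> : \sum_j (a *: A0r R) i j * y j t = a * \sum_j (A0r R) i j * y j t.
      by rewrite big_distrr /=; apply: eq_bigr => j _; rewrite mxE mulrA.
    have -> : \sum_j (A0r R) i j * z j t =
       \sum_j (A0r R) i j * x j t - \sum_j (A0r R) i j * y j t.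
      by rewrite -sumrB; apply: eq_bigr => j _; rewrite /z mulrBr.
    by ring.
  have dx' i : is_derive t (1 : R) (x i : R -> R^o)
     (- (a * \sum_j (A0r R) i j * x j t + a * rho * \sum_j (A1r R) i j * x j t)).
    by have := dx t i t0; rewrite Ar_sum.
  have H1 := is_derive_lyap (dz i0) (dz i1) (dz i2).
  have H2 := is_derive_lyap (dx' i0) (dx' i1) (dx' i2).
  have H3 := is_deriveM (is_derive_cst (128 * rho ^+ 2 : R^o) t 1) H2.
  apply: (is_derive_eq (is_deriveD H1 H3)).
  have [-> -> ->] := A0r_sum (z ^~ t); have [-> -> ->] := A0r_sum (x ^~ t).
  have [-> -> ->] := A1r_sum (x ^~ t).
  by rewrite /GRing.scale /= /Q /nsq /pert; field.
have nsq0 (v : 'I_3 -> R) : 0 <= nsq v by rewrite /nsq !addr_ge0 ?sqr_ge0.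
have QL t : 0 < t -> - Q t <= - (a / 20) * L t.
  move=> t0; have -> : - (a / 20) * L t = - (a * (L t / 20)) by field.
  rewrite lerN2 /Q ler_wpM2l//.
  have h1 := pert_le rho (z i0 t) (z i1 t) (z i2 t) (x i0 t) (x i1 t) (x i2 t).
  have h2 := pert_self_le (x i0 t) (x i1 t) (x i2 t) rhob.
  have h3 := lyap_le (z i0 t) (z i1 t) (z i2 t).
  have h4 := lyap_le (x i0 t) (x i1 t) (x i2 t).
  have r2 := sqr_ge0 rho.
  rewrite /L -/(nsq (z ^~ t)) -/(nsq (x ^~ t)).
  rewrite -/(nsq (z ^~ t)) -/(nsq (x ^~ t)) in h1 h2 h3 h4.
  have n1 := nsq0 (z ^~ t); have n2 := nsq0 (x ^~ t).
  set Z := nsq (z ^~ t) in h1 h2 h3 h4 n1 n2 *; set X := nsq (x ^~ t) in h1 h2 h3 h4 n1 n2 *.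
  set p1 := 2 * rho * _ in h1 *; set p2 := 2 * rho * _ in h2 *.
  set l1 := lyap _ _ _ in h3 *; set l2 := lyap (x _ _) _ _ in h4 *.
  have k2 := ler_wpM2l r2 h2; have k4 := ler_wpM2l r2 h4.
  have k5 := mulr_ge0 r2 n2.
  move: h1 k2 h3 k4 k5 n1; rewrite -!mulrA.
  clearbody Z X p1 p2 l1 l2; move=> h1 k2 h3 k4 k5 n1; nra.
have G := gronwall cL dL QL T0.
have ez := lyap_ge (z i0 T) (z i1 T) (z i2 T).
have ex := lyap_ge (x i0 T) (x i1 T) (x i2 T).
have e0 := lyap_le (x i0 0) (x i1 0) (x i2 0).
have z0 i : z i 0 = 0 by rewrite /z xy0 subrr.
(* The difference z vanishes at 0, so [L 0] carries the factor rho^2, with 640 = 128 * 5; the 1/2 of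
   [lyap_ge] later turns 640 into 1280. *)
have L0 : L 0 <= 640 * rho ^+ 2 * nsq (x ^~ 0).
  rewrite /L !z0 {1}/lyap !(expr0n, mulr0, mul0r, addr0, add0r).
  have := ler_wpM2l (mulr_ge0 (ler0n R 128) (sqr_ge0 rho)) e0.
  move=> /le_trans; apply; rewrite le_eqVlt; apply/orP; left; apply/eqP; rewrite /nsq; ring.
have LT : nsq (z ^~ T) / 2 <= L T.
  have l0 : 0 <= lyap (x i0 T) (x i1 T) (x i2 T).
    by apply: le_trans ex; rewrite divr_ge0 ?addr_ge0 ?sqr_ge0.
  by rewrite (le_trans ez)// lerDl (mulr_ge0 _ l0)// mulr_ge0// sqr_ge0.
have := ler_wpM2l (expR_ge0 (- (a / 20 * T))) L0.
have -> : nsq (fun i => x i T - y i T) = nsq (z ^~ T) by [].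
move: G LT; set E := expR _; nra.
Qed.

End real_sol.

(** * Taylor expansion of the solutions *)

Section taylor.
Variable R : realType.

(** The coefficients of exp (- t M) c, that is (-M)^k c / k!, in a recursive form that is visibly
    polynomial in M and c. *)
Fixpoint taylor_coef (M : 'M[R]_3) (c : 'I_3 -> R) (k : nat) : 'I_3 -> R :=
  if k is k'.+1 then fun i => - (\sum_j M i j * taylor_coef M c k' j) / k'.+1%:R else c.

Definition taylor (M : 'M[R]_3) (c : 'I_3 -> R) (N : nat) (i : 'I_3) (t : R) : R :=
  \sum_(k < N) taylor_coef M c k i * t ^+ k.

Lemma is_derive_monomial (c : R) (k : nat) (t : R) :
  is_derive t (1 : R) (fun t : R => c * t ^+ k : R^o) (c * k%:R * t ^+ k.-1).
Proof.
have -> : (fun t : R => c * t ^+ k) = cst c * id ^+ k by apply/funext => s; rewrite -[RHS]/(c * (id ^+ k) s) exprfctE.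
apply: (is_derive_eq (is_deriveM (is_derive_cst (c : R^o) t 1) (is_deriveX k (is_derive_id t 1)))).
by rewrite /GRing.scale /= mulr_natl; ring.
Qed.

Lemma is_derive_taylor M c N i (t : R) :
  is_derive t (1 : R) (taylor M c N.+1 i : R -> R^o) (- \sum_j M i j * taylor M c N j t).
Proof.
have -> : (- \sum_j M i j * taylor M c N j t) =
   \sum_(k < N.+1) (taylor_coef M c k i * k%:R * t ^+ k.-1).
  rewrite [RHS]big_ord_recl /= mulr0 mul0r add0r.
  transitivity (- \sum_j \sum_(k < N) M i j * taylor_coef M c k j * t ^+ k).
    congr (- _); apply: eq_bigr => j _; rewrite /taylor big_distrr /=.
    by apply: eq_bigr => k _; rewrite mulrA.
  rewrite exchange_big /= -sumrN; apply: eq_bigr => k _.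
  by rewrite /bump /= add1n add0n /= divfK ?pnatr_eq0// -big_distrl /= mulNr.
rewrite /taylor; elim: (N.+1) => [|K IH].
  rewrite big_ord0; under eq_fun do rewrite big_ord0; exact: is_derive_cst.
rewrite big_ord_recr /=; under eq_fun do rewrite big_ord_recr /=.
exact: (is_deriveD IH (is_derive_monomial _ _ _)).
Qed.

Lemma continuous_taylor M c N i : continuous (taylor M c N i).
Proof.
move=> t; case: N => [|N].
  rewrite /taylor; under eq_fun do rewrite big_ord0; exact: cst_continuous.
apply: differentiable_continuous; apply/derivable1_diffP.
by have [] := is_derive_taylor M c N i t.
Qed.

Lemma taylor0 M c N i : taylor M c N.+1 i 0 = c i.
Proof.
rewrite /taylor big_ord_recl expr0 mulr1 big1 ?addr0// => k _.
by rewrite expr0n /= mulr0.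
Qed.

(** Induction on N: the derivative of the error of order N + 1 is -M applied to the error of order
    N. It is compared with the derivative of the next majorant, once for each sign [s] of the
    error. *)
Lemma real_sol_taylor_error (M : 'M[R]_3) (x : 'I_3 -> R -> R) (T B Lam : R) : real_sol M x -> 0 <= T ->
  (forall i t, 0 <= t <= T -> `|x i t| <= B) -> (forall i, \sum_j `|M i j| <= Lam) ->
  forall N i t, 0 <= t <= T ->
  `|x i t - taylor M (fun i => x i 0) N i t| <= B * (Lam * t) ^+ N / N`!%:R.
Proof.
move=> [cx dx] T0 xB ML.
have B0 : 0 <= B by apply: le_trans (xB i0 0 _); rewrite ?lexx.
have Lam0 : 0 <= Lam by apply: le_trans (ML i0); exact: sumr_ge0.
elim=> [|N IH] i t /andP[t0 tT].
  by rewrite /taylor big_ord0 subr0 expr0 mulr1 fact0 divr1 xB// t0.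
pose c := fun i => x i 0.
have key (s : R) : `|s| = 1 ->
    s * (x i t - taylor M c N.+1 i t) - B * (Lam * t) ^+ N.+1 / N.+1`!%:R <= 0.
  move=> s1.
  pose f u := s * (x i u - taylor M c N.+1 i u) - B * (Lam * u) ^+ N.+1 / N.+1`!%:R.
  pose df u := s * (- (\sum_j M i j * x j u) - - (\sum_j M i j * taylor M c N j u)) -
     (B * Lam ^+ N.+1 / N.+1`!%:R) * N.+1%:R * u ^+ N.
  have fE : f = fun u => s * x i u + ((- s) * taylor M c N.+1 i u +
      (- (B * Lam ^+ N.+1 / N.+1`!%:R)) * u ^+ N.+1).
    by apply/funext => u; rewrite /f exprMn; ring.
  have cf : cont_half f.
    rewrite fE; apply: cont_halfD; first by apply: cont_halfM => //; exact: cont_half_cst.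
    apply: cont_halfD; first by apply: cont_halfM; [exact: cont_half_cst|exact/cont_half_continuous/continuous_taylor].
    apply: cont_halfM; first exact: cont_half_cst.
    apply: cont_half_continuous => u; exact: exprn_continuous.
  have dF (u : R) : 0 < u -> is_derive u (1 : R) (f : R -> R^o) (df u).
    move=> u0; rewrite fE.
    have D1 := is_deriveM (is_derive_cst (s : R^o) u 1) (dx u i u0).
    have D2 := is_deriveM (is_derive_cst (- s : R^o) u 1) (is_derive_taylor M c N i u).
    have D3 := is_derive_monomial (- (B * Lam ^+ N.+1 / N.+1`!%:R)) N.+1 u.
    apply: (is_derive_eq (is_deriveD D1 (is_deriveD D2 D3))).
    by rewrite /GRing.scale /= /df; ring.
  have -> : 0 = f 0.
    by rewrite /f taylor0 /c subrr mulr0 mulr0 expr0n mulr0 mul0r subrr.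
  apply: (le_init cf dF t0) => u u0 ut.
  have uT : 0 <= u <= T by rewrite (ltW u0) (le_trans ut).
  rewrite /df subr_le0.
  have -> : - (\sum_j M i j * x j u) - - (\sum_j M i j * taylor M c N j u) =
     - \sum_j M i j * (x j u - taylor M c N j u).
    by rewrite opprK -[RHS]opprK opprK; under [in RHS]eq_bigr do rewrite mulrBr; rewrite sumrB; ring.
  apply: (le_trans (ler_norm _)); rewrite normrM s1 mul1r normrN.
  apply: (@le_trans _ _ (\sum_j `|M i j| * (B * (Lam * u) ^+ N / N`!%:R))).
    rewrite (le_trans (ler_norm_sum _ _ _))// ler_sum// => j _.
    by rewrite normrM ler_wpM2l//; exact: IH.
  rewrite -big_distrl /=.
  apply: (@le_trans _ _ (Lam * (B * (Lam * u) ^+ N / N`!%:R))).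
    by rewrite ler_wpM2r// divr_ge0// mulr_ge0// exprn_ge0// mulr_ge0// ltW.
  rewrite le_eqVlt; apply/orP; left; apply/eqP.
  rewrite factS natrM exprMn [Lam ^+ N.+1]exprS; field.
  by rewrite pnatr_eq0 -lt0n fact_gt0 addrC natr1 pnatr_eq0.
rewrite ler_norml; apply/andP; split.
  by have := key (-1) (normrN1 _); rewrite mulN1r; lra.
by have := key 1 (normr1 _); rewrite mul1r; lra.
Qed.

Lemma real_sol_taylor_cvg (M : 'M[R]_3) (x : 'I_3 -> R -> R) i (t : R) : real_sol M x -> 0 <= t ->
  taylor M (fun i => x i 0) N i t @[N --> \oo] --> x i t.
Proof.
move=> sx t0; have [cx _] := sx.
have bnd j : exists B : R, forall s, 0 <= s <= t -> `|x j s| <= B.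
  have cj : {within `[0, t], continuous (x j)}.
    apply: continuous_subspaceW (cx j) => s /=; rewrite !in_itv /= andbT.
    by move=> /andP[].
  have [c1 _ h1] := EVT_max t0 cj; have [c2 _ h2] := EVT_min t0 cj.
  exists (`|x j c1| + `|x j c2|) => s st.
  have s_in : s \in `[0, t] by rewrite in_itv.
  have := h1 s s_in; have := h2 s s_in.
  have := ler_norm (x j c1); have := ler_norm (- x j c2); rewrite normrN.
  have := normr_ge0 (x j c1); have := normr_ge0 (x j c2).
  by rewrite ler_norml => *; apply/andP; split; lra.
have [B0 h0] := bnd i0; have [B1 h1] := bnd i1; have [B2 h2] := bnd i2.
pose B := `|B0| + `|B1| + `|B2|.
have xB j s : 0 <= s <= t -> `|x j s| <= B.
  move=> st; have a0 := h0 s st; have a1 := h1 s st; have a2 := h2 s st.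
  have b0 := ler_norm B0; have b1 := ler_norm B1; have b2 := ler_norm B2.
  have e0 := normr_ge0 B0; have e1 := normr_ge0 B1; have e2 := normr_ge0 B2.
  by rewrite /B; apply: (@all3 (fun j => `|x j s| <= `|B0| + `|B1| + `|B2|)); lra.
pose Lam := \sum_k \sum_j `|M k j|.
have ML k : \sum_j `|M k j| <= Lam.
  rewrite /Lam [leRHS](bigD1 k)//= lerDl sumr_ge0// => l _; exact: sumr_ge0.
have err := real_sol_taylor_error sx t0 xB ML.
apply/cvgrPdist_le => e e0.
have : B * exp_coeff (Lam * t) N @[N --> \oo] --> (B * 0 : R).
  exact: (cvgM (cvg_cst _) (@cvg_exp_coeff R _)).
rewrite mulr0 => /cvgr0Pnorm_le /(_ e e0); apply: filterS => N hN.
rewrite (le_trans (err N i t _)) ?t0 ?lexx//.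
by rewrite (le_trans _ hN)// (le_trans _ (ler_norm _))// /exp_coeff /= mulrA.
Qed.

End taylor.

(** * Measurable dependence of solutions on a parameter *)

Section measurable_sol.
Context d (T : measurableType d) (R : realType).
Variables (M : T -> 'M[R]_3) (x : T -> 'I_3 -> R -> R).
Hypotheses (mM : forall i j, measurable_fun setT (fun u => M u i j))
  (mx : forall i, measurable_fun setT (fun u => x u i 0))
  (sx : forall u, real_sol (M u) (x u)).

Lemma measurable_taylor_coef k i :
  measurable_fun setT (fun u => taylor_coef (M u) (fun i => x u i 0) k i).
Proof.
elim: k i => [|k IH] i /=; first exact: mx.
apply: measurable_funM => //; apply: measurableT_comp => //.
under eq_fun do rewrite sum3.
by apply: measurable_funD; [|apply: measurable_funD]; exact: measurable_funM.
Qed.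

(** No joint regularity in u is given; each solution is the pointwise limit of its Taylor
    polynomials, and these are measurable in u. *)
Lemma measurable_real_sol i (t : R) : 0 <= t -> measurable_fun setT (fun u => x u i t).
Proof.
move=> t0.
apply: (@measurable_fun_cvg _ _ _ _ (fun N u => taylor (M u) (fun i => x u i 0) N i t)).
  move=> N; rewrite /taylor; elim: N => [|N IH].
    by under eq_fun do rewrite big_ord0; exact: measurable_cst.
  under eq_fun do rewrite big_ord_recr /=.
  by apply: measurable_funD => //; apply: measurable_funM => //; exact: measurable_taylor_coef.
by move=> u _; exact: real_sol_taylor_cvg.
Qed.

End measurable_sol.

(** * From the complex Cauchy problems to real systems *)

Section cauchy_parts.
Variable R : realType.
Notation C := R[i].

Lemma Re_sum (F : 'I_3 -> C) : Re (\sum_j F j) = \sum_j Re (F j).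
Proof. exact: (big_morph (@complex.Re R) (@ReD R) erefl). Qed.

Lemma Im_sum (F : 'I_3 -> C) : Im (\sum_j F j) = \sum_j Im (F j).
Proof. exact: (big_morph (@complex.Im R) (@ImD R) erefl). Qed.

Lemma is_derive_sum3 (F : 'I_3 -> R -> R) (dF : 'I_3 -> R) (t : R) :
  (forall i, is_derive t (1 : R) (F i : R -> R^o) (dF i)) ->
  is_derive t (1 : R) (fun t => \sum_i F i t : R^o) (\sum_i dF i).
Proof.
move=> dF'; under eq_fun do rewrite sum3; rewrite sum3.
exact: (is_deriveD (dF' _) (is_deriveD (dF' _) (dF' _))).
Qed.

Lemma cont_half_sum3 (F : 'I_3 -> R -> R) :
  (forall i, cont_half (F i)) -> cont_half (fun t => \sum_i F i t).
Proof.
move=> cF; have -> : (fun t => \sum_i F i t) = (fun t => F (i0) t + (F (i1) t + F (i2) t)).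
  by apply/funext => t; rewrite sum3.
by apply: cont_halfD => //; exact: cont_halfD.
Qed.

Lemma is_derive_lin2 (a b : R) (f g : R -> R) (df dg t : R) :
  is_derive t (1 : R) (f : R -> R^o) df -> is_derive t (1 : R) (g : R -> R^o) dg ->
  is_derive t (1 : R) (fun t => a * f t + b * g t : R^o) (a * df + b * dg).
Proof.
move=> hf hg.
have D1 := is_deriveM (is_derive_cst (a : R^o) t 1) hf.
have D2 := is_deriveM (is_derive_cst (b : R^o) t 1) hg.
apply: (is_derive_eq (is_deriveD D1 D2)).
by rewrite /GRing.scale /=; ring.
Qed.

Lemma cont_half_lin2 (a b : R) (f g : R -> R) : cont_half f -> cont_half g ->
  cont_half (fun t => a * f t + b * g t).
Proof.
by move=> cf cg; apply: cont_halfD; apply: cont_halfM => //; exact: cont_half_cst.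
Qed.

(** Used with T = T_0 to turn the diagonal reference system into the unperturbed one with matrix
    |xi|^2 A_0. The derivative is recomputed on real and imaginary parts because [solves_cauchy] is
    stated on them. *)
Lemma solves_cauchy_conj (M M' T : 'M[C]_3) (v0 : 'cV[C]_3) (v : R -> 'cV[C]_3) :
  T *m M = M' *m T -> solves_cauchy M v0 v ->
  solves_cauchy M' (T *m v0) (fun t => T *m v t).
Proof.
move=> TM [vv0 cv dv].
have ReE j : (fun t => Re ((T *m v t) j ord0)) =
    (fun t => \sum_k (Re (T j k) * Re (v t k ord0) + (- Im (T j k)) * Im (v t k ord0))).
  by apply/funext => t; rewrite mxE Re_sum; apply: eq_bigr => k _; rewrite ReM mulNr.
have ImE j : (fun t => Im ((T *m v t) j ord0)) =
    (fun t => \sum_k (Re (T j k) * Im (v t k ord0) + Im (T j k) * Re (v t k ord0))).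
  by apply/funext => t; rewrite mxE Im_sum; apply: eq_bigr => k _; rewrite ImM.
split; first by rewrite vv0.
  move=> j; rewrite ReE ImE; split; apply: cont_half_sum3 => k; apply: cont_half_lin2.
  - exact: (cv k).1.
  - exact: (cv k).2.
  - exact: (cv k).2.
  - exact: (cv k).1.
move=> t t0 j.
have E : (M' *m (T *m v t)) j ord0 = \sum_k T j k * (M *m v t) k ord0.
  by rewrite mulmxA -TM -mulmxA mxE.
rewrite ReE ImE; split.
  have D := @is_derive_sum3 _ _ t (fun k => is_derive_lin2 (Re (T j k)) (- Im (T j k)) (dv t t0 k).1 (dv t t0 k).2).
  apply: (is_derive_eq D); rewrite E Re_sum -sumrN; apply: eq_bigr => k _.
  by rewrite ReM; ring.
have D := @is_derive_sum3 _ _ t (fun k => is_derive_lin2 (Re (T j k)) (Im (T j k)) (dv t t0 k).2 (dv t t0 k).1).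
apply: (is_derive_eq D); rewrite E Im_sum -sumrN; apply: eq_bigr => k _.
by rewrite ImM; ring.
Qed.

Lemma solves_cauchy_parts (M : 'M[C]_3) (Mr : 'M[R]_3) (v0 : 'cV[C]_3) (v : R -> 'cV[C]_3) :
  (forall j k, M j k = (Mr j k)%:C) -> solves_cauchy M v0 v ->
  real_sol Mr (fun j t => Re (v t j ord0)) /\ real_sol Mr (fun j t => Im (v t j ord0)).
Proof.
move=> MMr [_ cv dv]; split; split.
- by move=> j; exact: (cv j).1.
- move=> t j t0; apply: (is_derive_eq (dv t t0 j).1); rewrite mxE Re_sum; congr (- _).
  by apply: eq_bigr => k _; rewrite MMr ReZ.
- by move=> j; exact: (cv j).2.
- move=> t j t0; apply: (is_derive_eq (dv t t0 j).2); rewrite mxE Im_sum; congr (- _).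
  by apply: eq_bigr => k _; rewrite MMr ImZ.
Qed.

Lemma complex_half : (2^-1 : C) = (2^-1 : R)%:C.
Proof. by rewrite fmorphV rmorph_nat. Qed.

Lemma A0_real j k : A0 R j k = (A0r R j k)%:C.
Proof.
by rewrite /A0 complex_half; move: j k; apply: all3; apply: all3;
  rewrite mxE [X in _ * X = _]mxE [X in _ = X%:C]mxE /=; apply: complex_eqP; rewrite ?ReZ ?ImZ /=; field.
Qed.

Lemma A1_real j k : A1 R j k = (A1r R j k)%:C.
Proof.
by rewrite /A1 complex_half; move: j k; apply: all3; apply: all3;
  rewrite mxE [X in _ * X = _]mxE [X in _ = X%:C]mxE /=; apply: complex_eqP; rewrite ?ReZ ?ImZ /=; field.
Qed.

Lemma diagonalizes_mul (T0 : 'M[C]_3) (k : C) : diagonalizes T0 ->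
  T0 *m (k *: diagY R) = (k *: A0 R) *m T0.
Proof.
move=> [uT <-]; rewrite -scalemxAr -scalemxAl; congr (_ *: _).
by rewrite !mulmxA mulmxV// mul1mx.
Qed.

End cauchy_parts.

(** * The estimate at a fixed frequency *)

Section pointwise.
Variables (R : realType) (n : nat) (sigma : R).
Hypothesis sigma1 : 1 < sigma.
Notation Rn := 'rV[R]_n.
Notation C := R[i].
Variables (T0 : 'M[C]_3) (w0 : Rn -> 'cV[C]_3) (w wt : R -> Rn -> 'cV[C]_3).
Hypotheses (hT0 : diagonalizes T0) (hw : solves_S sigma w0 w) (hwt : solves_R T0 w0 wt).

(** Size of the perturbation relative to the main term |xi|^2; it is small at low frequencies
    because sigma > 1. *)
Definition rho_ (xi : Rn) : R := enorm xi `^ (2 * (sigma - 1)).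

Lemma enorm_powR_rho (xi : Rn) : enorm xi `^ (2 * sigma) = enorm xi ^+ 2 * rho_ xi.
Proof.
have e0 : 0 <= enorm xi by exact: sqrtr_ge0.
(* The frequency 0 is included: splitting a power of 0 requires a nonzero total exponent. *)
have s0 : 2 * sigma != 0 by rewrite gt_eqF// mulr_gt0// (lt_trans ltr01).
rewrite /rho_ -powR_mulrn// -powRD; first by congr powR; ring.
by rewrite (_ : 2 + 2 * (sigma - 1) = 2 * sigma) ?(negbTE s0)//; ring.
Qed.

Definition diff_sol (t : R) (xi : Rn) : 'cV[C]_3 := w t xi - T0 *m wt t xi.

Lemma sol_S_parts (xi : Rn) :
  real_sol (enorm xi ^+ 2 *: A0r R + (enorm xi ^+ 2 * rho_ xi) *: A1r R) (fun j t => Re (w t xi j ord0)) /\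
  real_sol (enorm xi ^+ 2 *: A0r R + (enorm xi ^+ 2 * rho_ xi) *: A1r R) (fun j t => Im (w t xi j ord0)).
Proof.
have E (K : comNzRingType) (a b : K) (A B : 'M[K]_3) j k :
    (a *: A + b *: B) j k = a * A j k + b * B j k.
  by rewrite mxE [X in X + _]mxE [X in _ + X]mxE.
apply: (solves_cauchy_parts _ (hw xi)) => j k.
by rewrite !E A0_real A1_real -enorm_powR_rho rmorphD !rmorphM.
Qed.

Lemma sol_R_parts (xi : Rn) :
  real_sol (enorm xi ^+ 2 *: A0r R) (fun j t => Re ((T0 *m wt t xi) j ord0)) /\
  real_sol (enorm xi ^+ 2 *: A0r R) (fun j t => Im ((T0 *m wt t xi) j ord0)).
Proof.
have E (K : comNzRingType) (a : K) (A : 'M[K]_3) j k : (a *: A) j k = a * A j k by rewrite mxE.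
apply: (solves_cauchy_parts _ (solves_cauchy_conj (diagonalizes_mul _ hT0) (hwt xi))) => j k.
rewrite E A0_real (E _ _ (A0r R)); exact: (esym (rmorphM _ _ _)).
Qed.

Lemma sol_init (xi : Rn) : w 0 xi = w0 xi /\ T0 *m wt 0 xi = w0 xi.
Proof.
have [-> _ _] := hw xi; have [-> _ _] := hwt xi; split=> //.
by case: hT0 => uT _; rewrite mulmxA mulmxV// mul1mx.
Qed.

Definition csq (v : 'cV[C]_3) : R :=
  nsq (fun j => Re (v j ord0)) + nsq (fun j => Im (v j ord0)).

Lemma diff_sol_le (t : R) (xi : Rn) : 0 <= t -> rho_ xi <= 16^-1 ->
  csq (diff_sol t xi) <= 1280 * rho_ xi ^+ 2 * expR (- (enorm xi ^+ 2 / 20 * t)) * csq (w0 xi).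
Proof.
move=> t0 r16; have r0 : 0 <= rho_ xi <= 16^-1 by rewrite powR_ge0 r16.
have a0 : 0 <= enorm xi ^+ 2 := sqr_ge0 _.
have [sR sI] := sol_S_parts xi; have [tR tI] := sol_R_parts xi.
have [iw iwt] := sol_init xi.
have q1 i : Re (w 0 xi i ord0) = Re ((T0 *m wt 0 xi) i ord0) by rewrite iw iwt.
have q2 i : Im (w 0 xi i ord0) = Im ((T0 *m wt 0 xi) i ord0) by rewrite iw iwt.
have H1 := real_sol_diff a0 r0 sR tR q1 t0; have H2 := real_sol_diff a0 r0 sI tI q2 t0.
have dE j : diff_sol t xi j ord0 = w t xi j ord0 - (T0 *m wt t xi) j ord0.
  by rewrite /diff_sol mxE [X in _ + X]mxE.
rewrite /csq mulrDr; apply: lerD.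
  by move: H1; rewrite iw; apply: le_trans; rewrite /nsq !dE !ReB.
by move: H2; rewrite iw; apply: le_trans; rewrite /nsq !dE !ImB.
Qed.

Hypotheses (mw0R : forall j, measurable_fun setT (fun xi => Re (w0 xi j ord0)))
  (mw0I : forall j, measurable_fun setT (fun xi => Im (w0 xi j ord0))).

Lemma measurable_enorm : measurable_fun setT (@enorm R n).
Proof.
apply: measurableT_comp; last exact: measurable_dotr.
by apply: continuous_measurable_fun; exact: sqrt_continuous.
Qed.

Lemma measurable_rho : measurable_fun setT rho_.
Proof. exact: measurableT_comp (measurable_powR _) measurable_enorm. Qed.

Lemma measurable_diff_sol (t : R) j : 0 <= t ->
  measurable_fun setT (fun xi => Re (diff_sol t xi j ord0)) /\
  measurable_fun setT (fun xi => Im (diff_sol t xi j ord0)).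
Proof.
move=> t0.
have me2 : measurable_fun setT (fun xi : Rn => enorm xi ^+ 2) by exact: measurable_funX measurable_enorm.
have mMS k l : measurable_fun setT (fun xi => (enorm xi ^+ 2 *: A0r R + (enorm xi ^+ 2 * rho_ xi) *: A1r R) k l).
  have -> : (fun xi => (enorm xi ^+ 2 *: A0r R + (enorm xi ^+ 2 * rho_ xi) *: A1r R) k l) =
     (fun xi => enorm xi ^+ 2 * A0r R k l + (enorm xi ^+ 2 * rho_ xi) * A1r R k l).
    by apply/funext => xi; rewrite mxE [X in X + _]mxE [X in _ + X]mxE.
  apply: measurable_funD; apply: measurable_funM => //; apply: measurable_funM => //.
  exact: measurable_rho.
have mMR k l : measurable_fun setT (fun xi : Rn => (enorm xi ^+ 2 *: A0r R) k l).
  have -> : (fun xi : Rn => (enorm xi ^+ 2 *: A0r R) k l) = (fun xi : Rn => enorm xi ^+ 2 * A0r R k l).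
    by apply/funext => xi; rewrite mxE.
  exact: measurable_funM.
have ew : w 0 = w0 by apply/funext => xi; have [] := sol_init xi.
pose wt0 xi := T0 *m wt 0 xi.
have ewt : wt0 = w0 by apply/funext => xi; have [] := sol_init xi.
have iw k : measurable_fun setT (fun xi => Re (w 0 xi k ord0)) /\
    measurable_fun setT (fun xi => Im (w 0 xi k ord0)) by rewrite ew.
have iwt k : measurable_fun setT (fun xi => Re (wt0 xi k ord0)) /\
    measurable_fun setT (fun xi => Im (wt0 xi k ord0)) by rewrite ewt.
have m1 := measurable_real_sol mMS (fun k => (iw k).1) (fun xi => (sol_S_parts xi).1) j t0.
have m2 := measurable_real_sol mMS (fun k => (iw k).2) (fun xi => (sol_S_parts xi).2) j t0.
have m3 := measurable_real_sol mMR (fun k => (iwt k).1) (fun xi => (sol_R_parts xi).1) j t0.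
have m4 := measurable_real_sol mMR (fun k => (iwt k).2) (fun xi => (sol_R_parts xi).2) j t0.
have E xi : diff_sol t xi j ord0 = w t xi j ord0 - (T0 *m wt t xi) j ord0.
  by rewrite /diff_sol mxE [X in _ + X]mxE.
split.
  by under eq_fun do rewrite E ReB; exact: measurable_funB m1 m3.
by under eq_fun do rewrite E ImB; exact: measurable_funB m2 m4.
Qed.

End pointwise.

(** * Low frequencies *)

Section continuous_measurable.
Variables (R : realType) (n : nat).
Notation Rn := 'rV[R]_n.

Definition grid (k : nat) (x : Rn) : 'rV[int]_n := \row_i Num.floor (k.+1%:R * x ord0 i).
Definition ungrid (k : nat) (z : 'rV[int]_n) : Rn := \row_i ((z ord0 i)%:~R / k.+1%:R).

Lemma measurable_grid_eq k (z : 'rV[int]_n) : measurable [set x : Rn | grid k x = z].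
Proof.
have H (r : seq 'I_n) : measurable [set x : Rn | forall i, i \in r -> Num.floor (k.+1%:R * x ord0 i) = z ord0 i].
  elim: r => [|i r IH].
    by rewrite (_ : [set _ | _] = setT)//; apply/seteqP; split.
  rewrite (_ : [set _ | _] =
    ((fun x : Rn => k.+1%:R * x ord0 i) @^-1` `[(z ord0 i)%:~R, (z ord0 i + 1)%:~R[) `&`
    [set x : Rn | forall i, i \in r -> Num.floor (k.+1%:R * x ord0 i) = z ord0 i]).
    apply: measurableI => //.
    have mf : measurable_fun setT (fun x : Rn => k.+1%:R * x ord0 i).
      by apply: measurable_funM => //; exact: measurable_coord.
    rewrite -[X in measurable X]setTI.
    by apply: mf => //; exact: measurable_itv.
  apply/seteqP; split=> x /=.
    move=> h; split; last by move=> j jr; apply: h; rewrite in_cons jr orbT.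
    have <- := h i (mem_head _ _).
    by rewrite in_itv /= floor_le_tmp /= floorD1_gt.
  rewrite in_itv /= => -[/andP[h1 h2] h] j; rewrite in_cons => /orP[/eqP->|]; last exact: h.
  by apply: floor_def; rewrite h1 h2.
have := H (enum 'I_n); congr measurable; apply/seteqP; split=> x /=.
  by move=> h; apply/rowP => i; rewrite mxE h// mem_enum.
by move=> <- i _; rewrite mxE.
Qed.

(** Measurable sets are generated by coordinates, continuity refers to the norm topology. Rounding
    to the grid of mesh 1 / (k + 1) bridges the two: the rounded function factors through a
    countable set, enumerated by [unpickle], with boxes as fibres, and it converges to f by
    continuity. *)
Lemma continuous_measurable_rV (f : Rn -> R) : continuous f -> measurable_fun setT f.
Proof.
move=> cf.
apply: (@measurable_fun_cvg _ _ _ _ (fun k x => f (ungrid k (grid k x)))).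
  move=> k _ Y mY; rewrite setTI.
  have -> : (fun x => f (ungrid k (grid k x))) @^-1` Y = \bigcup_(m : nat)
     [set x | exists2 z, unpickle m = Some z & grid k x = z /\ Y (f (ungrid k z))].
    apply/seteqP; split=> x /=.
      by move=> h; exists (pickle (grid k x)) => //=; exists (grid k x); rewrite ?pickleK.
    by move=> [m _ /= [z _ [<-]]].
  apply: bigcupT_measurable => m.
  case E : (unpickle m) => [z|]; last first.
    by rewrite (_ : [set _ | _] = set0)//; apply/seteqP; split=> x //= -[].
  have [Yz|nYz] := pselect (Y (f (ungrid k z))).
    rewrite (_ : [set _ | _] = [set x : Rn | grid k x = z]); first exact: measurable_grid_eq.
    apply/seteqP; split=> x /=; first by move=> [z' [<-] []].
    by move=> xz; exists z.
  by rewrite (_ : [set _ | _] = set0)//; apply/seteqP; split=> x //= -[z' [<-] []].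
move=> x _; apply: (@cvg_comp _ _ _ (fun k => ungrid k (grid k x)) f _ (nbhs x)); last exact: cf.
move=> P /nbhs_ballP [e /= e0 eP].
exists (Num.trunc e^-1).+1 => // k /= hk; apply: eP; split=> // i j.
rewrite /ball /= (ord1 i) /ungrid /grid !mxE.
have k0 : 0 < k.+1%:R :> R by [].
rewrite -(ltr_pM2l k0) -[X in X * `|_|]gtr0_norm// -normrM mulrBr [_ * (_ / _)]mulrC divfK ?gt_eqF//.
set y := k.+1%:R * x ord0 j.
have h1 : (Num.floor y)%:~R <= y by exact: floor_le_tmp.
have h2 : y < (Num.floor y + 1)%:~R by exact: floorD1_gt.
rewrite ger0_norm ?subr_ge0//; apply: (@lt_le_trans _ _ 1).
  by move: h2; rewrite intrD; lra.
rewrite -ler_pdivrMr// div1r (le_trans (ltW (truncnS_gt _)))// ler_nat.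
exact: leq_trans hk (leqnSn k).
Qed.

End continuous_measurable.

(** * L^2 norms of inverse Fourier transforms *)

Section inv_fourier_L2.
Variables (R : realType) (n : nat).
Notation Rn := 'rV[R]_n.
Notation mu := (@lebesgue_rV R n).
Notation C := R[i].

Lemma cmod_sqr (z : C) : cmod z ^+ 2 = Re z ^+ 2 + Im z ^+ 2.
Proof. by rewrite /cmod sqr_sqrtr// addr_ge0 ?sqr_ge0. Qed.

Lemma inv_fourier_parts (g : Rn -> C) (x : Rn) :
  L1 (fun xi => Re (g xi)) -> L1 (fun xi => Im (g xi)) ->
  let r := fun xi => Re (g xi) in let i := fun xi => Im (g xi) in
  Re (inv_fourier g x) = (2 * pi) ^- n * (fcos r x - fsin i x) /\
  Im (inv_fourier g x) = (2 * pi) ^- n * (fsin r x + fcos i x).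
Proof.
move=> gr gi r i; rewrite /inv_fourier ReZ ImZ /cintegral; split; congr (_ * _).
  rewrite [LHS]/= /fcos /fsin -RintegralB//; [|exact: integrable_cos|exact: integrable_sin].
  by apply: eq_Rintegral => xi _; rewrite ReM /expi /= /r /i; ring.
rewrite [LHS]/= /fcos /fsin -RintegralD//; [|exact: integrable_sin|exact: integrable_cos].
by apply: eq_Rintegral => xi _; rewrite ImM /expi /= /r /i; ring.
Qed.

Lemma measurable_inv_fourier_sq (g : Rn -> C) :
  L1 (fun xi => Re (g xi)) -> L1 (fun xi => Im (g xi)) ->
  measurable_fun setT (fun x => cmod (inv_fourier g x) ^+ 2).
Proof.
move=> gr gi.
have -> : (fun x => cmod (inv_fourier g x) ^+ 2) =
  (fun x => ((2 * pi) ^- n * (fcos (fun xi => Re (g xi)) x - fsin (fun xi => Im (g xi)) x)) ^+ 2 +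
     ((2 * pi) ^- n * (fsin (fun xi => Re (g xi)) x + fcos (fun xi => Im (g xi)) x)) ^+ 2).
  by apply/funext => x; rewrite cmod_sqr; have [-> ->] := inv_fourier_parts x gr gi.
exact: (measurable_funD
  (measurable_funX 2 (measurable_funM (measurable_cst _) (measurable_funB (measurable_fcos gr) (measurable_fsin gi))))
  (measurable_funX 2 (measurable_funM (measurable_cst _) (measurable_funD (measurable_fsin gr) (measurable_fcos gi))))).
Qed.

Lemma inv_fourier_L2 (g : Rn -> C) (B : R) :
  L1 (fun xi => Re (g xi)) -> L1 (fun xi => Im (g xi)) ->
  (\int[mu]_xi (Re (g xi) ^+ 2)%:E <= B%:E)%E ->
  (\int[mu]_xi (Im (g xi) ^+ 2)%:E <= B%:E)%E ->
  integral_bound mu (fun x => cmod (inv_fourier g x) ^+ 2) (4 * (2 * pi) ^- n * B).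
Proof.
move=> gr gi br bi.
have P0 := pi2n_gt0 R n.
have bound (h : Rn -> R) : L1 h -> (\int[mu]_xi (h xi ^+ 2)%:E <= B%:E)%E ->
    integral_bound mu (fun x => fcos h x ^+ 2 + fsin h x ^+ 2) ((2 * pi) ^+ n * B).
  move=> hi hB; split; [exact: measurable_fcos_fsin_sq|by move=> x; rewrite addr_ge0 ?sqr_ge0|].
  by apply: (le_trans (plancherel_le hi)); rewrite EFinM; apply: lee_wpmul2l => //; rewrite lee_fin ltW.
(* The inverse transform mixes the transforms of both parts, and (a - d)^2 + (b + c)^2 <= 2 (a^2 +
   b^2 + c^2 + d^2); the rest is the squared prefactor. *)
pose k : R := 2 * (2 * pi) ^- n ^+ 2.
have k0 : 0 <= k by rewrite mulr_ge0// sqr_ge0.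
have -> : 4 * (2 * pi) ^- n * B = k * ((2 * pi) ^+ n * B + (2 * pi) ^+ n * B).
  by rewrite /k; move: ((2 * pi) ^+ n) P0 => p p0; field; rewrite gt_eqF.
apply: (integral_bound_le (measurable_inv_fourier_sq gr gi) _
  (integral_boundZ k0 (integral_boundD (bound _ gr br) (bound _ gi bi)))) => x.
rewrite sqr_ge0 andTb cmod_sqr; have [-> ->] := inv_fourier_parts x gr gi; rewrite /k.
set r := fun xi => Re (g xi); set i := fun xi => Im (g xi).
move: (fcos r x) (fsin r x) (fcos i x) (fsin i x) ((2 * pi) ^- n) => a b c d p.
have := sqr_ge0 (p * (a + d)); have := sqr_ge0 (p * (b - c)).
rewrite !exprMn; nra.
Qed.

End inv_fourier_L2.

Section norm3.
Variables (R : realType) (n : nat).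
Notation Rn := 'rV[R]_n.
Notation mu := (@lebesgue_rV R n).

(** The 12 is the number 3 of components times the 4 of [inv_fourier_L2]. *)
Lemma Hdot_norm_le (s B : R) (g : Rn -> 'cV[R[i]]_3) : 0 <= B ->
  (forall j, let G := fun xi => ((enorm xi `^ s)%:C : R[i]) * g xi j ord0 in
     [/\ L1 (fun xi => Re (G xi)), L1 (fun xi => Im (G xi)),
      (\int[mu]_xi (Re (G xi) ^+ 2)%:E <= B%:E)%E &
      (\int[mu]_xi (Im (G xi) ^+ 2)%:E <= B%:E)%E]) ->
  (Hdot_norm_inv_fourier s g <= (Num.sqrt (12 * (2 * pi) ^- n * B))%:E)%E.
Proof.
move=> B0 H; pose G j := fun xi => ((enorm xi `^ s)%:C : R[i]) * g xi j ord0.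
have P0 := pi2n_gt0 R n.
have cE x : cvnorm (inv_fourier_vec (fun xi => ((enorm xi `^ s)%:C : R[i]) *: g xi) x) =
    Num.sqrt (\sum_j cmod (inv_fourier (G j) x) ^+ 2).
  rewrite /cvnorm; congr Num.sqrt; apply: eq_bigr => j _; rewrite mxE.
  by congr (cmod (inv_fourier _ x) ^+ 2); apply/funext => xi; rewrite mxE.
have b0 j : integral_bound mu (fun x => cmod (inv_fourier (G j) x) ^+ 2) (4 * (2 * pi) ^- n * B).
  by have [h1 h2 h3 h4] := H j; exact: inv_fourier_L2.
have [_ S0 SB] := integral_bound_sum (index_enum 'I_3) b0.
rewrite /Hdot_norm_inv_fourier unlock /Lnorm.
have -> : (\int[mu]_x (`|(cvnorm (inv_fourier_vec (fun xi => ((enorm xi `^ s)%:C : R[i]) *: g xi) x))%:E| `^ 2) =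
   \int[mu]_x (\sum_j cmod (inv_fourier (G j) x) ^+ 2)%:E)%E.
  apply: eq_integral => x _; rewrite cE abse_EFin ger0_norm ?sqrtr_ge0// poweR_EFin.
  by rewrite powR_mulrn ?sqrtr_ge0// sqr_sqrtr.
have I0 : (0 <= \int[mu]_x (\sum_j cmod (inv_fourier (G j) x) ^+ 2)%:E)%E.
  by apply: integral_ge0 => x _; rewrite lee_fin.
have IB : (\int[mu]_x (\sum_j cmod (inv_fourier (G j) x) ^+ 2)%:E <= (12 * (2 * pi) ^- n * B)%:E)%E.
  apply: (le_trans SB); rewrite lee_fin sumr_const card_ord -mulr_natl.
  by rewrite le_eqVlt; apply/orP; left; apply/eqP; ring.
move: I0 IB; set I := integral _ _ _ => I0 IB.
clearbody I.
case: I I0 IB => [v| |] //=; rewrite ?lee_fin ?leye_eq// => v0 vB.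
rewrite powR12_sqrt//.
exact: ler_wsqrtr.
Qed.

End norm3.

(** Here 1/40 is half of the exponent 1/20 that the squared difference of solutions enjoys; the
    other half must survive as a Gaussian. *)
Lemma powR_le_expR (R : realType) (b : R) : 0 <= b ->
  exists2 K : R, 0 <= K & forall v, 0 <= v -> v `^ b <= K * expR (v / 40).
Proof.
move=> b0; have c0 : 0 < 40^-1 :> R by rewrite invr_gt0.
have [K K0 HK] := expn_le_expR (Num.trunc b).+1 c0.
exists K => // v v0; rewrite (mulrC v); apply: le_trans (HK v v0).
have v1 : 1 <= 1 + v by rewrite lerDl.
rewrite -powR_mulrn ?(le_trans ler01)//.
apply: (@le_trans _ _ ((1 + v) `^ b)).
  by apply: ge0_ler_powR => //; rewrite ?nnegrE ?lerDr// (le_trans ler01).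
by apply: ler_powR => //; exact: ltW (truncnS_gt _).
Qed.

(** * Trading powers of the frequency for powers of time *)

Section low_frequency.
Variables (R : realType) (n : nat).
Notation Rn := 'rV[R]_n.
Notation mu := (@lebesgue_rV R n).
Notation C := R[i].

Lemma enorm_sqr (xi : Rn) : enorm xi ^+ 2 = dotr xi xi.
Proof. by rewrite /enorm sqr_sqrtr//; apply: sumr_ge0 => i _; rewrite -expr2 sqr_ge0. Qed.

Lemma powR_sqr (x a : R) : 0 <= x -> (x `^ a) ^+ 2 = (x ^+ 2) `^ a.
Proof. by move=> x0; rewrite !expr2 powRM. Qed.

(** With u = |xi|^2 <= 1, replacing t by 1 + t in the exponential costs at most exp (1/20). One
    factor exp (- u (1 + t) / 40) absorbs (u (1 + t))^b, which leaves (1 + t)^(-b); the other one is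
    the squared Gaussian. *)
Lemma symbol_le (sigma s K t : R) (xi : Rn) : 1 < sigma -> 0 <= s ->
  (forall v, 0 <= v -> v `^ (s + 2 * (sigma - 1)) <= K * expR (v / 40)) ->
  0 <= t -> enorm xi <= 1 ->
  (enorm xi `^ s) ^+ 2 * rho_ sigma xi ^+ 2 * expR (- (enorm xi ^+ 2 / 20 * t)) <=
  expR 20^-1 * K * (1 + t) `^ (- (s + 2 * (sigma - 1))) * gauss ((1 + t) / 80) 0 xi ^+ 2.
Proof.
move=> s1 s0 HK t0 x1.
have e0 : 0 <= enorm xi := sqrtr_ge0 _.
rewrite /rho_ !powR_sqr ?powR_ge0//.
set u := enorm xi ^+ 2; set b := s + 2 * (sigma - 1).
have u0 : 0 <= u := sqr_ge0 _.
have u1 : u <= 1 by rewrite /u expr_le1.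
have b0 : 0 < b by rewrite /b ltr_wpDl// mulr_gt0// subr_gt0.
have tau0 : 0 < 1 + t by rewrite ltr_wpDr.
have -> : u `^ s * u `^ (2 * (sigma - 1)) = u `^ b.
  by rewrite -powRD// gt_eqF.
have -> : u `^ b = (u * (1 + t)) `^ b * (1 + t) `^ (- b).
  rewrite powRM// ?(ltW tau0)// -mulrA -powRD ?(gt_eqF tau0) ?implybT//.
  by rewrite subrr powRr0 mulr1.
have -> : gauss ((1 + t) / 80) 0 xi ^+ 2 = expR (- (u * (1 + t) / 40)).
  rewrite /gauss subr0 -enorm_sqr -/u expr2 -expRD; congr expR; by field.
have := HK _ (mulr_ge0 u0 (ltW tau0)).
have -> : expR (- (u / 20 * t)) = expR (u / 20) * expR (- (u * (1 + t) / 40)) * expR (- (u * (1 + t) / 40)).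
  by rewrite -!expRD; congr expR; field.
have eK : expR (u * (1 + t) / 40) * expR (- (u * (1 + t) / 40)) = 1 by rewrite -expRD subrr expR0.
have eu : expR (u / 20) <= expR 20^-1 by rewrite ler_expR -[leRHS]mul1r ler_wpM2r// invr_ge0.
move: (powR_ge0 (1 + t) (- b)) (powR_ge0 (u * (1 + t)) b) (expR_gt0 (u * (1 + t) / 40)) (expR_gt0 (- (u * (1 + t) / 40))) (expR_gt0 (u / 20)) eK eu.
move: (expR (u * (1 + t) / 40)) (expR (- (u * (1 + t) / 40))) ((1 + t) `^ (- b)) ((u * (1 + t)) `^ b) (expR (u / 20)) (expR 20^-1).
move=> E F P Q X Y P0 Q0 E0 F0 X0 EF XY QK.
have KF : Q * F <= K by apply: (le_trans (ler_wpM2r (ltW F0) QK)); rewrite -mulrA EF mulr1.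
have -> : Q * P * (X * F * F) = (X * (Q * F)) * (P * F) by ring.
have -> : Y * K * P * F = (Y * K) * (P * F) by ring.
by apply: ler_wpM2r; [rewrite mulr_ge0// ltW|apply: ler_pM => //; [exact: ltW|rewrite mulr_ge0// ltW]].
Qed.

(** Square integrable with bounded support implies integrable: |r| <= 1 + r^2, and on the unit ball
    1 is dominated by e times a Gaussian, whose integral is already known. *)
Lemma integrable_of_sq (r : Rn -> R) (B : R) : measurable_fun setT r ->
  (forall xi, 1 < enorm xi -> r xi = 0) ->
  integral_bound mu (fun xi => r xi ^+ 2) B -> L1 r.
Proof.
move=> mr r0 /integral_bound_integrable ir.
have ig : L1 (fun xi : Rn => expR 1 * gauss 1 0 xi) by apply: integrable_funZ; exact: integrable_gauss.
apply: (dominated_integrable_fun mr _ (integrable_funD ig ir)) => xi.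
have e0 : 0 <= enorm xi := sqrtr_ge0 _.
have [x1|x1] := ltP 1 (enorm xi).
  by rewrite r0// normr0 expr0n addr0 mulr_ge0 ?expR_ge0 ?gauss_ge0.
have : 1 <= expR 1 * gauss 1 0 xi.
  rewrite /gauss -expRD -[leLHS]expR0 ler_expR subr0 -enorm_sqr mul1r subr_ge0.
  by rewrite expr_le1.
rewrite -(real_normK (num_real (r xi))).
by have := normr_ge0 (r xi); nra.
Qed.

End low_frequency.

Section low_frequency_bound.
Variables (R : realType) (n : nat).
Notation Rn := 'rV[R]_n.
Notation mu := (@lebesgue_rV R n).
Notation C := R[i].

Lemma initial_dataE (fh : 'I_3 -> Rn -> C) (xi : Rn) :
  let v := initial_data (fh i0) (fh i1) (fh i2) xi in
  [/\ v i0 ord0 = fh i1 xi + fh i0 xi, v i1 ord0 = fh i1 xi - fh i0 xi & v i2 ord0 = fh i2 xi].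
Proof. by split; rewrite mxE. Qed.

Lemma csq_initial_le (fh : 'I_3 -> Rn -> C) (xi : Rn) :
  csq (initial_data (fh i0) (fh i1) (fh i2) xi) <=
  2 * \sum_j (Re (fh j xi) ^+ 2 + Im (fh j xi) ^+ 2).
Proof.
have [e0 e1 e2] := initial_dataE fh xi.
rewrite sum3 /csq /nsq e0 e1 e2 ReD ImD ReB ImB.
have := sqr_ge0 (Re (fh i2 xi)); have := sqr_ge0 (Im (fh i2 xi)).
move: (Re (fh i0 xi)) (Re (fh i1 xi)) (Re (fh i2 xi)) (Im (fh i0 xi)) (Im (fh i1 xi)) (Im (fh i2 xi)).
by move=> a b c d e f; lra.
Qed.

Lemma measurable_initial_data (c : C -> R) (fh : 'I_3 -> Rn -> C) (j : 'I_3) :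
  (forall x y, c (x + y) = c x + c y) -> (forall x y, c (x - y) = c x - c y) ->
  (forall k, measurable_fun setT (fun xi => c (fh k xi))) ->
  measurable_fun setT (fun xi => c (initial_data (fh i0) (fh i1) (fh i2) xi j ord0)).
Proof.
move=> cD cB mfh; move: j; apply: all3.
- under eq_fun => xi do (have [-> _ _] := initial_dataE fh xi; rewrite cD).
  exact: measurable_funD.
- under eq_fun => xi do (have [_ -> _] := initial_dataE fh xi; rewrite cB).
  exact: measurable_funB.
- by under eq_fun => xi do (have [_ _ ->] := initial_dataE fh xi); exact: mfh.
Qed.

Lemma smooth_measurable (chi : Rn -> R) : smooth chi -> measurable_fun setT chi.
Proof. by move=> /(_ [::])[cchi _]; exact: continuous_measurable_rV. Qed.

Lemma exists_low_frequency (sigma : R) : 1 < sigma ->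
  exists2 eps0 : R, 0 < eps0 & forall xi : Rn, enorm xi <= eps0 ->
    enorm xi <= 1 /\ rho_ sigma xi <= 16^-1.
Proof.
move=> s1; have a0 : 0 < 2 * (sigma - 1) by rewrite mulr_gt0// subr_gt0.
(* The radius at which [rho_] equals 1/16; the minimum with 1 is taken for [symbol_le]. *)
pose e : R := 16^-1 `^ (2 * (sigma - 1))^-1.
have e0 : 0 < e by rewrite powR_gt0// invr_gt0.
exists (Num.min 1 e); first by rewrite lt_min ltr01.
move=> xi; rewrite le_min => /andP[x1 xe]; split=> //.
have -> : 16^-1 = e `^ (2 * (sigma - 1)) by rewrite /e -powRrM mulVf ?gt_eqF// powRr1// invr_ge0.
by apply: ge0_ler_powR; rewrite ?nnegrE ?sqrtr_ge0 ?(ltW a0) ?(ltW e0).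
Qed.

Variables (sigma eps s K : R) (chi : Rn -> R) (T0 : 'M[C]_3) (fh : 'I_3 -> Rn -> C)
  (w wt : R -> Rn -> 'cV[C]_3).
Let w0 := initial_data (fh i0) (fh i1) (fh i2).
Let b := s + 2 * (sigma - 1).
Hypotheses (s1 : 1 < sigma) (s0 : 0 <= s) (K0 : 0 <= K)
  (HK : forall v, 0 <= v -> v `^ b <= K * expR (v / 40))
  (heps : forall xi : Rn, enorm xi <= eps -> enorm xi <= 1 /\ rho_ sigma xi <= 16^-1)
  (hchi : cutoff eps chi) (hT0 : diagonalizes T0)
  (hw : solves_S sigma w0 w) (hwt : solves_R T0 w0 wt).

(** The factor 2560 is the 1280 of [diff_sol_le] times the 2 of [csq_initial_le]. *)
Let D (t : R) : R := 2560 * expR 20^-1 * K * (1 + t) `^ (- b).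

Let D_ge0 t : 0 <= D t.
Proof. exact: mulr_ge0 (mulr_ge0 (mulr_ge0 (ler0n _ _) (expR_ge0 _)) K0) (powR_ge0 _ _). Qed.

(** The number [d] stands for the real or imaginary part of a component of the difference. Beyond
    [eps] the cutoff vanishes; below, the bounds on the symbol, the difference and the data
    multiply. *)
Lemma cutoff_diff_sq_le (t d : R) (xi : Rn) : 0 <= t -> d ^+ 2 <= csq (diff_sol T0 w wt t xi) ->
  (enorm xi `^ s * (chi xi * d)) ^+ 2 <=
  D t * \sum_j ((gauss ((1 + t) / 80) 0 xi * Re (fh j xi)) ^+ 2 +
                (gauss ((1 + t) / 80) 0 xi * Im (fh j xi)) ^+ 2).
Proof.
move=> t0 hd; set g := gauss _ 0 xi.
have [_ chi01 chi0 _] := hchi.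
have S0 : 0 <= \sum_j (Re (fh j xi) ^+ 2 + Im (fh j xi) ^+ 2).
  by apply: sumr_ge0 => j _; rewrite addr_ge0 ?sqr_ge0.
have -> : \sum_j ((g * Re (fh j xi)) ^+ 2 + (g * Im (fh j xi)) ^+ 2) =
    g ^+ 2 * \sum_j (Re (fh j xi) ^+ 2 + Im (fh j xi) ^+ 2).
  by rewrite mulr_sumr; apply: eq_bigr => j _; rewrite !exprMn mulrDr.
have [xe|xe] := ltP eps (enorm xi).
  by rewrite chi0// mul0r mulr0 expr0n; exact: mulr_ge0 (D_ge0 t) (mulr_ge0 (sqr_ge0 g) S0).
have [x1 x16] := heps xe.
have hs := symbol_le s1 s0 HK t0 x1.
have hds := diff_sol_le s1 hT0 hw hwt t0 x16.
have hw0 := csq_initial_le fh xi.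
have /andP[c0 c1] := chi01 xi.
rewrite -/w0 in hw0; rewrite -/b -/g in hs.
set E := expR _ in hs hds.
have E0 : 0 <= E := expR_ge0 _.
have -> : D t * (g ^+ 2 * \sum_j (Re (fh j xi) ^+ 2 + Im (fh j xi) ^+ 2)) =
   (1280 * (expR 20^-1 * K * (1 + t) `^ (- b) * g ^+ 2)) *
   (2 * \sum_j (Re (fh j xi) ^+ 2 + Im (fh j xi) ^+ 2)).
  by rewrite /D; ring.
apply: (@le_trans _ _ ((1280 * ((enorm xi `^ s) ^+ 2 * rho_ sigma xi ^+ 2 * E)) * csq (w0 xi))); last first.
  apply: ler_pM.
  - exact: mulr_ge0 (ler0n _ _) (mulr_ge0 (mulr_ge0 (sqr_ge0 _) (sqr_ge0 _)) E0).
  - by rewrite /csq /nsq !addr_ge0 ?sqr_ge0.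
  - exact: ler_wpM2l (ler0n _ _) _ _ hs.
  - exact: hw0.
rewrite !exprMn.
have -> : 1280 * ((enorm xi `^ s) ^+ 2 * rho_ sigma xi ^+ 2 * E) * csq (w0 xi) =
  (enorm xi `^ s) ^+ 2 * (1280 * rho_ sigma xi ^+ 2 * E * csq (w0 xi)) by ring.
apply: ler_wpM2l; first exact: sqr_ge0.
apply: le_trans hds; apply: le_trans hd.
by rewrite -[leRHS]mul1r ler_wpM2r ?sqr_ge0// expr_le1.
Qed.

(** [gauss_fhat_L2] is used with c = (1 + t) / 80, so the kernel has mass (pi (1 + t) / 20)^(n/2),
    the source of the decay due to L^m data. The 8 adds the 4 of the real part to that of the
    imaginary part. *)
Lemma Hdot_low_frequency_le (f : 'I_3 -> Rn -> C) (m t : R) : 1 <= m <= 2 ->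
  (forall j, gauss_pair (f j) (fh j)) -> (forall j, in_Lp m (f j)) -> 0 <= t ->
  (Hdot_norm_inv_fourier s (fun xi => ((chi xi)%:C : C) *: diff_sol T0 w wt t xi) <=
   (Num.sqrt (12 * (2 * pi) ^- n * (D t * \sum_j
     (8 * (2 * pi) ^+ n * (fine (Lpnorm m (f j))) ^+ 2 *
       (Num.sqrt (pi * (1 + t) / 20) ^+ n) `^ (1 - 2 / m)))))%:E)%E.
Proof.
move=> m12 gp fLm t0.
have P0 := pi2n_gt0 R n.
have tau0 : 0 < 1 + t by rewrite ltr_wpDr.
have c0 : 0 < (1 + t) / 80 by rewrite divr_gt0.
have cE : pi * (1 + t) / 20 = pi / (4 * ((1 + t) / 80))^-1 by field; rewrite gt_eqF.
have [_ chi01 chi0 _] := hchi.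
have mchi : measurable_fun setT chi by apply: smooth_measurable; case: hchi.
have mes : measurable_fun setT (fun xi : Rn => enorm xi `^ s).
  exact: (measurableT_comp (measurable_powR s) (@measurable_enorm R n)).
have mfh j : measurable_fun setT (fun xi => Re (fh j xi)) /\ measurable_fun setT (fun xi => Im (fh j xi)) := (gp j).1.
have mw0R j : measurable_fun setT (fun xi => Re (w0 xi j ord0)).
  exact: (measurable_initial_data j (@ReD R) (@ReB R) (fun k => (mfh k).1)).
have mw0I j : measurable_fun setT (fun xi => Im (w0 xi j ord0)).
  exact: (measurable_initial_data j (@ImD R) (@ImB R) (fun k => (mfh k).2)).
pose beta j := 4 * (2 * pi) ^+ n * (fine (Lpnorm m (f j))) ^+ 2 *
       (Num.sqrt (pi * (1 + t) / 20) ^+ n) `^ (1 - 2 / m).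
have -> : \sum_j (8 * (2 * pi) ^+ n * (fine (Lpnorm m (f j))) ^+ 2 *
       (Num.sqrt (pi * (1 + t) / 20) ^+ n) `^ (1 - 2 / m)) = \sum_j (beta j + beta j).
  by apply: eq_bigr => j _; rewrite /beta; ring.
have mg : measurable_fun setT (gauss ((1 + t) / 80) (0 : Rn)) := measurable_gauss _ _.
have mug j : measurable_fun setT (fun xi => gauss ((1 + t) / 80) 0 xi * Re (fh j xi)).
  exact: measurable_funM mg (mfh j).1.
have mvg j : measurable_fun setT (fun xi => gauss ((1 + t) / 80) 0 xi * Im (fh j xi)).
  exact: measurable_funM mg (mfh j).2.
have key (d : Rn -> R) : measurable_fun setT d ->
    (forall xi, d xi ^+ 2 <= csq (diff_sol T0 w wt t xi)) ->
    L1 (fun xi => enorm xi `^ s * (chi xi * d xi)) /\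
    (\int[mu]_xi ((enorm xi `^ s * (chi xi * d xi)) ^+ 2)%:E <= (D t * \sum_j (beta j + beta j))%:E)%E.
  move=> md hd.
  have mr : measurable_fun setT (fun xi => enorm xi `^ s * (chi xi * d xi)).
    exact: measurable_funM mes (measurable_funM mchi md).
  have B : integral_bound mu (fun xi => (enorm xi `^ s * (chi xi * d xi)) ^+ 2) (D t * \sum_j (beta j + beta j)).
    apply: (integral_bound_le (measurable_funX 2 mr) _
      (integral_boundZ (D_ge0 t) (integral_bound_sum _ (fun j =>
        integral_boundD (integral_bound_sq (mug j) _) (integral_bound_sq (mvg j) _))))).
    - by move=> xi; rewrite sqr_ge0; exact: cutoff_diff_sq_le.
    - by move=> j; have [] := gauss_fhat_L2 (gp j) m12 (fLm j) c0; rewrite /beta cE.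
    - by move=> j; have [] := gauss_fhat_L2 (gp j) m12 (fLm j) c0; rewrite /beta cE.
  split; last by case: B.
  apply: (integrable_of_sq mr _ B) => xi x1.
  have [xe|xe] := ltP eps (enorm xi); first by rewrite chi0// mul0r mulr0.
  by have [] := heps xe; rewrite leNgt x1.
have b0 j : 0 <= beta j.
  exact: mulr_ge0 (mulr_ge0 (mulr_ge0 (ler0n _ 4) (ltW P0)) (sqr_ge0 _)) (powR_ge0 _ _).
apply: Hdot_norm_le.
  apply: (mulr_ge0 (D_ge0 t)); apply: sumr_ge0 => j _; exact: addr_ge0 (b0 j) (b0 j).
move=> j G.
have [mR mI] := measurable_diff_sol s1 hT0 hw hwt mw0R mw0I j t0.
have RE : (fun xi => Re (G xi)) = (fun xi => enorm xi `^ s * (chi xi * Re (diff_sol T0 w wt t xi j ord0))).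
  by apply/funext => xi; rewrite /G mxE !ReZ.
have IE : (fun xi => Im (G xi)) = (fun xi => enorm xi `^ s * (chi xi * Im (diff_sol T0 w wt t xi j ord0))).
  by apply/funext => xi; rewrite /G mxE !ImZ.
have le3 (h : 'I_3 -> R) (k : 'I_3) : h k ^+ 2 <= nsq h.
  move: k; apply: all3; rewrite /nsq;
  by have := sqr_ge0 (h i0); have := sqr_ge0 (h i1); have := sqr_ge0 (h i2); lra.
have n0 (h : 'I_3 -> R) : 0 <= nsq h by exact: le_trans (sqr_ge0 _) (le3 h i0).
have [r1 r2] : L1 (fun xi => Re (G xi)) /\
    (\int[mu]_xi (Re (G xi) ^+ 2)%:E <= (D t * \sum_j (beta j + beta j))%:E)%E.
  have [h1 h2] := key _ mR (fun xi => le_trans (le3 (fun k => Re (diff_sol T0 w wt t xi k ord0)) j)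
     (ler_wpDr (n0 (fun k => Im (diff_sol T0 w wt t xi k ord0))) (lexx _))).
  split; first by rewrite RE.
  by under eq_integral do rewrite (congr1 (fun u => u _) RE).
have [i1' i2'] : L1 (fun xi => Im (G xi)) /\
    (\int[mu]_xi (Im (G xi) ^+ 2)%:E <= (D t * \sum_j (beta j + beta j))%:E)%E.
  have [h1 h2] := key _ mI (fun xi => le_trans (le3 (fun k => Im (diff_sol T0 w wt t xi k ord0)) j)
     (ler_wpDl (n0 (fun k => Re (diff_sol T0 w wt t xi k ord0))) (lexx _))).
  split; first by rewrite IE.
  by under eq_integral do rewrite (congr1 (fun u => u _) IE).
by split.
Qed.

End low_frequency_bound.

(** * Bookkeeping of the decay exponent *)

Section decay_rate.
Variables (R : realType) (n : nat) (sigma s m t : R).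
Hypotheses (m12 : 1 <= m <= 2) (t0 : 0 <= t).

Lemma sqrt_expn_powR (c tau e : R) : 0 < c -> 0 < tau ->
  (Num.sqrt (c * tau) ^+ n) `^ e = (Num.sqrt c ^+ n) `^ e * tau `^ (n%:R / 2 * e).
Proof.
move=> c0 tau0; rewrite sqrtrM ?ltW// exprMn powRM ?exprn_ge0 ?sqrtr_ge0//; congr (_ * _).
by rewrite -powR12_sqrt ?ltW// -powR_mulrn ?powR_ge0// -!powRrM; congr powR; ring.
Qed.

(** The two exponents of 1 + t add up to twice the announced rate, and a sum of squares of
    nonnegative numbers is at most the square of their sum. *)
Lemma sqrt_rate_le (L Q : R) (N : 'I_3 -> R) : 0 <= Q -> (forall j, 0 <= N j) ->
  L = Q * (1 + t) `^ (- (s + 2 * (sigma - 1))) * (1 + t) `^ (n%:R / 2 * (1 - 2 / m)) * \sum_j N j ^+ 2 ->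
  Num.sqrt L <= Num.sqrt Q *
    (1 + t) `^ (- (((2 - m) * n%:R + 2 * m * s) / (4 * m)) - (sigma - 1)) * (N i0 + N i1 + N i2).
Proof.
move=> Q0 N0 ->.
have m0 : 0 < m by have /andP[m1 _] := m12; exact: lt_le_trans ltr01 m1.
have tau0 : 0 < 1 + t by rewrite ltr_wpDr.
set a := - _ - _.
have -> : Q * (1 + t) `^ (- (s + 2 * (sigma - 1))) * (1 + t) `^ (n%:R / 2 * (1 - 2 / m)) =
    Q * ((1 + t) `^ a) ^+ 2.
  rewrite -mulrA -powRD ?(gt_eqF tau0) ?implybT//; congr (_ * _).
  rewrite -powR_mulrn ?powR_ge0// -powRrM; congr powR; rewrite /a; field.
  by rewrite gt_eqF.
have p0 : 0 <= (1 + t) `^ a := powR_ge0 _ _.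
have S0 : 0 <= N i0 + N i1 + N i2 by rewrite !addr_ge0.
have Qa0 : 0 <= Num.sqrt Q * (1 + t) `^ a by rewrite mulr_ge0 ?sqrtr_ge0.
rewrite -[leRHS](ger0_norm (mulr_ge0 Qa0 S0)) -sqrtr_sqr; apply: ler_wsqrtr.
rewrite [leRHS]exprMn exprMn sqr_sqrtr//; apply: ler_wpM2l; first by rewrite mulr_ge0 ?sqr_ge0.
rewrite sum3; move: (N0 i0) (N0 i1) (N0 i2) => h0 h1 h2.
have := mulr_ge0 h0 h1; have := mulr_ge0 h0 h2; have := mulr_ge0 h1 h2; nra.
Qed.

End decay_rate.

Local Close Scope classical_set_scope.
Unset Implicit Arguments.
Unset Strict Implicit.

Theorem theorem5p3 (R : realType) (n : nat) (hn : (1 <= n)%N)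
    (sigma : R) (hsigma : 1 < sigma <= 2) :
  exists eps0 : R, 0 < eps0 /\
  forall (eps : R) (heps : 0 < eps <= eps0)
    (chi : 'rV[R]_n -> R) (hchi : cutoff eps chi)
    (T0 : 'M[R[i]]_3) (hT0 : diagonalizes T0)
    (s : R) (hs : 0 <= s) (m : R) (hm : 1 <= m <= 2),
  exists C : R, 0 < C /\
  forall (u0 : test_functional R n) (D2u0 u1 theta0 : 'rV[R]_n -> R[i])
    (q p th : 'rV[R]_n -> R[i]) (w wt : R -> 'rV[R]_n -> 'cV[R[i]]_3),
    tempered u0 ->
    represents D2u0 (absD2 u0) ->
    in_Lp m D2u0 -> in_Lp m u1 -> in_Lp m theta0 ->
    represents q (dist_mul (@sq_symbol R n) (dist_fourier u0)) ->
    is_fourier u1 p ->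
    is_fourier theta0 th ->
    solves_S sigma (initial_data q p th) w ->
    solves_R T0 (initial_data q p th) wt ->
  forall t : R, 0 <= t ->
    (Hdot_norm_inv_fourier s
       (fun xi => ((chi xi)%:C : R[i]) *: (w t xi - T0 *m wt t xi))
     <= (C * (1 + t) `^ (- (((2 - m) * n%:R + 2 * m * s) / (4 * m))
                         - (sigma - 1)))%:E
        * (Lpnorm m D2u0 + Lpnorm m u1 + Lpnorm m theta0))%E.
Proof.
have /andP[s1 _] := hsigma.
have [eps0 e0 low] := exists_low_frequency n s1.
exists eps0; split=> // eps /andP[_ epsle] chi hchi T0 hT0 s hs m hm.
have b0 : 0 <= s + 2 * (sigma - 1) by rewrite addr_ge0// mulr_ge0// subr_ge0 ltW.
have [K K0 HK] := powR_le_expR b0.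
have P0 := pi2n_gt0 R n.
(* All factors of the low-frequency bound that do not depend on t or on the data; the powers of 2 pi
   cancel. *)
pose Q : R := 12 * 8 * (2560 * expR 20^-1 * K) * (Num.sqrt (pi / 20) ^+ n) `^ (1 - 2 / m).
have Q0 : 0 <= Q.
  exact: mulr_ge0 (mulr_ge0 (mulr_ge0 (ler0n _ _) (ler0n _ _))
    (mulr_ge0 (mulr_ge0 (ler0n _ _) (expR_ge0 _)) K0)) (powR_ge0 _ _).
(* Only [0 <= Q] is known, so 1 is added to make the constant positive. *)
exists (Num.sqrt Q + 1); split; first by rewrite ltr_wpDl ?sqrtr_ge0.
move=> u0 D2u0 u1 theta0 q p th w wt _ hD L1 L2 L3 hq hp hth hw hwt t t0.
pose f (j : 'I_3) := nth D2u0 [:: D2u0; u1; theta0] j.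
pose fh (j : 'I_3) := nth q [:: q; p; th] j.
have gp j : gauss_pair (f j) (fh j).
  move: j; apply: all3; [exact: absD2_gauss_pair hD hq|exact: is_fourier_gauss_pair|exact: is_fourier_gauss_pair].
have fL j : in_Lp m (f j) by move: j; apply: all3.
pose N j := fine (Lpnorm m (f j)).
have NE j : (N j)%:E = Lpnorm m (f j).
  by have [_ fin] := fL j; rewrite fineK// ge0_fin_numE// Lnorm_ge0.
have N0 j : 0 <= N j by rewrite fine_ge0// Lnorm_ge0.
have small (xi : 'rV[R]_n) : enorm xi <= eps -> enorm xi <= 1 /\ rho_ sigma xi <= 16^-1.
  by move=> xe; apply: low; exact: le_trans xe epsle.
have tau0 : 0 < 1 + t by rewrite ltr_wpDr.
apply: (le_trans (@Hdot_low_frequency_le R n sigma eps s K chi T0 fh w wt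
  s1 hs K0 HK small hchi hT0 hw hwt f m t hm gp fL t0)).
rewrite -[Lpnorm m D2u0](NE i0) -[Lpnorm m u1](NE i1) -[Lpnorm m theta0](NE i2).
rewrite -!EFinD -EFinM lee_fin.
have Npos : 0 <= N i0 + N i1 + N i2 by rewrite !addr_ge0.
apply: (le_trans (@sqrt_rate_le R n sigma s m t hm t0 _ Q N Q0 N0 _)); last first.
  by apply: ler_wpM2r => //; apply: ler_wpM2r; [exact: powR_ge0|rewrite lerDl].
have -> : pi * (1 + t) / 20 = pi / 20 * (1 + t) :> R by ring.
have c0 : 0 < pi / 20 :> R by rewrite divr_gt0// pi_gt0.
rewrite sqrt_expn_powR//.
set S := (_ `^ (1 - 2 / m)); set X := (1 + t) `^ _; set Y := (1 + t) `^ _.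
have -> : \sum_j (8 * (2 * pi) ^+ n * (fine (Lpnorm m (f j))) ^+ 2 * (S * Y)) =
    8 * (2 * pi) ^+ n * (S * Y) * \sum_j N j ^+ 2.
  by rewrite mulr_sumr; apply: eq_bigr => j _; rewrite -/(N j) [LHS]mulrAC.
rewrite /Q -/S; move: ((2 * pi) ^+ n) P0 (\sum_j _) => P P0 V.
by field; rewrite gt_eqF.
Qed.
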